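(* Let $F|k$ be an extension of algebraically closed fields of characteristic zero of countably infinite transcendence degree, $G=G_{F|k}$, and let $v\in{\mathcal P}^1_F$. Let $W\in{\mathcal I}_G$ and let $V$ be any quotient of $W\otimes_{\mathbb Q}F$ (with the diagonal $G$-action) in the category of smooth semilinear representations of $G$ over $F$. Then the natural map $V_v\otimes_{{\mathcal O}_v}F\to V$ is an isomorphism and the natural map $\Gamma(V)\otimes_kF\to V$ is surjective.
   Context: For a subfield $K\subseteq F$, $G_{F|K}$ is the group of field automorphisms of $F$ over $K$; $G=G_{F|k}$ carries the topology in which the stabilizers of finite subsets of $F$ form a base of open subgroups. A representation is smooth if stabilizers of vectors are open; ${\mathcal S}m_G$ is the category of smooth ${\mathbb Q}$-linear representations of $G$. A smooth semilinear representation of $G$ over $F$ is an $F$-vector space $V$ with a smooth additive $G$-action satisfying $\sigma(fw)=\sigma(f)\sigma(w)$ for $\sigma\in G,f\in F,w\in V$; morphisms are $F$-linear $G$-equivariant maps. ${\mathcal I}_G\subset{\mathcal S}m_G$ is the full subcategory of those $W$ with $W^{G_{F|M}}=W^{G_{F|M'}}$ for every subfield $k\subseteq M\subseteq F$ and every purely transcendental extension $M'$ of $M$ in $F$. ${\mathcal P}^1_F$ is the set of valuation rings ${\mathcal O}_v\supseteq k$ in $F$ that are discrete of rank one: the value group $\Gamma_v=F^{\times}/{\mathcal O}_v^{\times}$ has $\dim_{\mathbb Q}\Gamma_v=1$ and $F$ is algebraic over the subfield generated over $k$ by some lift to ${\mathcal O}_v$ of a transcendence base of the residue field over $k$ and a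 lift to $F^\times$ of a basis of $\Gamma_v$. For $V\in{\mathcal S}m_G$, $V_v:=\sum_{F''}V^{G_{F|F''}}$, the sum over all subfields $k\subseteq F''\subset{\mathcal O}_v$, and $\Gamma(V):=\bigcap_{v\in{\mathcal P}^1_F}V_v$. If $V$ is a smooth semilinear representation, $V_v$ is an ${\mathcal O}_v$-submodule of $V$ and $\Gamma(V)$ is a $k$-subspace. *)

(* Defs.v *)
From HB Require Import structures.
From mathcomp Require Import all_boot all_order all_algebra.
From mathcomp Require Import generic_quotient ring_quotient.
From mathcomp Require Import boolp classical_sets.
From mathcomp Require Import freeg mpoly.

Set Implicit Arguments.
Unset Strict Implicit.
Unset Printing Implicit Defensive.

Import GRing.Theory.

Local Open Scope classical_set_scope.
Local Open Scope ring_scope.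

Section Subfields.
Variable F : fieldType.
Implicit Types (K M B : set F).

Definition subfield K := GRing.divring_closed (mem K).

Definition adjoin K B : set F := smallest subfield (K `|` B).

Definition algebraic_over K (x : F) :=
  exists2 p : {poly F}, p != 0 /\ (forall i, K p`_i) & root p x.

Definition alg_indep K B :=
  forall (n : nat) (t : 'I_n -> F), injective t -> (forall i, B (t i)) ->
  forall p : {mpoly F[n]}, (forall m, K p@_m) -> p.@[t] = 0 -> p = 0.

Definition transc_basis K B :=
  alg_indep K B /\ forall x, algebraic_over (adjoin K B) x.

Definition purely_transcendental M M' :=
  exists2 B, alg_indep M B & M' = adjoin M B.

End Subfields.

(* [tensor f M] is M (x)_A B, where B is an A-module through f : A -> B: the
   free abelian group on M x B modulo the subgroup generated by the usual
   relators, with B acting on the right-hand factor. *)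

Section Tensor.
Variables (A B : comNzRingType) (f : {rmorphism A -> B}) (M : lmodType A).

Local Notation free := {freeg (M * B)%type}.

Definition tens_relators : set free := fun x =>
  [\/ exists m m' b, x = << (m + m', b) >> - << (m, b) >> - << (m', b) >>,
      exists m b b', x = << (m, b + b') >> - << (m, b) >> - << (m, b') >>
    | exists a m b, x = << (a *: m, b) >> - << (m, f a * b) >>].

Definition tens_ideal : {pred free} :=
  fun x => x \in smallest (fun S : set free => GRing.zmod_closed (mem S))
                          tens_relators.

Fact tens_ideal_zmod : GRing.zmod_closed tens_ideal.
Proof.
split=> [|x y]; first by apply/mem_set => S [[S0 _] _]; exact/set_mem.
move=> /set_mem Ix /set_mem Iy; apply/mem_set => S hS.
have [[_ SB] _] := hS.
by apply/set_mem/SB; apply/mem_set; [exact: Ix | exact: Iy].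
Qed.
HB.instance Definition _ := GRing.isZmodClosed.Build free tens_ideal
  tens_ideal_zmod.

Definition tensor : Type := Quotient.quot tens_ideal.
HB.instance Definition _ := Choice.on tensor.
HB.instance Definition _ := GRing.Zmodule.on tensor.

Definition tens_pi (x : free) : tensor := (\pi_(Quotient.quot tens_ideal) x)%qT.

Definition tens_repr (x : tensor) : free := repr (x : Quotient.quot tens_ideal).

Lemma tens_reprK x : tens_pi (tens_repr x) = x.
Proof. exact: reprK. Qed.

Definition tens (m : M) (b : B) : tensor := tens_pi << (m, b) >>.

Lemma tens_piB x y : tens_pi (x - y) = tens_pi x - tens_pi y.
Proof.
exact: (raddfB (\pi_(Quotient.quot tens_ideal) : free -> Quotient.quot _)%qT).
Qed.
HB.instance Definition _ := GRing.isZmodMorphism.Build free tensor tens_pi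
  tens_piB.

Lemma tens_pi0 x : tens_relators x -> tens_pi x = 0.
Proof.
move=> rx; rewrite -[0](raddf0 tens_pi); apply/eqmodP => /=.
by rewrite /Quotient.equiv subr0; apply/mem_set; exact: sub_gen_smallest.
Qed.

Lemma tensDl m m' b : tens (m + m') b = tens m b + tens m' b.
Proof.
apply/eqP; rewrite -subr_eq0 opprD addrA -!raddfB; apply/eqP/tens_pi0.
by constructor 1; exists m, m', b.
Qed.

Lemma tensDr m b b' : tens m (b + b') = tens m b + tens m b'.
Proof.
apply/eqP; rewrite -subr_eq0 opprD addrA -!raddfB; apply/eqP/tens_pi0.
by constructor 2; exists m, b, b'.
Qed.

Lemma tensZ a m b : tens (a *: m) b = tens m (f a * b).
Proof.
apply/eqP; rewrite -subr_eq0 -!raddfB; apply/eqP/tens_pi0.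
by constructor 3; exists a, m, b.
Qed.

Lemma tens_ind (P : tensor -> Prop) :
  P 0 -> (forall x y, P x -> P y -> P (x - y)) ->
  (forall m b, P (tens m b)) -> forall x, P x.
Proof.
move=> P0 PB Pt x; rewrite -[x]tens_reprK; move: (tens_repr x) => D.
have PN y : P y -> P (- y) by move=> Py; rewrite -sub0r; exact: PB.
have PD y z : P y -> P z -> P (y + z).
  by move=> Py Pz; rewrite -[z]opprK; apply: PB => //; exact: PN.
rewrite -[D]freeg_sumE raddf_sum.
elim/big_ind: _ => // -[m b] _; rewrite -[coeff _ _]intz -freegU_mulz raddfMz.
have PMn n : P (tens m b *+ n).
  by elim: n => [|n IHn]; rewrite ?mulr0n // mulrS; exact: PD.
by case: (coeff _ _) => n; [exact: PMn | rewrite NegzE mulrNz; exact/PN/PMn].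
Qed.

Section Lift.
Variables (P : zmodType) (beta : M -> B -> P).

Definition balanced :=
  [/\ forall m m' b, beta (m + m') b = beta m b + beta m' b,
      forall m b b', beta m (b + b') = beta m b + beta m b'
    & forall a m b, beta (a *: m) b = beta m (f a * b)].

Definition tens_lift (x : tensor) : P :=
  fglift (fun z : M * B => beta z.1 z.2 : zmodule P) (tens_repr x).

Hypothesis hbeta : balanced.

Let ev : free -> zmodule P :=
  fglift (fun z : M * B => beta z.1 z.2 : zmodule P).

Let evB x y : ev (x - y) = ev x - ev y.
Proof. exact: lift_is_additive. Qed.

Let evU z : ev << z >> = beta z.1 z.2.
Proof. by rewrite /ev liftU scale1r. Qed.

Let ev0 : ev 0 = 0.
Proof. by rewrite -[0 in LHS](subrr 0) evB subrr. Qed.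

Let ev_ker x : x \in tens_ideal -> ev x = 0.
Proof.
move=> /set_mem; apply: (smallest_sub (X := fun x => ev x = 0)).
  split=> [|y z /set_mem hy /set_mem hz]; apply/mem_set => //.
  by move: hy hz; rewrite /= evB => -> ->; rewrite subr0.
have [h1 h2 h3] := hbeta.
move=> y [[m [m' [b ->]]]|[m [b [b' ->]]]|[a [m [b ->]]]].
- by rewrite 2!evB !evU /= h1 -addrA -opprD subrr.
- by rewrite 2!evB !evU /= h2 -addrA -opprD subrr.
- by rewrite evB !evU /= h3 subrr.
Qed.

Let tens_liftE x : tens_lift (tens_pi x) = ev x.
Proof.
apply/eqP; rewrite -subr_eq0 -[tens_lift _]/(ev _) -evB; apply/eqP/ev_ker.
by rewrite Quotient.idealrBE; apply/eqP; exact: tens_reprK.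
Qed.

Lemma tens_lift_tens m b : tens_lift (tens m b) = beta m b.
Proof. by rewrite tens_liftE evU. Qed.

Lemma tens_liftB x y : tens_lift (x - y) = tens_lift x - tens_lift y.
Proof.
rewrite -[x]tens_reprK -[y]tens_reprK -raddfB !tens_liftE.
exact: evB.
Qed.

End Lift.

Definition tens_scale (b0 : B) : tensor -> tensor :=
  tens_lift (fun m b => tens m (b0 * b)).

Let scale_bal b0 : balanced (fun m b => tens m (b0 * b)).
Proof.
split=> [m m' b|m b b'|a m b]; first exact: tensDl.
  by rewrite mulrDr tensDr.
by rewrite tensZ mulrCA.
Qed.

Let tens_scaleB b0 x y :
  tens_scale b0 (x - y) = tens_scale b0 x - tens_scale b0 y.
Proof. exact/tens_liftB/scale_bal. Qed.

Let tens_scale_tens b0 m b : tens_scale b0 (tens m b) = tens m (b0 * b).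
Proof. exact/tens_lift_tens/scale_bal. Qed.

Let tens_scale0 b0 : tens_scale b0 0 = 0.
Proof. by rewrite -[0 in LHS](subrr 0) tens_scaleB subrr. Qed.

Let tens_scaleA a b x : tens_scale a (tens_scale b x) = tens_scale (a * b) x.
Proof.
elim/tens_ind: x => [|x y hx hy|m c]; first by rewrite !tens_scale0.
  by rewrite !tens_scaleB hx hy.
by rewrite !tens_scale_tens mulrA.
Qed.

Let tens_scale1 x : tens_scale 1 x = x.
Proof.
elim/tens_ind: x => [|x y hx hy|m c]; first by rewrite tens_scale0.
  by rewrite tens_scaleB hx hy.
by rewrite tens_scale_tens mul1r.
Qed.

Let tens_scaleDr a x y : tens_scale a (x + y) = tens_scale a x + tens_scale a y.
Proof.
by rewrite -{1}[y]opprK -[- y]sub0r !tens_scaleB tens_scale0 sub0r opprK.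
Qed.

Let tens_scaleDl x a b :
  tens_scale (a + b) x = tens_scale a x + tens_scale b x.
Proof.
elim/tens_ind: x => [|x y hx hy|m c]; first by rewrite !tens_scale0 addr0.
  by rewrite !tens_scaleB hx hy opprD addrACA.
by rewrite !tens_scale_tens mulrDl tensDr.
Qed.

HB.instance Definition _ := GRing.Zmodule_isLmodule.Build B tensor
  tens_scaleA tens_scale1 tens_scaleDr tens_scaleDl.

Lemma scale_tens b0 m b : b0 *: tens m b = tens m (b0 * b).
Proof. exact: tens_scale_tens. Qed.

End Tensor.

(* Here V is an A-module by restriction of scalars along f : A -> B; submodules
   are A-submodules of V, and [natural_map N] is the map N (x)_A B -> V sending
   x (x) b to b *: x. *)

Section Submodule.
Variables (A B : comNzRingType) (f : {rmorphism A -> B}) (V : lmodType B).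

Definition is_submodule (S : set V) :=
  S 0 /\ forall a x y, S x -> S y -> S (f a *: x + y).

Record submodule := Submodule {
  submod_set : set V;
  submodP : is_submodule submod_set
}.

Variable N : submodule.

Definition submod_pred : {pred V} := mem (submod_set N).

Fact submod_pred_zmod : GRing.zmod_closed submod_pred.
Proof.
have [S0 SD] := submodP N; split=> [|x y Sx Sy]; first exact/mem_set.
apply/mem_set; rewrite addrC -scaleN1r -(rmorphN1 f).
by apply: SD; apply/set_mem.
Qed.
HB.instance Definition _ := GRing.isZmodClosed.Build V submod_pred
  submod_pred_zmod.

Record submod_sort : Type :=
  SubmodElt { submod_val : V; submod_valP : submod_val \in submod_pred }.
HB.instance Definition _ := [isSub for submod_val].
HB.instance Definition _ := [Choice of submod_sort by <:].
HB.instance Definition _ := [SubChoice_isSubZmodule of submod_sort by <:].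

Fact submod_scale_subproof a (x : submod_sort) :
  f a *: submod_val x \in submod_pred.
Proof.
have [S0 SD] := submodP N; apply/mem_set; rewrite -[_ *: _]addr0.
by apply: SD => //; apply/set_mem/submod_valP.
Qed.

Definition submod_scale a (x : submod_sort) :=
  SubmodElt (submod_scale_subproof a x).

Fact submod_scaleA a b x :
  submod_scale a (submod_scale b x) = submod_scale (a * b) x.
Proof. by apply: val_inj; rewrite /= scalerA rmorphM. Qed.

Fact submod_scale1 x : submod_scale 1 x = x.
Proof. by apply: val_inj; rewrite /= rmorph1 scale1r. Qed.

Fact submod_scaleDr a x y :
  submod_scale a (x + y) = submod_scale a x + submod_scale a y.
Proof. by apply: val_inj; rewrite /= scalerDr. Qed.

Fact submod_scaleDl x a b :
  submod_scale (a + b) x = submod_scale a x + submod_scale b x.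
Proof. by apply: val_inj; rewrite /= rmorphD scalerDl. Qed.

HB.instance Definition _ := GRing.Zmodule_isLmodule.Build A submod_sort
  submod_scaleA submod_scale1 submod_scaleDr submod_scaleDl.

Definition natural_map : tensor f submod_sort -> V :=
  tens_lift (fun x b => b *: submod_val x).

Lemma natural_map_tens x b : natural_map (tens f x b) = b *: submod_val x.
Proof.
apply: tens_lift_tens; split=> [m m' c|m c c'|a m c] /=.
- by rewrite scalerDr.
- by rewrite scalerDl.
- by rewrite scalerA mulrC.
Qed.

Lemma natural_map_is_linear a x y :
  natural_map (a *: x + y) = a *: natural_map x + natural_map y.
Proof.
have bal : balanced f (fun (z : submod_sort) b => b *: submod_val z).
  split=> [m m' c|m c c'|c m c'] /=.
  - by rewrite scalerDr.
  - by rewrite scalerDl.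
  - by rewrite scalerA mulrC.
have nB u w : natural_map (u - w) = natural_map u - natural_map w.
  exact: tens_liftB.
have n0 : natural_map 0 = 0 by rewrite -[0 in LHS](subrr 0) nB subrr.
rewrite -{1}[y]opprK nB -[- y]sub0r nB n0 sub0r opprK; congr (_ + _).
elim/tens_ind: x => [|u w hu hw|z b]; first by rewrite scaler0 n0 scaler0.
  by rewrite scalerBr !nB hu hw scalerBr.
by rewrite scale_tens !natural_map_tens scalerA.
Qed.

HB.instance Definition _ := GRing.isLinear.Build B (tensor f submod_sort) V _
  natural_map natural_map_is_linear.

End Submodule.

Arguments natural_map {A B f V} N _.

Section RatEmbedding.
Variables (F : fieldType) (char0 : [pchar F] =i pred0).

(* [ratr] has a canonical ring morphism structure only over numFieldType. *)
Definition ratF of [pchar F] =i pred0 : rat -> F := @ratr F.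

Let intF_eq0 (m : int) : ((m%:~R : F) == 0) = (m == 0).
Proof.
have natF n : ((n%:R : F) == 0) = (n == 0)%N by exact: (pcharf0P F).1.
by case: m => n; [exact: natF | rewrite NegzE mulrNz oppr_eq0 natF].
Qed.

Let ratF_frac (x y : int) : y != 0 -> ratr (x%:~R / y%:~R) = x%:~R / y%:~R :> F.
Proof.
move=> y0; rewrite /ratr; have d0 := denq_neq0 (x%:~R / y%:~R).
apply/eqP; rewrite eqr_div ?intF_eq0 //; apply/eqP.
rewrite -!intrM; congr (_%:~R); apply: (@intr_inj rat); rewrite !intrM.
have y0' : (y%:~R : rat) != 0 by rewrite intr_eq0.
by apply/eqP; rewrite -eqr_div ?intr_eq0 //; rewrite divq_num_den.
Qed.

Fact ratF_zmod : GRing.zmod_morphism (ratF char0).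
Proof.
move=> x y; rewrite /ratF -[x]divq_num_den -[y]divq_num_den.
have dF z : (denq z)%:~R != 0 :> F by rewrite intF_eq0 denq_neq0.
have dQ z : (denq z)%:~R != 0 :> rat by rewrite intr_eq0 denq_neq0.
rewrite -mulNr addf_div // -!(intrM, intrN, intrD) !ratF_frac ?mulf_neq0 ?denq_neq0 //.
by rewrite !(intrM, intrN, intrD) -mulNr addf_div // !(intrM, intrN, intrD).
Qed.

Fact ratF_monoid : GRing.monoid_morphism (ratF char0).
Proof.
split=> [|x y]; rewrite /ratF; first exact: (ratr_int F 1).
rewrite -[x]divq_num_den -[y]divq_num_den mulf_div -!intrM.
by rewrite !ratF_frac ?mulf_neq0 ?denq_neq0 // mulf_div -!intrM.
Qed.

HB.instance Definition _ := GRing.isZmodMorphism.Build rat F (ratF char0)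
  ratF_zmod.
HB.instance Definition _ := GRing.isMonoidMorphism.Build rat F (ratF char0)
  ratF_monoid.

End RatEmbedding.

Section Galois.
Variables (k F : fieldType) (iota : {rmorphism k -> F}).

Definition is_automorphism (s : F -> F) :=
  [/\ GRing.zmod_morphism s, GRing.monoid_morphism s, bijective s
    & forall a, s (iota a) = iota a].

Record gal : Type := Gal { gal_fun :> F -> F; _ : `[< is_automorphism gal_fun >] }.
HB.instance Definition _ := [isSub for gal_fun].
HB.instance Definition _ := [Choice of gal by <:].

Fact galP (s : gal) : is_automorphism s.
Proof. exact/asboolP/(valP s). Qed.

Fact gal_zmod (s : gal) : GRing.zmod_morphism s. Proof. by case: (galP s). Qed.
Fact gal_monoid (s : gal) : GRing.monoid_morphism s.
Proof. by case: (galP s). Qed.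
HB.instance Definition _ (s : gal) := GRing.isZmodMorphism.Build F F s
  (gal_zmod s).
HB.instance Definition _ (s : gal) := GRing.isMonoidMorphism.Build F F s
  (gal_monoid s).

Fact gal_one_subproof : `[< is_automorphism id >].
Proof. by apply/asboolP; split=> //; exists id. Qed.

Fact gal_mul_subproof (s t : gal) : `[< is_automorphism (s \o t) >].
Proof.
apply/asboolP; have [_ _ bs fs] := galP s; have [_ _ bt ft] := galP t.
split=> [x y|||a] /=; first by rewrite !rmorphB.
- by split=> [|x y] /=; rewrite ?rmorph1 ?rmorphM.
- exact: bij_comp.
- by rewrite ft fs.
Qed.

Definition gal_inv_fun (s : gal) (y : F) : F := xget 0 [set x | s x = y].

Fact gal_invK (s : gal) : cancel (gal_inv_fun s) s.
Proof.
move=> y; have [_ _ [g _ sg] _] := galP s.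
by rewrite /gal_inv_fun; case: xgetP => [x _ //|/(_ (g y))]; rewrite /= sg.
Qed.

Fact gal_invVK (s : gal) : cancel s (gal_inv_fun s).
Proof. exact: inj_can_sym (gal_invK s) (fmorph_inj s). Qed.

Fact gal_inv_subproof (s : gal) : `[< is_automorphism (gal_inv_fun s) >].
Proof.
have sK := gal_invK s; have sI : injective (gal_fun s) := fmorph_inj s; apply/asboolP.
have [_ _ _ fs] := galP s; split=> [x y|||a].
- by apply: sI; rewrite [LHS]sK [RHS](rmorphB s) /= !sK.
- split=> [|x y]; apply: sI; first by rewrite [LHS]sK [RHS](rmorph1 s).
  by rewrite [LHS]sK [RHS](rmorphM s) /= !sK.
- by exists s => //; exact: gal_invVK.
- by rewrite -{1}fs gal_invVK.
Qed.

Definition gal_one := Gal gal_one_subproof.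
Definition gal_mul s t := Gal (gal_mul_subproof s t).
Definition gal_inv s := Gal (gal_inv_subproof s).

Fact gal_mulA : associative gal_mul. Proof. by move=> s t u; exact: val_inj. Qed.
Fact gal_mul1 : left_id gal_one gal_mul. Proof. by move=> s; exact: val_inj. Qed.
Fact gal_1mul : right_id gal_one gal_mul.
Proof. by move=> s; exact: val_inj. Qed.
Fact gal_mulV : left_inverse gal_one gal_inv gal_mul.
Proof. by move=> s; apply: val_inj; apply/funext => x; exact: gal_invVK. Qed.
Fact gal_Vmul : right_inverse gal_one gal_inv gal_mul.
Proof. by move=> s; apply: val_inj; apply/funext => x; exact: gal_invK. Qed.

HB.instance Definition _ := isGroup.Build gal
  gal_mulA gal_mul1 gal_1mul gal_mulV gal_Vmul.

Definition gal_over (M : set F) : set gal :=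
  [set s | forall x, M x -> s x = x].

(* The topology in which the stabilizers of finite subsets of F form a base of
   open subgroups: U is open iff, with each of its points s, it contains a coset
   of the stabilizer of some finite S. *)
Definition gal_open (U : set gal) :=
  forall s, U s -> exists S : seq F, forall t, gal_over [set` S] t ->
    U (s * t)%g.

Definition fixed (V : Type) (act : gal -> V -> V) (H : set gal) : set V :=
  [set x | forall s, H s -> act s x = x].

Definition is_action (V : Type) (act : gal -> V -> V) :=
  (forall x, act 1%g x = x) /\
  (forall s t x, act (s * t)%g x = act s (act t x)).

Definition is_smooth (V : Type) (act : gal -> V -> V) :=
  forall x, gal_open [set s | act s x = x].

Record smooth_rep := SmoothRep {
  rep_sort :> lmodType rat;
  rep_act : gal -> rep_sort -> rep_sort;
  rep_actP : is_action rep_act;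
  rep_act_linear : forall s a x y,
    rep_act s (a *: x + y) = a *: rep_act s x + rep_act s y;
  rep_smooth : is_smooth rep_act
}.

Record semilinear_rep := SemilinearRep {
  slin_sort :> lmodType F;
  slin_act : gal -> slin_sort -> slin_sort;
  slin_actP : is_action slin_act;
  slin_actD : forall s x y, slin_act s (x + y) = slin_act s x + slin_act s y;
  slin_actZ : forall s a x, slin_act s (a *: x) = s a *: slin_act s x;
  slin_smooth : is_smooth slin_act
}.

Definition is_morphism (V V' : semilinear_rep) (q : V -> V') :=
  (forall a x y, q (a *: x + y) = a *: q x + q y) /\
  (forall s x, q (slin_act s x) = slin_act s (q x)).

Definition in_I_G (W : smooth_rep) :=
  forall M M' : set F, subfield M -> range iota `<=` M ->
    purely_transcendental M M' ->
    fixed (@rep_act W) (gal_over M) = fixed (@rep_act W) (gal_over M').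

Section TensorRep.
Variables (char0 : [pchar F] =i pred0) (W : smooth_rep).

Local Notation WF := (tensor (ratF char0) W).

Definition tensor_act (s : gal) : WF -> WF :=
  tens_lift (fun w a => tens (ratF char0) (rep_act s w) (s a)).

Let rep_actD s (x y : W) : rep_act s (x + y) = rep_act s x + rep_act s y.
Proof. by rewrite -[x]scale1r rep_act_linear !scale1r. Qed.

Let rep_act0 s : rep_act s (0 : W) = 0.
Proof. by apply: (addrI (rep_act s 0)); rewrite -rep_actD !addr0. Qed.

Let rep_actZ s a (x : W) : rep_act s (a *: x) = a *: rep_act s x.
Proof. by rewrite -[_ *: x]addr0 rep_act_linear rep_act0 addr0. Qed.

Let act_bal s :
  balanced (ratF char0) (fun (w : W) a => tens (ratF char0) (rep_act s w) (s a)).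
Proof.
split=> [m m' b|m b b'|a m b].
- by rewrite rep_actD tensDl.
- by rewrite rmorphD tensDr.
- by rewrite rep_actZ tensZ rmorphM fmorph_rat.
Qed.

Lemma tensor_act_tens s w a :
  tensor_act s (tens (ratF char0) w a) = tens (ratF char0) (rep_act s w) (s a).
Proof. exact/tens_lift_tens/act_bal. Qed.

Let tensor_actB s x y : tensor_act s (x - y) = tensor_act s x - tensor_act s y.
Proof. exact/tens_liftB/act_bal. Qed.

Let tensor_act0 s : tensor_act s 0 = 0.
Proof. by rewrite -[0 in LHS](subrr 0) tensor_actB subrr. Qed.

Let tensor_actP : is_action tensor_act.
Proof.
have [a1 aM] := rep_actP W; split=> [x|s t x].
  elim/tens_ind: x => [|x y hx hy|w a]; first exact: tensor_act0.
    by rewrite tensor_actB hx hy.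
  by rewrite tensor_act_tens a1.
elim/tens_ind: x => [|x y hx hy|w a]; first by rewrite !tensor_act0.
  by rewrite !tensor_actB hx hy.
by rewrite !tensor_act_tens aM.
Qed.

Let tensor_actD s x y : tensor_act s (x + y) = tensor_act s x + tensor_act s y.
Proof.
by rewrite -{1}[y]opprK -[- y]sub0r !tensor_actB tensor_act0 sub0r opprK.
Qed.

Let tensor_actZ s a x : tensor_act s (a *: x) = s a *: tensor_act s x.
Proof.
elim/tens_ind: x => [|x y hx hy|w b].
- by rewrite scaler0 tensor_act0 scaler0.
- by rewrite scalerBr !tensor_actB hx hy scalerBr.
- by rewrite scale_tens !tensor_act_tens scale_tens rmorphM.
Qed.

Let tensor_smooth : is_smooth tensor_act.
Proof.
have [a1 aM] := rep_actP W.
have fin (x : WF) : exists S : seq F, forall t, gal_over [set` S] t ->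
    tensor_act t x = x.
  elim/tens_ind: x => [|x y [S hS] [T hT]|w a].
  - by exists [::] => t _; rewrite tensor_act0.
  - exists (S ++ T) => t ht; rewrite tensor_actB hS ?hT // => z /= zS;
    by apply: ht; rewrite /= mem_cat zS ?orbT.
  - have [S hS] := @rep_smooth W w 1%g (a1 w).
    exists (a :: S) => t ht; rewrite tensor_act_tens ht /= ?inE ?eqxx //.
    congr tens; rewrite -[t]mul1g; apply: hS => z /= zS.
    by apply: ht; rewrite /= inE zS orbT.
move=> x s /= sx; have [S hS] := fin x; exists S => t /hS tx /=.
by rewrite (tensor_actP.2) tx.
Qed.

Definition tensor_rep : semilinear_rep :=
  SemilinearRep tensor_actP tensor_actD tensor_actZ tensor_smooth.

End TensorRep.

Record valuation_ring := ValuationRing {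
  vring_pred : {pred F};
  vring_subring : GRing.subring_closed vring_pred;
  vring_val : forall x, (x \in vring_pred) || (x^-1 \in vring_pred);
  vring_base : forall a, iota a \in vring_pred
}.

HB.instance Definition _ v := GRing.isSubringClosed.Build F (vring_pred v)
  (vring_subring v).

Record vring (v : valuation_ring) : Type :=
  Vring { vring_elt : F; _ : vring_elt \in vring_pred v }.
HB.instance Definition _ v := [isSub for @vring_elt v].
HB.instance Definition _ v := [Choice of vring v by <:].
HB.instance Definition _ v := [SubChoice_isSubComNzRing of vring v by <:].

Definition vring_unit (v : valuation_ring) (x : F) :=
  [/\ x != 0, x \in vring_pred v & x^-1 \in vring_pred v].

(* [res] identifies [kappa] with the residue field of [v]. *)
Definition is_residue_map v (kappa : fieldType)
    (res : {rmorphism vring v -> kappa}) :=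
  (forall z, exists x, res x = z) /\
  (forall x, res x = 0 <-> ~ vring_unit v (\val x)).

(* [nu] identifies the value group of [v], which is uniquely divisible when [F]
   is algebraically closed of characteristic zero, with (the additive group of)
   the rational vector space [Gamma].  The value of [nu] at 0 is irrelevant. *)
Definition is_value_map v (Gamma : vectType rat) (nu : F -> Gamma) :=
  [/\ forall g, exists2 x, x != 0 & nu x = g,
      forall x y, x != 0 -> y != 0 -> nu (x * y) = nu x + nu y
    & forall x, x != 0 -> nu x = 0 <-> vring_unit v x].

(* [B] lifts a transcendence basis of the residue field over k, and [t] lifts a
   basis of the value group. *)
Definition discrete_rank_one : set valuation_ring := fun v =>
  exists (kappa : fieldType) (res : {rmorphism vring v -> kappa})
         (Gamma : vectType rat) (nu : F -> Gamma),
  [/\ is_residue_map res, is_value_map v nu, \dim {:Gamma} = 1%N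
    & exists (B : set (vring v)) (t : F),
      [/\ {in B &, injective res},
          transc_basis [set res (Vring (vring_base v a)) | a in setT] (res @` B),
          t != 0, basis_of {:Gamma} [:: nu t]
        & forall x, algebraic_over (adjoin (range iota)
                                           (\val @` B `|` [set t])) x]].

Section Vv.
Variables (V : zmodType) (act : gal -> V -> V).

(* The sum, i.e. the set of finite sums of elements, of the subspaces fixed by
   G_{F|M}, over all subfields M with k <= M <= O_v. *)
Definition Vv (v : valuation_ring) : set V := fun x =>
  exists (n : nat) (w : 'I_n -> V),
    (forall i, exists M : set F,
      [/\ subfield M, range iota `<=` M, {subset M <= vring_pred v}
        & fixed act (gal_over M) (w i)])
    /\ x = \sum_(i < n) w i.

Definition Gamma_set : set V := \bigcap_(v in discrete_rank_one) Vv v.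

End Vv.

Fact Gamma_submodule (V : semilinear_rep) :
  is_submodule iota (Gamma_set (@slin_act V)).
Proof.
have act0 s : slin_act s (0 : V) = 0.
  by apply: (addrI (slin_act s 0)); rewrite -slin_actD !addr0.
split=> [v _|a x y hx hy v hv].
  by exists 0%N, (fun _ => 0); split=> [[]//|]; rewrite big_ord0.
have [n [w [hw ->]]] := hx v hv; have [m [u [hu ->]]] := hy v hv.
exists (n + m)%N, (fun i => match fintype.split i with
                            | inl j => iota a *: w j | inr j => u j end).
split=> [i|].
  case: fintype.split => j; last exact: hu.
  have [M [hM kM Mv fw]] := hw j; exists M; split=> // s sM.
  by rewrite slin_actZ fw // sM //; apply: kM; exists a.
rewrite big_split_ord scaler_sumr; congr (_ + _); apply: eq_bigr => i _.
  by rewrite (unsplitK (inl i)).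
by rewrite (unsplitK (inr i)).
Qed.

Definition Gamma (V : semilinear_rep) : submodule iota V :=
  Submodule (Gamma_submodule V).

End Galois.

(* Main.v *)
Require Import Defs.
From Stdlib Require Import Ring.
From HB Require Import structures.
From mathcomp Require Import freeg mpoly.
From mathcomp Require Import all_boot all_order all_algebra.
From mathcomp Require Import polyXY separable.
From mathcomp Require Import boolp classical_sets.

Set Implicit Arguments.
Unset Strict Implicit.
Unset Printing Implicit Defensive.

Import GRing.Theory.

Local Open Scope classical_set_scope.
Local Open Scope ring_scope.

(** Everything rests on two facts about v. (1) W = W_v for W in I_G. Let w be
    fixed by the stabilizer of a finite set l. Discreteness gives a subfield
    E c O_v, algebraically closed in F, an element t of positive value and a
    unit u whose residue is transcendental over E, such that l is algebraic
    over E(t); so E(t, l) is the function field of a curve over E on which v is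
    a closed point. One finds coordinates (pi, h) of a plane model that is
    smooth at this point and takes the pencil of lines c = pi + u h. Since
    E(u, c) is purely transcendental over E, the sum S of the G_{F|E(u,c)}-orbit
    of w is fixed by G_{F|E}. The conjugates of w other than w come from
    conjugate points of the curve whose residue is a generic point, hence lie
    in W_v, and so does w. (2) V_v is stable under O_v. For x fixed by G_{F|M}
    with M c O_v algebraically closed, if some residue is transcendental over
    M, then up to an element of M every a in O_v has such a residue or is a
    difference of two such elements; otherwise one may assume that a has
    positive value, and there are y in M and an automorphism g
    that fixes x, sends y to y + a and is the identity modulo the maximal ideal,
    so that a x = g(y x) - y x.

    Given (1), V is spanned over F by the images of the w (x) 1, which lie in
    V_v for every v. Injectivity is automatic: as O_v is a valuation ring, every
    element of a tensor product with F is a pure tensor. *)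

(** The obstacle in (1) is that the field E(t, l) over which w is fixed contains 1/t, so it does not
    lie in O_v, while membership in I_G compares fixed vectors only along purely transcendental
    extensions. The orbit sum over E(u, c) makes the comparison with E possible, at the cost of the
    other conjugates s w. These are settled by a dichotomy on the algebraic closure of E(s t) in F.
    If it contains an element of O_v whose residue is transcendental over E, then by exchange it is
    the closure of E and that element; such a field lies in O_v, and s w is fixed over it. Otherwise
    its residues all lie in E, and then s fixes (pi, h), hence w: the point (s pi, s h) is on the
    same line c = pi + u h, both points reduce to the origin, and a line of residually generic slope
    is not tangent to the curve there. At a singular origin distinct points could meet after
    reduction, so smoothness of the model is essential. Infinite transcendence degree enters twice:
    it leaves a u independent of the finite list l, and in (2) it leaves a y in M independent of the
    finite set that supports x. *)

(* Folding the structure operations of MathComp into constants over one fixed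
   carrier makes Stdlib's [ring] applicable. *)
Section RingTactic.
Variable R : comNzRingType.

Definition ring_add (x y : R) : R := x + y.
Definition ring_mul (x y : R) : R := x * y.
Definition ring_opp (x : R) : R := - x.
Definition ring_one : R := 1.
Definition ring_zero : R := 0.

Lemma ring_addE x y : x + y = ring_add x y. Proof. by []. Qed.
Lemma ring_mulE x y : x * y = ring_mul x y. Proof. by []. Qed.
Lemma ring_oppE x : - x = ring_opp x. Proof. by []. Qed.
Lemma ring_oneE : 1 = ring_one. Proof. by []. Qed.
Lemma ring_zeroE : 0 = ring_zero. Proof. by []. Qed.

Lemma com_ring_theory : @ring_theory R ring_zero ring_one ring_add ring_mul
  (fun x y => ring_add x (ring_opp y)) ring_opp eq.
Proof.
rewrite /ring_add /ring_mul /ring_opp /ring_one /ring_zero.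
split=> *; rewrite ?add0r ?mul1r ?mulrDl ?subrr //.
all: by rewrite ?addrA ?mulrA // 1?addrC // 1?mulrC.
Qed.

Lemma ring_eqI x y : ring_add ring_zero x = ring_add ring_zero y -> x = y.
Proof. exact: addrI. Qed.

End RingTactic.

Ltac mc_ring R :=
  rewrite ?(@ring_addE R, @ring_mulE R, @ring_oppE R, @ring_oneE R, @ring_zeroE R);
  apply: (@ring_eqI R); ring.

(** * Subfields and relative algebraic closure *)

Lemma subf_div (F : fieldType) (a b c d : F) : b != 0 -> d != 0 ->
  a / b - c / d = (a * d - c * b) / (b * d).
Proof. by move=> b0 d0; rewrite -mulNr addf_div // mulNr. Qed.

Section SubfieldType.
Variables (F : fieldType) (K : set F) (hK : subfield K).

Lemma subfield1 : K 1. Proof. by have [/set_mem] := hK. Qed.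
Lemma subfieldB x y : K x -> K y -> K (x - y).
Proof. by have [_ h _] := hK; move=> /mem_set hx /mem_set hy; apply/set_mem/h. Qed.
Lemma subfield_div x y : K x -> K y -> K (x / y).
Proof. by have [_ _ h] := hK; move=> /mem_set hx /mem_set hy; apply/set_mem/h. Qed.
Lemma subfield0 : K 0. Proof. by rewrite -(subrr 1); apply: subfieldB subfield1 subfield1. Qed.
Lemma subfieldN x : K x -> K (- x).
Proof. by rewrite -sub0r; apply: subfieldB subfield0. Qed.
Lemma subfieldD x y : K x -> K y -> K (x + y).
Proof. by move=> hx hy; rewrite -[y]opprK; apply: subfieldB => //; exact: subfieldN. Qed.
Lemma subfieldV x : K x -> K x^-1.
Proof. by rewrite -div1r; apply: subfield_div subfield1. Qed.
Lemma subfieldM x y : K x -> K y -> K (x * y).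
Proof. by move=> hx hy; rewrite -[y]invrK; apply: subfield_div => //; exact: subfieldV. Qed.
Lemma subfieldX x n : K x -> K (x ^+ n).
Proof.
by move=> hx; elim: n => [|n IHn]; [exact: subfield1 | rewrite exprS; exact: subfieldM].
Qed.

(** The proof is an argument so that the closure instance can be inferred from the predicate
    alone. *)
Definition subfield_pred of subfield K : {pred F} := mem K.
HB.instance Definition _ := GRing.isDivringClosed.Build F (subfield_pred hK) hK.

Record subfieldT : Type := SubfieldT { subfield_val : F; _ : subfield_val \in subfield_pred hK }.
HB.instance Definition _ := [isSub for subfield_val].
HB.instance Definition _ := [Choice of subfieldT by <:].
HB.instance Definition _ := [SubChoice_isSubIntegralDomain of subfieldT by <:].
HB.instance Definition _ := [SubIntegralDomain_isSubField of subfieldT by <:].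

Definition subfield_inj : {rmorphism subfieldT -> F} := (\val : {rmorphism subfieldT -> F}).

Lemma subfield_injP (x : subfieldT) : K (subfield_inj x).
Proof. by apply/set_mem; exact: (valP x). Qed.

Lemma subfield_lift x : K x -> exists y, x = subfield_inj y.
Proof. by move=> /mem_set hx; exists (SubfieldT hx). Qed.

Lemma subfield_predE x : (x \in subfield_pred hK) <-> K x.
Proof. by split=> [/set_mem|/mem_set]. Qed.

Lemma subfield_polyOverP (p : {poly F}) :
  (p \is a polyOver (subfield_pred hK)) <-> forall i, K p`_i.
Proof.
by split=> [/polyOverP h i|h]; [apply/subfield_predE/h | apply/polyOverP => i; apply/subfield_predE/h].
Qed.

Lemma subfield_poly_lift (p : {poly F}) :
  (forall i, K p`_i) -> exists q, p = map_poly subfield_inj q.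
Proof.
move=> hp; have /choice[f hf] : forall i, exists y, p`_i = subfield_inj y.
  by move=> i; exact: subfield_lift.
exists (\poly_(i < size p) f i); apply/polyP => i.
rewrite coef_map coef_poly; case: ltnP => [//|si].
by rewrite nth_default // ?rmorph0.
Qed.

Lemma subfield_poly_map q i : K (map_poly subfield_inj q)`_i.
Proof. by rewrite coef_map; exact: subfield_injP. Qed.

Lemma subfield_horner (p : {poly F}) x : (forall i, K p`_i) -> K x -> K p.[x].
Proof.
move=> /subfield_polyOverP hp /subfield_predE hx; apply/subfield_predE.
exact: rpred_horner.
Qed.

(** Passing to the field type [subfieldT] gives access to the closure properties of [algebraicOver],
    from which [acl_subfield] and [acl_trans] follow. *)
Lemma algebraic_overE x : algebraic_over K x <-> algebraicOver subfield_inj x.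
Proof.
split=> [[p [p0 /subfield_poly_lift[q pq]] px]|[q q0 qx]].
  by exists q; rewrite -?pq //; apply: contraNneq p0 => q0; rewrite pq q0 rmorph0.
exists (map_poly subfield_inj q) => //; split; first by rewrite map_poly_eq0.
exact: subfield_poly_map.
Qed.

Lemma acl_subfield : subfield (algebraic_over K).
Proof.
split=> [|x y|x y].
- by apply/mem_set/algebraic_overE/algebraic1.
- move=> /set_mem/algebraic_overE hx /set_mem/algebraic_overE hy.
  exact/mem_set/algebraic_overE/algebraic_sub.
- move=> /set_mem/algebraic_overE hx /set_mem/algebraic_overE hy.
  exact/mem_set/algebraic_overE/algebraic_div.
Qed.

Lemma sub_acl : K `<=` algebraic_over K.
Proof. by move=> x /subfield_lift[y ->]; apply/algebraic_overE/algebraic_id. Qed.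

Lemma acl_trans x : algebraic_over (algebraic_over K) x -> algebraic_over K x.
Proof.
case=> p [p0 hp] px; apply/algebraic_overE/integral_algebraic.
apply: (integral_root p0 px) => _ /(nthP 0)[i _ <-].
exact/integral_algebraic/algebraic_overE/hp.
Qed.

End SubfieldType.

Section Closure.
Variables (F : fieldType) (k0 : set F).
Implicit Types (S T M N : set F).

Lemma algebraic_over_mono M N x : M `<=` N -> algebraic_over M x -> algebraic_over N x.
Proof. by move=> MN [p [p0 hp] px]; exists p => //; split=> // i; exact/MN/hp. Qed.

Lemma adjoin_subfield M S : subfield (adjoin M S).
Proof.
split=> [|x y|x y].
- by apply/mem_set => N [hN _]; exact: subfield1.
- move=> /set_mem hx /set_mem hy; apply/mem_set => N hN.
  by apply: subfieldB; [case: hN | exact: hx | exact: hy].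
- move=> /set_mem hx /set_mem hy; apply/mem_set => N hN.
  by apply: subfield_div; [case: hN | exact: hx | exact: hy].
Qed.

Lemma sub_adjoinl M S : M `<=` adjoin M S.
Proof. by move=> x Mx; apply: sub_gen_smallest; left. Qed.

Lemma sub_adjoinr M S : S `<=` adjoin M S.
Proof. by move=> x Mx; apply: sub_gen_smallest; right. Qed.

Lemma adjoin_min M S N : subfield N -> M `<=` N -> S `<=` N -> adjoin M S `<=` N.
Proof. by move=> hN MN SN; apply: smallest_sub => // x [/MN|/SN]. Qed.

(** The closure operator of algebraic dependence over [k0]; [cl_min], [cl_fin] and [cl_exchange]
    make it a finitary matroid. *)
Definition adjoin_acl S : set F := algebraic_over (adjoin k0 S).

Lemma cl_subfield S : subfield (adjoin_acl S).
Proof. exact/acl_subfield/adjoin_subfield. Qed.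

Lemma adjoin_sub_cl S : adjoin k0 S `<=` adjoin_acl S.
Proof. exact/sub_acl/adjoin_subfield. Qed.

Lemma sub_cl S : S `<=` adjoin_acl S.
Proof. by move=> x Sx; apply: adjoin_sub_cl; apply: sub_adjoinr. Qed.

Lemma base_cl S : k0 `<=` adjoin_acl S.
Proof. by move=> x Sx; apply: adjoin_sub_cl; apply: sub_adjoinl. Qed.

Lemma acl_cl S x : algebraic_over (adjoin_acl S) x -> adjoin_acl S x.
Proof. exact/acl_trans/adjoin_subfield. Qed.

Lemma cl_min S T : S `<=` adjoin_acl T -> adjoin_acl S `<=` adjoin_acl T.
Proof.
move=> ST x hx; apply: acl_cl; apply: algebraic_over_mono hx.
by apply: adjoin_min ST; [exact: cl_subfield | exact: base_cl].
Qed.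

Lemma cl_mono S T : S `<=` T -> adjoin_acl S `<=` adjoin_acl T.
Proof. by move=> ST; apply: cl_min => x /ST; exact: sub_cl. Qed.

Lemma cl_cl S : adjoin_acl (adjoin_acl S) = adjoin_acl S.
Proof. by apply/seteqP; split; [apply: cl_min | apply: sub_cl]. Qed.

Lemma cl_fin S x : adjoin_acl S x -> exists2 s : seq F, [set` s] `<=` S & adjoin_acl [set` s] x.
Proof.
(* [D] is the union of the fields generated by finite parts of [S]; two of them lie in a third by
   concatenation, so the union is a field. *)
pose D := [set x | exists2 s : seq F, [set` s] `<=` S & adjoin k0 [set` s] x].
have cat_sub (s1 s2 : seq F) : [set` s1] `<=` S -> [set` s2] `<=` S -> [set` s1 ++ s2] `<=` S.
  by move=> h1 h2 y /=; rewrite mem_cat => /orP[/h1|/h2].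
have catl (s1 s2 : seq F) : adjoin k0 [set` s1] `<=` adjoin k0 [set` s1 ++ s2].
  apply: adjoin_min; [exact: adjoin_subfield | exact: sub_adjoinl |].
  by move=> y ys; apply: sub_adjoinr; rewrite /= mem_cat ys.
have catr (s1 s2 : seq F) : adjoin k0 [set` s2] `<=` adjoin k0 [set` s1 ++ s2].
  apply: adjoin_min; [exact: adjoin_subfield | exact: sub_adjoinl |].
  by move=> y ys; apply: sub_adjoinr; rewrite /= mem_cat ys orbT.
have hD : subfield D.
  split=> [|y z|y z].
  - apply/mem_set; exists [::]; first by move=> y /=; rewrite inE.
    by apply: subfield1; apply: adjoin_subfield.
  - move=> /set_mem[s1 h1 y1] /set_mem[s2 h2 y2]; apply/mem_set; exists (s1 ++ s2); first exact: cat_sub h1 h2.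
    by apply: (subfieldB (adjoin_subfield _ _)); [exact: catl y1 | exact: catr y2].
  - move=> /set_mem[s1 h1 y1] /set_mem[s2 h2 y2]; apply/mem_set; exists (s1 ++ s2); first exact: cat_sub h1 h2.
    by apply: (subfield_div (adjoin_subfield _ _)); [exact: catl y1 | exact: catr y2].
have SD : adjoin k0 S `<=` D.
  apply: adjoin_min => // y hy.
    by exists [::]; [move=> z /=; rewrite inE | exact: sub_adjoinl].
  exists [:: y]; first by move=> z /=; rewrite inE => /eqP ->.
  by apply: sub_adjoinr; rewrite /= inE.
have finD (l : seq F) : (forall y, y \in l -> D y) ->
    exists2 s : seq F, [set` s] `<=` S & forall y, y \in l -> adjoin k0 [set` s] y.
  elim: l => [|a l IHl] hl; first by exists [::] => // y /=; rewrite inE.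
  have [|s1 h1 hs1] := IHl; first by move=> y yl; apply: hl; rewrite inE yl orbT.
  have [s2 h2 hs2] := hl a (mem_head _ _).
  exists (s1 ++ s2); first exact: cat_sub h1 h2.
  by move=> y; rewrite inE => /predU1P[->|/hs1 hy]; [exact: catr | exact: catl].
case=> p [p0 hp] px; have [|s sS hs] := finD p.
  by move=> _ /(nthP 0)[i _ <-]; by apply: SD; apply: hp.
exists s => //; exists p => //; split=> // i.
have [ip|ip] := ltnP i (size p); first by apply: hs; apply: mem_nth.
by rewrite nth_default //; by apply: subfield0; apply: adjoin_subfield.
Qed.

End Closure.

(** * Fractions over a simple extension and the exchange property *)

Section Exchange.
Variables (F : fieldType).

Section Frac.
Variables (M : set F) (hM : subfield M) (y : F).

Lemma adjoin1P x : adjoin M [set y] x ->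
  exists p q : {poly F}, [/\ forall i, M p`_i, forall i, M q`_i, q.[y] != 0 &
    x = p.[y] / q.[y]].
Proof.
pose D := [set x | exists p q : {poly F}, [/\ p \is a polyOver (subfield_pred hM),
    q \is a polyOver (subfield_pred hM), q.[y] != 0 & x = p.[y] / q.[y]]].
have DC c : M c -> D c.
  move=> hc; exists c%:P, 1; split; rewrite ?hornerC ?oner_eq0 ?divr1 ?rpred1 //.
  by rewrite polyOverC; apply/subfield_predE.
have hD : subfield D.
  split=> [|a b|a b].
  - by apply/mem_set/DC; exact: subfield1.
  - move=> /set_mem[p1 [q1 [hp1 hq1 n1 ->]]] /set_mem[p2 [q2 [hp2 hq2 n2 ->]]].
    apply/mem_set; exists (p1 * q2 - p2 * q1), (q1 * q2).
    split; rewrite ?rpredB ?rpredM // ?hornerE ?mulf_neq0 //.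
    by rewrite subf_div.
  - move=> /set_mem[p1 [q1 [hp1 hq1 n1 ->]]] /set_mem[p2 [q2 [hp2 hq2 n2 ->]]].
    apply/mem_set; have [p20|p20] := eqVneq p2.[y] 0.
      by rewrite p20 mul0r invr0 mulr0; apply: DC; exact: subfield0.
    exists (p1 * q2), (q1 * p2).
    split; rewrite ?rpredB ?rpredM // ?hornerE ?mulf_neq0 //.
    by rewrite invf_div mulf_div.
move=> hx; have [//|z ->|p [q [/subfield_polyOverP hp /subfield_polyOverP hq q0 ->]]] := adjoin_min hD _ _ hx.
  by exists 'X, 1; split; rewrite ?hornerE ?oner_eq0 ?divr1 ?rpred1 ?polyOverX.
by exists p, q.
Qed.

(** In [P] the outer variable is that of [p] and the inner one stands for [y], so the relation can
    be read in either direction. *)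
Lemma clear_denom (p : {poly F}) : (forall i, adjoin M [set y] p`_i) ->
  exists (P : {poly {poly F}}) (d : {poly F}), [/\ forall i j, M P`_i`_j,
    forall i, M d`_i, d.[y] != 0 & map_poly (horner_eval y) P = d.[y] *: p].
Proof.
elim/poly_ind: p => [|p c IHp] hp.
  exists 0, 1; split=> [i j|i||]; rewrite ?rmorph0 ?scaler0 ?hornerE ?oner_eq0 //.
    by rewrite !coef0; exact: subfield0.
  by rewrite coef1; case: (i == 0%N); [exact: subfield1 | exact: subfield0].
have [|P [d [hP hd d0 eP]]] := IHp.
  by move=> i; have := hp i.+1; rewrite coefD coefMX coefC addr0.
have := hp 0%N; rewrite coefD coefMX coefC add0r => /adjoin1P[r [q [/(subfield_polyOverP hM) hr hq q0 ec]]].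
move: hd hq => /(subfield_polyOverP hM) hd /(subfield_polyOverP hM) hq.
exists (P * q%:P * 'X + (r * d)%:P), (d * q); split=> [i|||].
- apply/(subfield_polyOverP hM); rewrite coefD coefMX coefC coefMC.
  apply: rpredD; last by case: ifP => _; rewrite ?rpredM ?rpred0.
  case: ifP => _; first by rewrite rpred0.
  by apply: rpredM => //; apply/subfield_polyOverP.
- by apply/subfield_polyOverP/rpredM.
- by rewrite hornerM mulf_neq0.
- rewrite rmorphD !rmorphM /= eP map_polyX !map_polyC /= /horner_eval.
  rewrite scalerDr !hornerM ec -!mul_polyC -!polyCM; congr (_ + _%:P); last first.
    by rewrite [r.[y] / _]mulrC mulrA mulfK // mulrC.
  by rewrite polyCM -!mulrA; congr (_ * _); rewrite mulrCA.
Qed.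
End Frac.

(** With denominators cleared, the equation of [x] over M(y) is a relation in two variables, read
    here as an equation for [y] over M(x). It cannot vanish identically: each of its coefficients
    would be a polynomial over M with root [x], hence zero. *)
Lemma acl_exchange (M : set F) x y : subfield M ->
  algebraic_over (adjoin M [set y]) x -> ~ algebraic_over M x ->
  algebraic_over (adjoin M [set x]) y.
Proof.
move=> hM [p [p0 hp] px] nx.
have [P [d [hP hd d0 eP]]] := clear_denom hM hp.
have hx : adjoin M [set x] x by apply: sub_adjoinr.
have hA := adjoin_subfield M [set x].
exists P.[x%:P]; last first.
  by rewrite /root -horner2_swapXY horner_swapXY eP hornerZ (eqP px) mulr0.
have QE : P.[x%:P] = map_poly (horner_eval x) (swapXY P).
  by rewrite -{1}[P]swapXYK horner_swapXY.
split; last first.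
  move=> j; rewrite QE coef_map; apply: (subfield_horner hA) => // i.
  by rewrite coef_swapXY; apply: sub_adjoinl.
apply/eqP => Q0; have : swapXY P = 0.
  apply/polyP => j; rewrite coef0; apply/eqP/negP => /negP sj; apply: nx.
  exists (swapXY P)`_j; first by split=> // i; rewrite coef_swapXY.
  have := congr1 (fun q : {poly F} => q`_j) Q0.
  by rewrite /root QE coef_map coef0 => /eqP.
move=> /eqP; rewrite swapXY_eq0 => /eqP P0; move: eP; rewrite P0 rmorph0.
by move/esym/eqP; rewrite scaler_eq0 (negPf d0) (negPf p0).
Qed.

Lemma adjoinU (k0 : set F) S T : adjoin k0 (S `|` T) = adjoin (adjoin k0 S) T.
Proof.
apply/seteqP; split; apply: adjoin_min; try exact: adjoin_subfield.
- by move=> x kx; do 2 apply: sub_adjoinl.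
- by move=> x [Sx|Tx]; [apply: sub_adjoinl; apply: sub_adjoinr | apply: sub_adjoinr].
- apply: adjoin_min; first exact: adjoin_subfield; first exact: sub_adjoinl.
  by move=> x Sx; apply: sub_adjoinr; left.
- by move=> x Tx; apply: sub_adjoinr; right.
Qed.

Lemma cl_exchange (k0 : set F) S x y :
  adjoin_acl k0 (S `|` [set y]) x -> ~ adjoin_acl k0 S x -> adjoin_acl k0 (S `|` [set x]) y.
Proof.
rewrite /adjoin_acl !adjoinU => h1 h2; apply: acl_exchange h1 h2; exact: adjoin_subfield.
Qed.

End Exchange.

(** * Algebraic independence and multivariate polynomials *)

Section MpolyUni.
Variables (n : nat) (R : comNzRingType).

Lemma meval_mwiden (p : {mpoly R[n]}) (t : 'I_n.+1 -> R) :
  (mwiden p).@[t] = p.@[fun i => t (widen_ord (leqnSn n) i)].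
Proof.
rewrite /mwiden /mmap raddf_sum /= mevalE; apply: eq_bigr => m _.
rewrite mevalM mevalC /mmap1 rmorph_prod /=; congr (_ * _).
by apply: eq_bigr => i _; rewrite rmorphXn /= mevalXU.
Qed.

Lemma muni_Xwiden (i : 'I_n) :
  muni ('X_(widen_ord (leqnSn n) i) : {mpoly R[n.+1]}) = ('X_i)%:P.
Proof.
rewrite muniE msuppX big_seq1 mcoeffX eqxx scale1r mnm1E.
rewrite -val_eqE /= ltn_eqF // expr0 -[LHS]mul_polyC mulr1; congr ('X_[_])%:P.
by apply/mnmP => j; rewrite mnmE !mnm1E -val_eqE.
Qed.

Lemma muni_mwiden (p : {mpoly R[n]}) : muni (mwiden p) = p%:P.
Proof.
rewrite /mwiden /mmap raddf_sum /= [p in RHS]mpolyE raddf_sum /=.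
apply: eq_bigr => m _; rewrite muniM muniC /mmap1 rmorph_prod /= mpolyXE_id.
rewrite -mul_mpolyC polyCM rmorph_prod /=; congr (_ * _).
by apply: eq_bigr => i _; rewrite !rmorphXn /= muni_Xwiden.
Qed.

Lemma muni_Xmax : muni ('X_ord_max : {mpoly R[n.+1]}) = 'X.
Proof.
rewrite muniE msuppX big_seq1 mcoeffX eqxx scale1r mnm1E eqxx expr1.
rewrite (_ : [multinom _ | i < n] = 0%MM) ?mpolyX0 ?scale1r //.
apply/mnmP => i; rewrite mnmE mnm1E mnm0E; apply/eqP; rewrite eqb0.
by rewrite -val_eqE /= neq_ltn ltn_ord orbT.
Qed.

End MpolyUni.

Lemma set_cat_sub (T : eqType) (B : set T) (s1 s2 : seq T) :
  [set` s1] `<=` B -> [set` s2] `<=` B -> [set` s1 ++ s2] `<=` B.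
Proof. by move=> h1 h2 y /=; rewrite mem_cat => /orP[/h1|/h2]. Qed.

Section Gen.
Variables (F : fieldType) (K : set F) (hK : subfield K).

(** The ring K[s], given by values of polynomials rather than as a smallest subring, so that a
    polynomial is at hand when [alg_indep] is applied. *)
Definition mgen (s : seq F) : set F := fun x =>
  exists2 p : {mpoly F[size s]}, p \is a mpolyOver (size s) (subfield_pred hK) & x = p.@[fun i => s`_i].

Lemma mgen_subring s : GRing.subring_closed (mem (mgen s)).
Proof.
split=> [|x y|x y].
- by apply/mem_set; exists 1; rewrite ?meval1 // rpred1.
- by move=> /set_mem[p hp ->] /set_mem[q hq ->]; apply/mem_set; exists (p - q);
     rewrite ?mevalB // rpredB.
- by move=> /set_mem[p hp ->] /set_mem[q hq ->]; apply/mem_set; exists (p * q);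
     rewrite ?mevalM // rpredM.
Qed.

Definition mgen_pred s : {pred F} := mem (mgen s).
HB.instance Definition _ s := GRing.isSubringClosed.Build F (mgen_pred s) (mgen_subring s).

Lemma mgenC s c : K c -> c \in mgen_pred s.
Proof.
by move=> hc; apply/mem_set; exists c%:MP; rewrite ?mevalC // mpolyOverC; apply/subfield_predE.
Qed.

Lemma mgen_mem s x : x \in s -> x \in mgen_pred s.
Proof.
move=> xs; apply/mem_set; have ix : (index x s < size s)%N by rewrite index_mem.
exists 'X_(Ordinal ix); first exact: mpolyOverX.
by rewrite mevalXU /= nth_index.
Qed.

Lemma mgen_mono s1 s2 : {subset s1 <= s2} -> {subset mgen_pred s1 <= mgen_pred s2}.
Proof.
move=> s12 x /set_mem[p /mpolyOverP hp ->]; rewrite mevalE.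
apply: rpred_sum => m _; apply: rpredM.
  by apply: mgenC; apply/subfield_predE/hp.
by apply: rpred_prod => i _; apply/rpredX/mgen_mem/s12/mem_nth.
Qed.

Lemma mgen_catl s1 s2 : {subset mgen_pred s1 <= mgen_pred (s1 ++ s2)}.
Proof. by apply: mgen_mono => y ys; rewrite mem_cat ys. Qed.

Lemma mgen_catr s1 s2 : {subset mgen_pred s2 <= mgen_pred (s1 ++ s2)}.
Proof. by apply: mgen_mono => y ys; rewrite mem_cat ys orbT. Qed.

Lemma adjoinP (B : set F) x : adjoin K B x ->
  exists (s : seq F) a b, [/\ [set` s] `<=` B, a \in mgen_pred s, b \in mgen_pred s,
    b != 0 & x = a / b].
Proof.
pose D := [set x | exists (s : seq F) a b, [/\ [set` s] `<=` B, a \in mgen_pred s,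
    b \in mgen_pred s, b != 0 & x = a / b]].
have DC c : K c -> D c.
  move=> hc; exists [::], c, 1; split; rewrite ?divr1 ?rpred1 ?oner_eq0 //.
  exact: mgenC.
have hD : subfield D.
  split=> [|x1 x2|x1 x2].
  - by apply/mem_set/DC; exact: subfield1.
  - move=> /set_mem[s1 [a1 [b1 [h1 ha1 hb1 n1 ->]]]] /set_mem[s2 [a2 [b2 [h2 ha2 hb2 n2 ->]]]].
    apply/mem_set; exists (s1 ++ s2), (a1 * b2 - a2 * b1), (b1 * b2).
    rewrite mulf_neq0 //; split=> //; first exact: set_cat_sub h1 h2.
    + by rewrite rpredB // rpredM // ?(mgen_catl _ ha1) ?(mgen_catl _ hb1) ?(mgen_catr _ ha2) ?(mgen_catr _ hb2).
    + by rewrite rpredM // ?(mgen_catl _ hb1) ?(mgen_catr _ hb2).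
    + by rewrite subf_div.
  - move=> /set_mem[s1 [a1 [b1 [h1 ha1 hb1 n1 ->]]]] /set_mem[s2 [a2 [b2 [h2 ha2 hb2 n2 ->]]]].
    apply/mem_set; have [a20|a20] := eqVneq a2 0.
      by rewrite a20 mul0r invr0 mulr0; apply: DC; exact: subfield0.
    exists (s1 ++ s2), (a1 * b2), (b1 * a2).
    rewrite mulf_neq0 //; split=> //; first exact: set_cat_sub h1 h2.
    + by rewrite rpredM // ?(mgen_catl _ ha1) ?(mgen_catr _ hb2).
    + by rewrite rpredM // ?(mgen_catl _ hb1) ?(mgen_catr _ ha2).
    + by rewrite invf_div mulf_div.
apply: (adjoin_min hD) => [y hy|y hy]; first exact: DC. 
exists [:: y], y, 1; split; rewrite ?divr1 ?rpred1 ?oner_eq0 //.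
  by move=> z /=; rewrite inE => /eqP ->.
by apply: mgen_mem; rewrite inE.
Qed.

Lemma common_denom (B : set F) (p : {poly F}) : (forall i, adjoin K B p`_i) ->
  exists (s : seq F) d, [/\ [set` s] `<=` B, d != 0, d \in mgen_pred s & forall i, (d *: p)`_i \in mgen_pred s].
Proof.
elim/poly_ind: p => [|p c IHp] hp.
  by exists [::], 1; split=> [||| i]; rewrite ?oner_eq0 ?rpred1 // scaler0 coef0 rpred0.
have [|s1 [d [h1 d0 hdd hd]]] := IHp.
  by move=> i; have := hp i.+1; rewrite coefD coefMX coefC addr0.
have := hp 0%N; rewrite coefD coefMX coefC add0r => /adjoinP[s2 [a [b [h2 ha hb b0 ec]]]].
exists (s1 ++ s2), (d * b); rewrite mulf_neq0 // rpredM ?(mgen_catl _ hdd) ?(mgen_catr _ hb) //.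
split=> //; first exact: set_cat_sub h1 h2.
move=> i; rewrite coefZ coefD coefMX coefC; case: i => [|i] /=.
  rewrite add0r ec -mulrA (mulrC b) divfK // rpredM ?(mgen_catl _ hdd) ?(mgen_catr _ ha) //.
rewrite addr0 mulrAC -coefZ rpredM ?(mgen_catr _ hb) //.
by apply: mgen_catl; exact: hd.
Qed.

(** Passes from independence stated by polynomials to independence for the closure operator. An
    equation of [u], cleared of denominators, is a polynomial relation [Q] between [u], as last
    variable, and a finite list; [muni] recovers its coefficients and shows them to vanish. *)
Lemma alg_indep_not_acl (B : set F) u : alg_indep K B -> B u ->
  ~ algebraic_over (adjoin K (B `\ u)) u.
Proof.
move=> iB Bu [p [p0 hp] pu].
have [s0 [d [h0 d0 _ hd]]] := common_denom hp.
(* [alg_indep] speaks of injective families, so repetitions are removed. *)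
pose s := undup s0.
have hs : [set` s] `<=` B `\ u by move=> y /=; rewrite mem_undup; exact: h0.
have ds i : exists r : {mpoly F[size s]}, r \is a mpolyOver (size s) (subfield_pred hK) /\
    (d *: p)`_i = r.@[fun i => s`_i].
  have /set_mem[r hr er] : (d *: p)`_i \in mgen_pred s.
    by apply: mgen_mono (hd i) => y; rewrite mem_undup.
  by exists r.
have /choice[r hr] := ds.
(* The default value [u] of [nth] is what the last index [size s] receives. *)
pose N := size p; pose t (i : 'I_(size s).+1) := nth u s i.
pose Q : {mpoly F[(size s).+1]} := \sum_(i < N) mwiden (r i) * 'X_ord_max ^+ i.
have tinj : injective t.
  move=> i j; have us : uniq (rcons s u).
    by rewrite rcons_uniq undup_uniq andbT; apply/negP => /hs[_ /=]; exact.
  have tE (k : 'I_(size s).+1) : t k = nth u (rcons s u) k.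
    rewrite /t nth_rcons; case: ltnP => // ks; case: eqP => // _; exact: nth_default.
  rewrite !tE => /eqP; rewrite nth_uniq ?size_rcons // => /eqP; exact: val_inj.
have tB i : B (t i).
  rewrite /t; have [si|si] := ltnP i (size s); last by rewrite nth_default.
  by have [] := hs _ (mem_nth u si).
have Q0 : Q = 0.
  apply: (iB _ t) => //.
    move=> m; apply/(subfield_predE hK); move: m; apply/mpolyOverP; apply: rpred_sum => i _.
    apply: rpredM; last by apply: rpredX; apply: mpolyOverX.
    rewrite /mwiden /mmap; apply: rpred_sum => m _; apply: rpredM.
      by rewrite mpolyOverC; apply/mpolyOverP; case: (hr i).
    by apply: rpred_prod => j _; apply: rpredX; apply: mpolyOverX.
  rewrite rmorph_sum /=; under eq_bigr => i _.
    rewrite rmorphM rmorphXn /= mevalXU meval_mwiden.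
    rewrite (_ : (r i).@[_] = (d *: p)`_i); last first.
      have [_ ->] := hr i; apply: meval_eq => j; rewrite /t /=.
      exact: set_nth_default.
    rewrite (_ : t ord_max = u); last by rewrite /t nth_default.
    rewrite coefZ -mulrA; over.
  by rewrite -mulr_sumr -horner_coef (eqP pu) mulr0.
have : muni Q = 0 by rewrite Q0 muni0.
rewrite rmorph_sum /= => muQ; case/negP: p0; apply/eqP/polyP => i.
rewrite coef0; have [iN|iN] := ltnP i N; last by rewrite nth_default.
have ri0 : r i = 0.
  have := congr1 (fun q : {poly {mpoly F[size s]}} => q`_i) muQ.
  rewrite coef0 coef_sum => <-.
  rewrite (bigD1 (Ordinal iN)) //= big1 => [|j ji].
    by rewrite rmorphM rmorphXn /= muni_Xmax muni_mwiden coefCM coefXn eqxx mulr1 addr0.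
  rewrite rmorphM rmorphXn /= muni_Xmax muni_mwiden coefCM coefXn.
  by rewrite -val_eqE /= eq_sym in ji; rewrite (negPf ji) mulr0.
have [_] := hr i; rewrite ri0 meval0 coefZ => /eqP.
by rewrite mulf_eq0 (negPf d0) => /eqP.
Qed.

Lemma alg_indep1 (u : F) : ~ algebraic_over K u -> alg_indep K [set u].
Proof.
move=> nu [|[|n]] t ti tB p hp pt.
- by move: pt; rewrite [p]nvar0_mpolyC mevalC => ->.
- pose q : {poly F} := mmap (@polyC F) (fun _ => 'X) p.
  have qE : q = \sum_(m <- msupp p) p@_m *: 'X^(m ord0).
    by apply: eq_bigr => m _; rewrite /mmap1 big_ord1 mul_polyC.
  have qc (m : 'X_{1..1}) : q`_(m ord0) = p@_m.
    rewrite qE coef_sum [p in RHS]mpolyE raddf_sum /=; apply: eq_bigr => m' _.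
    rewrite coefZ coefXn mcoeffZ mcoeffX; congr (_ * (nat_of_bool _)%:R).
    rewrite eq_sym; apply/eqP/eqP => [e|-> //].
    by apply/mnmP => i; rewrite ord1.
  have qu : q.[u] = 0.
    rewrite -pt qE horner_sum mevalE; apply: eq_bigr => m _.
    by rewrite hornerZ hornerXn big_ord1 (tB ord0).
  have [q0|q0] := eqVneq q 0; first by apply/mpolyP => m; rewrite mcoeff0 -qc q0 coef0.
  case: nu; exists q; last exact/eqP.
  split=> // i; rewrite qE coef_sum; apply/(subfield_predE hK); apply: rpred_sum => m _.
  rewrite coefZ coefXn; apply: rpredM; first exact/subfield_predE.
  exact: rpred_nat.
- have /ti/eqP : t ord0 = t (fintype.lift ord0 ord0) by rewrite (tB ord0) (tB (fintype.lift ord0 ord0)).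
  by [].
Qed.

End Gen.

(** * Valuation rings *)

Section Valuation.
Variables (k : fieldType) (F : closedFieldType) (iota : {rmorphism k -> F}).
Variable v : valuation_ring iota.

Local Notation O := (vring_pred v).
Local Notation cl := (adjoin_acl (range iota)).

(** The maximal ideal of the valuation ring. *)
Definition vmax : set F := fun x => x \in O /\ forall y, y \in O -> x * y <> 1.
Local Notation m := vmax.

Lemma vmaxO x : m x -> x \in O. Proof. by case. Qed.

Lemma vmax0 : m 0.
Proof. by split=> [|y _]; [exact: rpred0 | rewrite mul0r => /esym/eqP; rewrite oner_eq0]. Qed.

Lemma vmax1 : ~ m 1.
Proof. by case=> _ /(_ 1 (rpred1 _)); rewrite mulr1. Qed.

Lemma vmaxMl x y : x \in O -> m y -> m (x * y).
Proof.
move=> hx [hy ny]; split=> [|z hz]; first exact: rpredM.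
by rewrite mulrAC mulrC; apply: ny; rewrite rpredM.
Qed.

Lemma vmaxMr x y : m x -> y \in O -> m (x * y).
Proof. by move=> hx hy; rewrite mulrC; exact: vmaxMl. Qed.

Lemma vmaxN x : m x -> m (- x).
Proof. by rewrite -mulN1r; apply: vmaxMl; rewrite rpredN1. Qed.

Lemma vmaxD x y : m x -> m y -> m (x + y).
Proof.
(* Of two elements of F, one is a multiple of the other by an element of O_v. *)
wlog hxy : x y / exists2 a, a \in O & x = a * y.
  move=> H mx my; have [-> |y0] := eqVneq y 0; first by rewrite addr0.
  have [-> |x0] := eqVneq x 0; first by rewrite add0r.
  have /orP[h|] := vring_val v (x / y).
    by apply: H => //; exists (x / y) => //; rewrite divfK.
  by rewrite invf_div => h; rewrite addrC; apply: H => //; exists (y / x); rewrite ?divfK.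
case: hxy => a ha -> _ my; rewrite -[X in _ + X]mul1r -mulrDl.
by apply: vmaxMl => //; rewrite rpredD // rpred1.
Qed.

Lemma vmaxB x y : m x -> m y -> m (x - y).
Proof. by move=> hx /vmaxN; exact: vmaxD. Qed.

Lemma vmax_sum (I : Type) (r : seq I) (P : pred I) (f : I -> F) :
  (forall i, P i -> m (f i)) -> m (\sum_(i <- r | P i) f i).
Proof. by move=> hf; elim/big_ind: _ => //; [exact: vmax0 | exact: vmaxD]. Qed.

Lemma vmaxV x : x \notin O -> m x^-1.
Proof.
move=> nx; have /orP[|hx] := vring_val v x; first by rewrite (negPf nx).
split=> // y hy e; have x0 : x != 0 by apply: contraNneq nx => ->; rewrite rpred0.
by case/negP: nx; rewrite -[x]mulr1 -e mulrA divff // mul1r.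
Qed.

Lemma vunitV x : x \in O -> ~ m x -> x^-1 \in O.
Proof.
move=> hx nx; apply/negPn/negP => nVx; apply: nx.
by rewrite -[x]invrK; exact: vmaxV.
Qed.

Lemma vmax_prime x y : x \in O -> m (x * y) -> y \in O -> m x \/ m y.
Proof.
move=> hx mxy hy; have [mx|nx] := EM (m x); [by left | right].
have x0 : x != 0 by apply/eqP => x0; apply: nx; rewrite x0; exact: vmax0.
by rewrite -[y](mulKf x0); apply: vmaxMl => //; exact: vunitV.
Qed.

Lemma vmaxX x n : x \in O -> m (x ^+ n) -> m x.
Proof.
move=> hx; elim: n => [|n IHn]; first by rewrite expr0 => /vmax1.
by rewrite exprS => /(vmax_prime hx)[]; rewrite ?rpredX.
Qed.

Lemma vringX x n : (0 < n)%N -> x ^+ n \in O -> x \in O.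
Proof.
move=> n0 hx; apply/negPn/negP => nx; have x0 : x != 0.
  by apply: contraNneq nx => ->; rewrite rpred0.
have := vmaxMl hx (vmaxMr (vmaxV nx) (rpredX n.-1 (vmaxO (vmaxV nx)))).
by rewrite -exprS prednK // exprVn mulfV ?expf_neq0 //; exact: vmax1.
Qed.

Lemma vmax_prod (s : seq F) x : x \in O -> {in s, forall a, a \in O} ->
  m (\prod_(a <- s) (x - a)) -> exists2 a, a \in s & m (x - a).
Proof.
move=> hx; elim: s => [|a s IHs] hs; first by rewrite big_nil => /vmax1.
have hO b : b \in a :: s -> x - b \in O by move=> bs; rewrite rpredB // hs.
have hs' : {in s, forall b, x - b \in O} by move=> b bs; rewrite hO // inE bs orbT.
rewrite big_cons => /vmax_prime[||ma|/IHs[|b bs mb]].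
- by apply: hO; exact: mem_head.
- by rewrite big_seq rpred_prod.
- by exists a; rewrite ?mem_head.
- by move=> b bs; rewrite hs // inE bs orbT.
- by exists b; rewrite // inE bs orbT.
Qed.

Lemma subfield_vmax (M : set F) x : subfield M -> M `<=` [set` O] -> M x -> m x -> x = 0.
Proof.
move=> hM MO Mx mx; apply/eqP/negPn/negP => x0; case: mx => _ /(_ x^-1).
by rewrite divff //; apply => //; apply: MO; exact: subfieldV.
Qed.

(** If [x] were outside O_v, its inverse would lie in the maximal ideal; dividing the equation by
    the top power of [x] would put the leading coefficient, a nonzero element of the field M, there
    too. *)
Lemma vring_acl (M : set F) x : subfield M -> M `<=` [set` O] -> algebraic_over M x -> x \in O.
Proof.
move=> hM MO [p [p0 hp] px]; apply/negPn/negP => nx.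
have x0 : x != 0 by apply: contraNneq nx => ->; rewrite rpred0.
have mV := vmaxV nx.
have sp : size p = (size p).-1.+1 by rewrite prednK // lt0n size_poly_eq0.
have l0 : lead_coef p != 0 by rewrite lead_coef_eq0.
move/rootP: px; rewrite horner_coef sp big_ord_recr /= -/(lead_coef p) => /eqP.
rewrite addrC addr_eq0 => /eqP h; case/eqP: l0; apply: (subfield_vmax hM MO); first exact: hp.
have xn0 := expf_neq0 (size p).-1 x0.
rewrite -[lead_coef p](mulfK xn0) h mulNr; apply: vmaxN.
rewrite mulr_suml; apply: vmax_sum => i _; rewrite -mulrA; apply: vmaxMl; first exact/MO/hp.
rewrite -invf_div -expfB // -exprVn -(subnSK (ltn_ord i)) exprS.
by apply: vmaxMr => //; apply/rpredX/(vmaxO mV).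
Qed.

Lemma cl_sub_vring S : adjoin (range iota) S `<=` [set` O] -> cl S `<=` [set` O].
Proof. by move=> h x hx; apply: vring_acl h hx; exact: adjoin_subfield. Qed.

Lemma poly_congr (p q : {poly F}) x y : x \in O -> y \in O -> m (x - y) ->
  p \is a polyOver O -> (forall i, m (p`_i - q`_i)) -> m (p.[x] - q.[y]).
Proof.
move=> hx hy mxy /polyOverP hp hpq; elim/poly_ind: p q hp hpq => [|p c IHp] q hp hpq.
  rewrite horner0 sub0r; apply: vmaxN; rewrite horner_coef; apply: vmax_sum => i _.
  apply: vmaxMr; last exact: rpredX.
  by have /vmaxN := hpq i; rewrite coef0 sub0r opprK.
pose q' := drop_poly 1 q; have eq_q : q = q' * 'X + (q`_0)%:P.
  apply/polyP => i; rewrite coefD coefMX coefC coef_drop_poly.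
  by case: i => [|i] /=; rewrite ?add0r ?addr0 ?addn1.
have hpi i : p`_i \in O by have := hp i.+1; rewrite coefD coefMX coefC addr0.
have IH : m (p.[x] - q'.[y]).
  apply: IHp => // i; have := hpq i.+1.
  by rewrite coefD coefMX coefC addr0 coef_drop_poly addn1.
have := hpq 0%N; rewrite coefD coefMX coefC add0r => hc.
rewrite eq_q !hornerE opprD addrACA; apply: vmaxD => //.
rewrite (_ : _ - _ = (p.[x] - q'.[y]) * y + p.[x] * (x - y)).
  apply: vmaxD; first exact: vmaxMr.
  by apply: vmaxMl => //; apply: rpred_horner => //; exact/polyOverP.
by rewrite mulrBl mulrBr [RHS]addrC addrA subrK.
Qed.

(** * Residues over a relatively algebraically closed field of constants *)

Section AlgClosed.
Variables (E : set F) (clE : cl E = E) (EO : E `<=` [set` O]).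

Let hE : subfield E. Proof. by rewrite -clE; exact: cl_subfield. Qed.

Lemma closed_acl x : algebraic_over E x -> E x.
Proof. by rewrite -{2}clE => h; apply: acl_cl; rewrite clE. Qed.

Lemma closed_adjoinE S : adjoin (range iota) (E `|` S) = adjoin E S.
Proof.
rewrite adjoinU; congr adjoin; apply/seteqP; split.
  by rewrite -{2}clE; exact: adjoin_sub_cl.
exact: sub_adjoinr.
Qed.

Lemma poly_factorE (p : {poly F}) : p != 0 -> (forall i, E p`_i) ->
  exists c r, [/\ E c, c != 0, {in r, forall a, E a} & forall x, p.[x] = c * \prod_(a <- r) (x - a)].
Proof.
move=> p0 hp; have [r er] := closed_field_poly_normal p.
exists (lead_coef p), r; split; rewrite ?lead_coef_eq0 //; first exact: hp.
  move=> a ar; apply: closed_acl; exists p => //.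
  by rewrite er rootZ ?lead_coef_eq0 // root_prod_XsubC.
move=> x; rewrite [in LHS]er hornerZ horner_prod; congr (_ * _).
by apply: eq_bigr => a _; rewrite hornerXsubC.
Qed.

(** A nonzero polynomial over E is a constant times factors z - a with a in E. These are units
    because the residue of [z] is not in E, so denominators in E(z) are invertible in O_v. *)
Lemma vring_adjoin z : z \in O -> (forall e, E e -> ~ m (z - e)) ->
  cl (E `|` [set z]) `<=` [set` O].
Proof.
move=> hz nz; apply: cl_sub_vring; rewrite closed_adjoinE => x /(adjoin1P hE)[p [q [hp hq q0 ->]]].
have q00 : q != 0 by apply: contraNneq q0 => ->; rewrite horner0.
have OE : p.[z] \in O by apply: rpred_horner => //; apply/polyOverP => i; exact/EO/hp.
apply: rpredM => //; have [c [r [Ec c0 rE ->]]] := poly_factorE q00 hq.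
rewrite invfM rpredM //; first by apply: EO; exact: subfieldV.
apply: vunitV.
  by rewrite big_seq rpred_prod // => a ar; rewrite rpredB //; exact/EO/rE.
by case/vmax_prod => // [a /rE|a /rE /nz //]; exact: EO.
Qed.

Lemma poly_shift (p : {poly F}) : p != 0 -> (forall i, E p`_i) ->
  exists n (q : {poly F}), [/\ p = 'X^n * q, forall i, E q`_i & q`_0 != 0].
Proof.
move=> p0 hp; have [n [q q0 e]] := multiplicity_XsubC p 0.
rewrite p0 /= in q0; rewrite subr0 mulrC in e; exists n, q; split=> //.
  by move=> i; have := hp (n + i)%N; rewrite e coefXnM ltnNge leq_addr addKn.
by rewrite -horner_coef0.
Qed.

Section Residue.
Variable t : F.
Hypotheses (mt : m t) (t0 : t != 0).

Lemma vmax_horner0 (q : {poly F}) : (forall i, E q`_i) -> m (q.[t] - q`_0).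
Proof.
move=> hq; rewrite -horner_coef0; apply: poly_congr; rewrite ?subr0 ?rpred0 ?(vmaxO mt) //.
  by apply/polyOverP => i; exact/EO/hq.
by move=> i; rewrite subrr; exact: vmax0.
Qed.

(** Once powers of [t] are split off, numerator and denominator are polynomials in [t] with nonzero
    constant terms, to which they reduce. So the values on E(t) are the integer multiples of that of
    [t]. *)
Lemma adjoin_normal x : x != 0 -> adjoin E [set t] x ->
  exists a b y e, [/\ E e, e != 0, m (y - e), y \in O & x = t ^+ a / t ^+ b * y].
Proof.
move=> x0 /(adjoin1P hE)[p [q [hp hq q0 ex]]].
have p00 : p != 0 by apply: contraNneq x0 => p0; rewrite ex p0 horner0 mul0r.
have q00 : q != 0 by apply: contraNneq q0 => ->; rewrite horner0.
have [a [p' [ep hp' p'0]]] := poly_shift p00 hp.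
have [b [q' [eq_q hq' q'0]]] := poly_shift q00 hq.
have nm e y : E e -> e != 0 -> m (y - e) -> y \in O /\ ~ m y.
  move=> Ee e0 me; split; first by rewrite -(subrK e y) rpredD // ?(vmaxO me) // (EO Ee).
  move=> my; case/eqP: e0; apply: (subfield_vmax hE EO) => //.
  by rewrite -(subKr y e); exact: vmaxB.
have [Op np] := nm _ _ (hp' 0%N) p'0 (vmax_horner0 hp').
have [Oq nq] := nm _ _ (hq' 0%N) q'0 (vmax_horner0 hq').
exists a, b, (p'.[t] / q'.[t]), (p'`_0 / q'`_0).
have qt0 : q'.[t] != 0 by apply/eqP => qt; apply: nq; rewrite qt; exact: vmax0.
have OVq := vunitV Oq nq.
split; first exact: subfield_div.
- by rewrite mulf_neq0 ?invr_neq0.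
- rewrite subf_div //; apply: vmaxMr; last first.
    by rewrite invfM rpredM //; apply: EO; exact: subfieldV.
  rewrite (_ : _ - _ = (p'.[t] - p'`_0) * q'`_0 - p'`_0 * (q'.[t] - q'`_0)).
    apply: vmaxB; [apply: vmaxMr | apply: vmaxMl]; try exact: vmax_horner0.
      exact: EO.
    exact: EO.
  by rewrite mulrBl mulrBr opprB addrA subrK.
- exact: rpredM.
- by rewrite ex ep eq_q !hornerM !hornerXn mulf_div.
Qed.

Lemma adjoin_residue x : adjoin E [set t] x -> x \in O -> exists2 e, E e & m (x - e).
Proof.
move=> hx Ox; have [->|x0] := eqVneq x 0.
  by exists 0; rewrite ?subrr; [exact: subfield0 | exact: vmax0].
have [a [b [y [e [Ee e0 me Oy ex]]]]] := adjoin_normal x0 hx.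
have ny : ~ m y.
  move=> my; case/eqP: e0; apply: (subfield_vmax hE EO) => //.
  by rewrite -(subKr y e); exact: vmaxB.
have y0 : y != 0 by apply/eqP => y0; apply: ny; rewrite y0; exact: vmax0.
have [ab|] := ltnP a b.
  case: ny; rewrite (_ : y = t ^+ (b - a) * x).
    by rewrite -(subnSK ab) exprS; apply: vmaxMr => //; apply: vmaxMr => //; rewrite rpredX ?(vmaxO mt).
  by rewrite ex expfB // mulrA mulf_div [t ^+ b * _]mulrC divff ?mulf_neq0 ?expf_neq0 // mul1r.
rewrite leq_eqVlt => /predU1P[ba|ba].
  by exists e => //; rewrite ex ba divff ?expf_neq0 // mul1r.
exists 0; first exact: subfield0.
rewrite subr0 ex -expfB // -(subnSK ba) exprS.
by apply: vmaxMr => //; apply: vmaxMr => //; rewrite rpredX ?(vmaxO mt).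
Qed.

(** [c] is an entry of least value: dividing by it keeps the list in O_v and makes one entry equal
    to 1. *)
Lemma max_coef (s : seq F) : has (fun c => c != 0) s ->
  exists2 c, (c \in s) && (c != 0) & {in s, forall x, x / c \in O}.
Proof.
elim: s => // a s IHs; have [hs _|ns] := boolP (has (fun c => c != 0) s).
  have [c /andP[cs c0] hc] := IHs hs.
  have [ac|nac] := boolP (a / c \in O).
    by exists c; rewrite ?inE ?cs ?orbT ?c0 // => x; rewrite inE => /predU1P[->|/hc].
  have a0 : a != 0 by apply: contraNneq nac => ->; rewrite mul0r rpred0.
  have hca : c / a \in O by rewrite -invf_div; exact/vmaxO/vmaxV.
  exists a; first by rewrite mem_head.
  move=> x; rewrite inE => /predU1P[->|/hc xc]; first by rewrite divff ?rpred1.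
  have -> : x / a = (x / c) * (c / a) by rewrite mulrA divfK.
  exact: rpredM.
rewrite /= (negPf ns) orbF => a0; exists a; first by rewrite mem_head.
move=> x; rewrite inE => /predU1P[->|xs]; first by rewrite divff ?rpred1.
have /hasPn/(_ x xs) := ns; rewrite negbK => /eqP ->; by rewrite mul0r rpred0.
Qed.

(** Algebraic extension of E(t) adds no residues. The equation of [y], divided by a coefficient of
    least value, reduces to a nonzero polynomial over E that kills the residue of [y]; since E is
    relatively algebraically closed, this polynomial splits over E. *)
Lemma cl_residue y : cl (E `|` [set t]) y -> y \in O -> exists2 e, E e & m (y - e).
Proof.
rewrite /adjoin_acl closed_adjoinE => -[p [p0 hp] py] Oy.
have hA := adjoin_subfield E [set t].
have [|c /andP[cp c0] hc] := @max_coef p.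
  apply/hasP; exists (lead_coef p); rewrite ?lead_coef_eq0 //.
  by apply: mem_nth; rewrite prednK // lt0n size_poly_eq0.
have Ac : adjoin E [set t] c by have /(nthP 0)[i _ <-] := cp.
have hr i : exists e, E e /\ m (e - p`_i / c).
  have [ip|ip] := ltnP i (size p); last first.
    by exists 0; rewrite nth_default // mul0r subrr; split; [exact: subfield0 | exact: vmax0].
  have [||e Ee me] := @adjoin_residue (p`_i / c); first exact: (subfield_div hA (hp i) Ac).
    by apply: hc; exact: mem_nth.
  by exists e; rewrite -opprB; split=> //; exact: vmaxN.
have /choice[f hf] := hr.
pose q := \poly_(i < size p) f i.
have qE i : E q`_i.
  by rewrite coef_poly; case: ifP => _; [case: (hf i) | exact: subfield0].
have q0 : q != 0.
  apply/eqP => q0; have /(nthP 0)[i ip ic] := cp.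
  have [_] := hf i; rewrite ic divff //.
  have := congr1 (fun q : {poly F} => q`_i) q0; rewrite coef_poly ip coef0 => ->.
  by rewrite sub0r => /vmaxN; rewrite opprK; exact: vmax1.
have mq : m q.[y].
  rewrite -[q.[y]]subr0 -[0](mulr0 c^-1) -(eqP py) -hornerZ.
  apply: poly_congr; rewrite ?subrr //; first exact: vmax0.
    by apply/polyOverP => i; exact/EO/qE.
  move=> i; rewrite coefZ coef_poly mulrC; case: ltnP => ip; first by case: (hf i).
  by rewrite nth_default // mul0r subrr; exact: vmax0.
have [d [r [Ed d0 rE er]]] := poly_factorE q0 qE.
have Od : d^-1 \in O by apply: EO; exact: subfieldV.
have : m (\prod_(a <- r) (y - a)).
  by rewrite -[X in m X](mulKf d0) -er; exact: vmaxMl.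
by case/vmax_prod => // [a /rE /EO //|a /rE Ea ma]; exists a.
Qed.

End Residue.
End AlgClosed.
End Valuation.

(** * Primitive elements *)

Section Primitive.
Variables (F : fieldType) (char0 : [pchar F] =i pred0).
Variables (M : set F) (hM : subfield M).

(** The first conclusion says that [th] belongs to the field generated by [l] over M, in the form in
    which it is applied to various overfields. *)
Lemma primitive_seq (l : seq F) : (forall x, x \in l -> algebraic_over M x) ->
  exists2 th, (forall N, subfield N -> M `<=` N -> [set` l] `<=` N -> N th) &
    forall x, x \in l -> exists2 p : {poly F}, (forall i, M p`_i) & x = p.[th].
Proof.
elim: l => [|a l IHl] hl; first by exists 0 => // N hN _ _; exact: subfield0.
have [|th' h1 h2] := IHl; first by move=> x xl; apply: hl; rewrite inE xl orbT.
have /(algebraic_overE hM)[p p0 pa] := hl a (mem_head _ _).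
have /(algebraic_overE hM)[q q0 qth] : algebraic_over M th'.
  apply: (h1 _ (acl_subfield hM)); first exact: sub_acl.
  by move=> x xl; apply: hl; rewrite inE (_ : x \in l) ?orbT.
have char0M : [pchar (subfieldT hM)] =i pred0.
  by move=> x; rewrite -char0; apply/esym; exact: (fmorph_pchar (subfield_inj hM)).
have [n [[r1 er1] [r2 er2]]] := pchar0_PET p0 pa q0 qth char0M.
exists (th' *+ n - a).
  move=> N hN MN lN; apply: (subfieldB hN); last by apply: lN; exact: mem_head.
  have : N th' by apply: h1 => // x xl; apply: lN; rewrite /= inE (_ : x \in l) ?orbT.
  move=> Nth; elim: (n) => [|j IHj]; first exact: subfield0.
  by rewrite mulrS; exact: subfieldD.
move=> x; rewrite inE => /predU1P[->|xl].
  by exists (map_poly (subfield_inj hM) r1); [exact: subfield_poly_map | rewrite er1].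
have [s hs ->] := h2 x xl.
exists (s \Po map_poly (subfield_inj hM) r2); last by rewrite horner_comp er2.
apply/(subfield_polyOverP hM); apply: polyOver_comp; apply/(subfield_polyOverP hM) => //.
exact: subfield_poly_map.
Qed.

(* The powers of [x = p(th) / q(th)] become polynomials in [th], hence vectors of
   length [n] modulo the equation of [th], after multiplication by [q(th) ^+ n]. *)
Lemma bounded_degree th : algebraic_over M th -> exists2 n, (0 < n)%N &
  forall x, adjoin M [set th] x -> exists c : 'I_n.+1 -> F,
    [/\ forall i, M (c i), exists i, c i != 0 & \sum_i c i * x ^+ i = 0].
Proof.
move=> /(algebraic_overE hM)[P P0 Pth]; pose n := (size P).-1.
have sP : size P = n.+1 by rewrite prednK // lt0n size_poly_eq0.
have n0 : (0 < n)%N.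
  have := root_size_gt1 _ Pth; rewrite map_poly_eq0 => /(_ P0).
  by rewrite size_map_poly sP.
exists n => // x /(adjoin1P hM)[p0 [q0 [/subfield_poly_lift h1 /subfield_poly_lift h2 qth ->]]].
have [[p ep] [q eq]] := (h1 hM, h2 hM); rewrite {}ep {}eq in qth *.
pose f (i : 'I_n.+1) := p ^+ i * q ^+ (n - i).
pose A := \matrix_(i < n.+1) (poly_rV (f i %% P) : 'rV_n).
have : kermx A != 0.
  rewrite kermx_eq0 /row_free; apply/eqP => rA.
  by have := rank_leq_col A; rewrite rA ltnn.
case/rowV0Pn => w /sub_kermxP wA w0.
exists (fun i => subfield_inj hM (w 0 i)); split=> [i||]; first exact: subfield_injP.
  have [i wi] : exists i, w 0 i != 0.
    apply/existsP; apply: contraNT w0; rewrite negb_exists => /forallP wi; apply/eqP/rowP => i.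
    by rewrite mxE; apply/eqP; rewrite -[_ == _]negbK wi.
  by exists i; rewrite fmorph_eq0.
have qn0 : (map_poly (subfield_inj hM) q).[th] ^+ n != 0 by rewrite expf_neq0.
apply: (mulIf qn0); rewrite mul0r mulr_suml.
pose ev (r : {poly subfieldT hM}) := (map_poly (subfield_inj hM) r).[th].
have evZ c r : ev (c *: r) = subfield_inj hM c * ev r by rewrite /ev map_polyZ hornerZ.
have evm r : ev (r %% P) = ev r.
  rewrite [in RHS](divp_eq r P) /ev rmorphD rmorphM hornerD hornerM (rootP Pth).
  by rewrite mulr0 add0r.
have /(congr1 rVpoly) := wA; rewrite mulmx_sum_row linear0 linear_sum /=.
move/(congr1 ev); rewrite {2}/ev rmorph0 horner0 => e0; apply: etrans e0.
rewrite /ev rmorph_sum horner_sum; apply: eq_bigr => i _.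
rewrite -[RHS]/(ev _) linearZ /= rowK poly_rV_K; last by rewrite -ltnS -sP ltn_modpN0.
rewrite evZ evm /ev /f rmorphM !rmorphXn /= hornerM !horner_exp.
rewrite expr_div_n -!mulrA; congr (_ * (_ * _)).
have expB (a : F) j m : a != 0 -> (j <= m)%N -> a ^- j * a ^+ m = a ^+ (m - j).
  by move=> a0 jm; rewrite -{1}(subnKC jm) exprD mulrA mulVf ?mul1r ?expf_neq0.
by rewrite expB // leq_ord.
Qed.

End Primitive.

(** * Uniformizers *)

Section Uniformizer.
Variables (k : fieldType) (F : closedFieldType) (iota : {rmorphism k -> F}).
Variable v : valuation_ring iota.

Local Notation O := (vring_pred v).
Local Notation cl := (adjoin_acl (range iota)).
Local Notation m := (vmax v).

Definition vunit (x : F) := x \in O /\ ~ m x.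
Local Notation U := vunit.

Lemma vunit_neq0 x : U x -> x != 0.
Proof. by case=> _ nx; apply/eqP => x0; apply: nx; rewrite x0; exact: vmax0. Qed.

Lemma vunit1 : U 1. Proof. by split; [exact: rpred1 | exact: vmax1]. Qed.

Lemma vunitM x y : U x -> U y -> U (x * y).
Proof.
move=> [hx nx] [hy ny]; split; first exact: rpredM.
by case/(vmax_prime hx).
Qed.

Lemma vunit_inv x : U x -> U x^-1.
Proof.
move=> Ux; have [hx nx] := Ux; split; first exact: vunitV.
by case=> _ /(_ x hx); rewrite mulVf // vunit_neq0.
Qed.

Lemma vunitX x n : U x -> U (x ^+ n).
Proof. by move=> Ux; elim: n => [|n IHn]; [exact: vunit1 | rewrite exprS; exact: vunitM]. Qed.

Lemma vunitXz x (z : int) : U x -> U (x ^ z).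
Proof. by case: z => n Ux; [exact: vunitX | exact/vunit_inv/vunitX]. Qed.

Lemma vunit_root x n : (0 < n)%N -> U (x ^+ n) -> U x.
Proof.
move=> n0 [hx nx]; split; first exact: vringX hx.
move=> mx; apply: nx; rewrite -(prednK n0) exprS; apply: vmaxMr => //.
exact/rpredX/vmaxO.
Qed.

Lemma vunit_congr x y : U x -> m (y - x) -> U y.
Proof.
move=> [hx nx] mxy; split; first by rewrite -(subrK x y) rpredD // (vmaxO mxy).
by move=> my; apply: nx; rewrite -(subKr y x); exact: vmaxB.
Qed.

Lemma subfield_vunit (M : set F) x : subfield M -> M `<=` [set` O] -> M x -> x != 0 -> U x.
Proof.
move=> hM MO Mx x0; split; first exact: MO.
by move=> mx; case/eqP: x0; exact: (subfield_vmax hM MO Mx mx).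
Qed.

Section Coordinates.
Variables (E : set F) (clE : cl E = E) (EO : E `<=` [set` O]).
Variable t : F.
Hypotheses (mt : m t) (t0 : t != 0).

Let hE : subfield E. Proof. by rewrite -clE; exact: cl_subfield. Qed.
Let hEt : subfield (adjoin E [set t]). Proof. exact: adjoin_subfield. Qed.

Lemma adjoin_value x : x != 0 -> adjoin E [set t] x -> exists z : int, U (x * t ^ z).
Proof.
move=> x0 hx; have [a [b [y [e [Ee e0 me Oy ->]]]]] := adjoin_normal clE EO mt x0 hx.
exists (b%:Z - a%:Z).
rewrite mulrAC expfzDr // -exprnN -exprnP mulf_div [t ^+ b * _]mulrC divff ?mulf_neq0 ?expf_neq0 //.
by rewrite mul1r; apply: vunit_congr me; exact: (subfield_vunit hE).
Qed.

(** In a vanishing sum two terms must share the least value. Hence some power x^j with 0 < j <= n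
    has the value of an element of E(t), that is, of an integral power of [t]; n! is a common
    multiple of all these j. *)
Lemma uniform_value (N : set F) n : subfield N -> (0 < n)%N ->
  (forall x, N x -> exists c : 'I_n.+1 -> F,
    [/\ forall i, adjoin E [set t] (c i), exists i, c i != 0 & \sum_i c i * x ^+ i = 0]) ->
  exists2 L, (0 < L)%N & forall x, N x -> x != 0 -> exists z : int, U (x ^+ L * t ^ z).
Proof.
move=> hN n0 hdep; exists n`!; first exact: fact_gt0.
move=> x Nx x0; have [c [hc [ic c0] cs]] := hdep x Nx.
have [j [z [j0 jn Uj]]] : exists j (z : int), [/\ (0 < j)%N, (j <= n)%N & U (x ^+ j * t ^ z)].
  have [|y /andP[/mapP[i0 _ ->] yi0] hy] := @max_coef _ _ _ v [seq c i * x ^+ i | i <- enum 'I_n.+1].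
    apply/hasP; exists (c ic * x ^+ ic); last by rewrite mulf_neq0 ?expf_neq0.
    by apply: map_f; rewrite mem_enum.
  have [c0i0 xi0] : c i0 != 0 /\ x ^+ i0 != 0 by apply/andP; rewrite -negb_or -mulf_eq0.
  have [i1 [i10 U1]] : exists i1, i1 != i0 /\ U ((c i1 * x ^+ i1) / (c i0 * x ^+ i0)).
    apply: contrapT => H; case: (@vmax1 _ _ _ v).
    have /(congr1 (fun y => y / (c i0 * x ^+ i0))) := cs.
    rewrite mul0r mulr_suml (bigD1 i0) //= divff // => /eqP; rewrite addr_eq0 => /eqP ->.
    apply: vmaxN; apply: vmax_sum => i ii0; apply: contrapT => ni; apply: H; exists i; split=> //.
    by split=> //; apply: hy; apply: map_f; rewrite mem_enum.
  have ci1 : c i1 != 0.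
    by apply/eqP => c10; have := vunit_neq0 U1; rewrite c10 !mul0r eqxx.
  have [z hz] := adjoin_value (mulf_neq0 ci1 (invr_neq0 c0i0)) (subfield_div hEt (hc i1) (hc i0)).
  have {U1 hz}U2 : U (x ^+ i1 / x ^+ i0 * t ^ (- z)).
    have := vunitM U1 (vunit_inv hz).
    rewrite -[_ / (c i0 * _)]mulf_div [(_ * t ^ z)^-1]invfM mulrACA divff ?mul1r ?invr_expz //.
    by rewrite mulf_neq0 ?invr_neq0.
  move: i10; rewrite -val_eqE neq_ltn => /orP[lt01|lt01].
    exists (i0 - i1)%N, z; rewrite subn_gt0 lt01 leq_subLR; split=> //.
      by rewrite (leq_trans (leq_ord i0)) // leq_addl.
    by have := vunit_inv U2; rewrite invfM invf_div -expfB // invr_expz opprK.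
  exists (i1 - i0)%N, (- z); rewrite subn_gt0 lt01 leq_subLR; split=> //.
    by rewrite (leq_trans (leq_ord i1)) // leq_addl.
  by rewrite expfB.
have /dvdnP[q ->] : (j %| n`!)%N by apply: dvdn_fact; rewrite j0.
exists (z * q%:Z); rewrite mulnC exprM -exprz_exp -exprnP -exprMn; exact: vunitX.
Qed.

(** The values of L-th powers of elements of N are integral multiples of the value of [t]. An
    element [pi] with the least positive multiple [j] works, since division with remainder by [j]
    leaves remainder 0. *)
Lemma uniformizer (N : set F) L : subfield N -> N t -> (0 < L)%N ->
  (forall x, N x -> x != 0 -> exists z : int, U (x ^+ L * t ^ z)) ->
  exists pi, [/\ N pi, m pi, pi != 0 & forall x, N x -> x != 0 -> exists z : int, U (x * pi ^ z)].
Proof.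
move=> hN Nt L0 hval.
pose P j := `[< (0 < j)%N /\ exists2 x, N x /\ x != 0 & U (x ^+ L * t ^ (- j%:Z)) >].
have exP : exists j, P j.
  exists L; apply/asboolP; split=> //; exists t => //.
  by rewrite -exprnN divff ?expf_neq0 //; exact: vunit1.
have [j /asboolP[j0 [pi [Npi pi0] Upi]] jmin] := ex_minnP exP.
have NXz x (z : int) : N x -> N (x ^ z).
  by case: z => i Nx; [exact: subfieldX | apply: (subfieldV hN); exact: subfieldX].
have main x : N x -> x != 0 -> exists z : int, U (x * pi ^ z).
  move=> Nx x0; have [z Uz] := hval x Nx x0.
  have jn0 : j%:Z != 0 by rewrite -lt0n.
  pose q := (z %/ j)%Z; pose r := (z %% j)%Z.
  have ez : z = q * j%:Z + r := divz_eq z j.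
  have [s es] : exists s : nat, r = s%:Z.
    by have := modz_ge0 z jn0; rewrite -/r; case: (r) => // s _; exists s.
  have sj : (s < j)%N by have := ltz_pmod z (j0 : (0 < j%:Z)%R); rewrite -/r es.
  have Uy : U ((x * pi ^ q) ^+ L * t ^ r).
    have e1 : (pi ^ q) ^+ L = (pi ^+ L) ^ q by rewrite !exprnP exprzAC.
    have e2 : t ^ r = t ^ z * (t ^ (- j%:Z)) ^ q.
      by rewrite exprz_exp -expfzDr // ez mulNr [j%:Z * q]mulrC addrAC subrr add0r.
    by rewrite exprMn e1 e2 mulrACA -expfzMl; apply: vunitM => //; exact: vunitXz.
  exists q; have [s0|s0] := posnP s.
    by move: Uy; rewrite es s0 expr0z mulr1; exact: vunit_root.
  suff /jmin : P s by rewrite leqNgt sj.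
  (* [Uy] says that the L-th power of x pi^q has value -s times that of [t], hence the inverse. *)
  apply/asboolP; split=> //; exists (x * pi ^ q)^-1.
    by rewrite invr_eq0 mulf_neq0 ?expfz_neq0 //; split=> //; apply: (subfieldV hN); apply: subfieldM => //; exact: NXz.
  by have := vunit_inv Uy; rewrite invfM -exprVn invr_expz es.
exists pi; split=> //.
have mL : m (pi ^+ L).
  have -> : pi ^+ L = pi ^+ L * t ^ (- j%:Z) * t ^+ j.
    by rewrite -exprnN divfK // expf_neq0.
  have [hu _] := Upi; apply: vmaxMl => //; rewrite -(prednK j0) exprS.
  by apply: vmaxMr => //; exact/rpredX/vmaxO.
apply: (vmaxX _ mL); apply: (vringX L0); exact: (vmaxO mL).
Qed.

End Coordinates.
End Uniformizer.

(** * Smooth local coordinates *)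

Section Local.
Variables (k : fieldType) (F : closedFieldType) (iota : {rmorphism k -> F}).
Variable char0 : [pchar F] =i pred0.
Variable v : valuation_ring iota.

Local Notation O := (vring_pred v).
Local Notation cl := (adjoin_acl (range iota)).
Local Notation m := (vmax v).
Local Notation U := (vunit v).

Variables (E : set F) (clE : cl E = E) (EO : E `<=` [set` O]).
Let hE : subfield E. Proof. by rewrite -clE; exact: cl_subfield. Qed.

(** If X^j is the exact power of X dividing q, the cofactor takes a unit value at [pi]; so
    divisibility of q(pi) by pi^a is divisibility of q by X^a. *)
Lemma poly_div_Xn (pi : F) (q : {poly F}) a r : m pi -> pi != 0 ->
  (forall i, E q`_i) -> q.[pi] = pi ^+ a * r -> r \in O ->
  exists2 q', q = 'X^a * q' & forall i, E q'`_i.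
Proof.
move=> mpi pi0 hq qpi Or; have [->|q0] := eqVneq q 0.
  by exists 0; [rewrite mulr0 | move=> i; rewrite coef0; exact: subfield0].
have [j [q1 [eq1 hq1 q10]]] := poly_shift q0 hq.
have [aj|ja] := leqP a j.
  exists ('X^(j - a) * q1); first by rewrite mulrA -exprD subnKC.
  by move=> i; rewrite coefXnM; case: ifP => _; [exact: subfield0 | exact: hq1].
have Uq1 : U q1.[pi].
  by apply: (vunit_congr _ (vmax_horner0 EO mpi hq1)); exact: (subfield_vunit hE).
have e : q1.[pi] = pi ^+ (a - j) * r.
  apply: (mulfI (expf_neq0 j pi0)); rewrite mulrA -exprD subnKC 1?ltnW // -qpi.
  by rewrite eq1 hornerM hornerXn.
case: Uq1 => _ []; rewrite e -(subnSK ja) exprS -mulrA; apply: vmaxMr => //.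
by rewrite rpredM // rpredX // vmaxO.
Qed.

(** [s] is the divided difference, stated without division to allow x = y; near the origin it
    reduces to the derivative at 0. *)
Lemma horner_diff (p : {poly F}) x y : (forall i, p`_i \in O) -> m x -> m y ->
  exists2 s, p.[x] - p.[y] = (x - y) * s & m (s - p`_1).
Proof.
move=> hp mx my; elim/poly_ind: p hp => [|p c IHp] hp.
  by exists 0; rewrite ?horner0 ?subrr ?mulr0 ?coef0 ?subrr //; exact: vmax0.
have hpi i : p`_i \in O by have := hp i.+1; rewrite coefD coefMX coefC addr0.
have [s es ms] := IHp hpi.
exists (s * x + p.[y]).
  rewrite !hornerE opprD addrACA subrr addr0 mulrDr mulrA -es mulrBl [_ * p.[y]]mulrC mulrBr.
  by rewrite addrA subrK.
rewrite coefD coefMX coefC /= addr0 -addrA; apply: vmaxD.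
  apply: vmaxMl => //; rewrite -(subrK p`_1 s) rpredD // ?(vmaxO ms) //.
rewrite -horner_coef0; apply: poly_congr; rewrite ?rpred0 ?(vmaxO my) ?subr0 //.
  exact/polyOverP.
by move=> i; rewrite subrr; exact: vmax0.
Qed.

Lemma horner_diffO (p : {poly F}) x y : p \is a polyOver O -> x \in O -> y \in O ->
  exists2 s, p.[x] - p.[y] = (x - y) * s & s \in O.
Proof.
move=> /polyOverP hp Ox Oy; elim/poly_ind: p hp => [|p c IHp] hp.
  by exists 0; rewrite ?horner0 ?subrr ?mulr0 ?rpred0.
have hpi i : p`_i \in O by have := hp i.+1; rewrite coefD coefMX coefC addr0.
have [s es Os] := IHp hpi.
exists (s * x + p.[y]).
  rewrite !hornerE opprD addrACA subrr addr0 mulrDr mulrA -es mulrBl [_ * p.[y]]mulrC mulrBr.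
  by rewrite addrA subrK.
by rewrite rpredD ?rpredM // rpred_horner //; exact/polyOverP.
Qed.

(** The outer variable of [G] is evaluated at y and the inner one at x, so [G]_0[_1] and [G]_1[_0]
    are its partial derivatives at the origin in x and in y. The difference is split at the
    intermediate point (x', y). *)
Lemma horner2_diff (G : {poly {poly F}}) x y x' y' :
  (forall i j, E G`_i`_j) -> m x -> m y -> m x' -> m y' ->
  exists a b, [/\ G.[y'%:P].[x'] - G.[y%:P].[x] = (x' - x) * a + (y' - y) * b,
    m (a - G`_0`_1) & m (b - G`_1`_0)].
Proof.
move=> hG mx my mx' my'.
have [Ox Oy] := (vmaxO mx, vmaxO my); have [Ox' Oy'] := (vmaxO mx', vmaxO my').
have GO i j : G`_i`_j \in O by exact/EO/hG.
have evE z w : G.[w%:P].[z] = \sum_(i < size G) (G`_i).[z] * w ^+ i.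
  by rewrite (horner_coef G) horner_sum; apply: eq_bigr => i _; rewrite hornerM -polyC_exp hornerC.
have evO i z : z \in O -> (G`_i).[z] \in O.
  by move=> hz; apply: rpred_horner => //; apply/polyOverP.
have [b eb mb] : exists2 b, G.[y'%:P].[x'] - G.[y%:P].[x'] = (y' - y) * b & m (b - G`_1`_0).
  pose H := \poly_(i < size G) (G`_i).[x'].
  have HE i : H`_i = (G`_i).[x'].
    by rewrite coef_poly; case: ltnP => // h; rewrite nth_default // horner0.
  have evH w : G.[w%:P].[x'] = H.[w].
    by rewrite evE horner_poly.
  have [i|b eb mb] := @horner_diff H y' y _ my' my; first by rewrite HE evO.
  exists b; first by rewrite !evH.
  rewrite -(subrK H`_1 b) -addrA; apply: vmaxD => //.
  by rewrite HE; exact: (vmax_horner0 EO mx' (hG 1%N)).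
have /choice[s hs] : forall i, exists s, (G`_i).[x'] - (G`_i).[x] = (x' - x) * s /\ m (s - G`_i`_1).
  by move=> i; have [s es ms] := horner_diff (GO i) mx' mx; exists s.
exists (\sum_(i < size G) s i * y ^+ i), b; split=> //.
  rewrite -(subrK G.[y%:P].[x'] G.[y'%:P].[x']) -addrA eb addrC; congr (_ + _).
  rewrite !evE -sumrB mulr_sumr; apply: eq_bigr => i _.
  by rewrite -mulrBl (hs i).1 mulrA.
have sO i : s i \in O.
  by have [_ ms] := hs i; rewrite -(subrK G`_i`_1 (s i)) rpredD // (vmaxO ms).
have [G0|G0] := posnP (size G).
  rewrite big1 => [|i _]; last by have := ltn_ord i; rewrite {2}G0.
  have -> : G`_0 = 0 by rewrite nth_default ?G0.
  by rewrite coef0 subr0; exact: vmax0.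
case: (size G) G0 => // n _.
rewrite big_ord_recl expr0 mulr1 addrAC; apply: vmaxD; first by case: (hs 0%N).
apply: vmax_sum => i _; rewrite /= exprS mulrCA; apply: vmaxMr => //.
by rewrite rpredM // rpredX.
Qed.

Section Expansion.
Variables (N : set F) (hN : subfield N) (EN : E `<=` N).
Variables (t : F) (mt : m t) (t0 : t != 0) (NE : N `<=` cl (E `|` [set t])).
Variables (pi : F) (Npi : N pi) (mpi : m pi) (pi0 : pi != 0).
Hypothesis hpi : forall x, N x -> x != 0 -> exists z : int, U (x * pi ^ z).

Lemma uniformizerP x : N x -> x \in O -> x != 0 ->
  exists n y, [/\ x = pi ^+ n * y, N y & U y].
Proof.
move=> Nx Ox x0; have [z Uz] := hpi Nx x0; case: z Uz => n Un.
  case: n Un => [|n] Un.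
    by rewrite expr0z mulr1 in Un; exists 0%N, x; rewrite expr0 mul1r.
  case: Un => _ []; apply: vmaxMl => //; rewrite -exprnP exprS.
  by apply: vmaxMr => //; rewrite rpredX // vmaxO.
exists n.+1, (x * pi ^- n.+1); split=> //; first by rewrite mulrC divfK // expf_neq0.
by apply: (subfield_div hN) => //; exact: subfieldX.
Qed.

(** All residues of N lie in E by [cl_residue]; subtracting the residue and dividing by [pi]
    produces one more coefficient. *)
Lemma expansion n x : N x -> x \in O -> exists (A : {poly F}) r,
  [/\ forall i, E A`_i, N r, r \in O & x = A.[pi] + pi ^+ n * r].
Proof.
move=> Nx Ox; elim: n => [|n [A [r [hA Nr Or ex]]]].
  exists 0, x; rewrite expr0 mul1r horner0 add0r; split=> // i.
  by rewrite coef0; exact: subfield0.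
have [e Ee me] := cl_residue clE EO mt t0 (NE Nr) Or.
have [r' [Nr' Or' er']] : exists r', [/\ N r', r' \in O & r - e = pi * r'].
  have Nre : N (r - e) by apply: subfieldB => //; exact: EN.
  have [re0|re0] := eqVneq (r - e) 0.
    by exists 0; rewrite rpred0 mulr0; split=> //; exact: subfield0.
  have [j [y [ey Ny Uy]]] := uniformizerP Nre (vmaxO me) re0.
  case: j ey => [|j] ey; first by case: Uy => _ []; rewrite -[y]mul1r -(expr0 pi) -ey.
  exists (pi ^+ j * y); rewrite mulrA -exprS; split=> //.
    by apply: subfieldM => //; exact: subfieldX.
  by case: Uy => Oy _; rewrite rpredM // rpredX // vmaxO.
exists (A + e *: 'X^n), r'; split=> // [i|].
  rewrite coefD coefZ coefXn; apply: subfieldD => //; apply: subfieldM => //.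
  by case: (_ == _); [exact: subfield1 | exact: subfield0].
rewrite ex hornerD hornerZ hornerXn -addrA; congr (_ + _).
by rewrite exprSr -mulrA -er' mulrBr [e * _]mulrC addrC subrK.
Qed.

(* A truncated expansion of [th] in [pi], beyond the order of the derivative of
   its equation, replaces [th] by a function [h] for which the plane curve
   through (pi, h) is smooth at the origin, as in Hensel's lemma. *)
Lemma smooth_model th (P : {poly {poly F}}) : N th -> th \in O ->
  (forall i j, E P`_i`_j) -> (map_poly (horner_eval pi) P).[th] = 0 ->
  (map_poly (horner_eval pi) P)^`().[th] != 0 ->
  exists h (G : {poly {poly F}}), [/\ N h, m h, adjoin E ([set pi] `|` [set h]) th,
    forall i j, E G`_i`_j & G.[h%:P].[pi] = 0 /\ G`_1`_0 != 0].
Proof.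
move=> Nth Oth hP; set Pp := map_poly _ P => Pth dPth.
have Opi := vmaxO mpi.
have hPp i : N Pp`_i.
  rewrite coef_map; apply: (subfield_horner hN) => // j; exact/EN/hP.
have OPp : Pp \is a polyOver O.
  apply/polyOverP => i; rewrite coef_map; apply: rpred_horner => //; apply/polyOverP => j; exact/EO/hP.
have Nw : N Pp^`().[th].
  apply: (subfield_horner hN) => // i; rewrite coef_deriv -mulr_natr; apply: subfieldM => //.
  by elim: (i.+1) => [|j IHj]; [exact: subfield0 | rewrite mulrS; apply: subfieldD => //; exact: subfield1].
have Ow : Pp^`().[th] \in O.
  by apply: rpred_horner => //; apply: polyOver_deriv.
have [d [y [ew Ny Uy]]] := uniformizerP Nw Ow dPth.
(* [d] is the order of P'(th) in [pi]. Of the d + 2 orders, one puts h = pi r into the maximal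
   ideal; the other n = d + 1 exceed d, so that the Taylor terms of degree at least 2, of order at
   least 2n, are beyond n + d. *)
have [A [r [hA Nr Or eth]]] := expansion d.+2 Nth Oth.
pose n := d.+1; pose h := pi * r.
have mh : m h by apply: vmaxMr.
have Oh := vmaxO mh.
have {}eth : th = A.[pi] + pi ^+ n * h by rewrite eth /h /n mulrA -exprSr.
(* Taylor coefficients of P around A, kept as polynomials in the variable that stands for [pi]. *)
pose c i := P^`N(i).[A].
have hc i : forall j, E (c i)`_j.
  apply/(subfield_polyOverP hE); apply: rpred_horner; last exact/(subfield_polyOverP hE).
  by apply: polyOver_nderivn; apply/polyOverP => j; apply/(subfield_polyOverP hE).
have cpi i : (c i).[pi] = Pp^`N(i).[A.[pi]].
  by rewrite /Pp nderivn_map -[A.[pi]]/(horner_eval pi A) horner_map.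
have OA : A.[pi] \in O by apply: rpred_horner => //; apply/polyOverP => i; exact/EO/hA.
pose z := pi ^+ n * h; pose S := size P.
have Oz : z \in O by rewrite rpredM // rpredX.
(* A(pi) differs from [th] by a multiple of pi^(d+1) h, too little to change the order of the
   derivative. *)
have [y1 ec1 Uy1] : exists2 y1, (c 1%N).[pi] = pi ^+ d * y1 & U y1.
  have [s es Os] := horner_diffO (polyOver_deriv OPp) Oth OA.
  exists (y - pi * h * s).
    rewrite cpi nderivn1 -[LHS](subKr Pp^`().[th]) es ew {1}eth [A.[pi] + _]addrC addrK.
    by rewrite mulrBr /n exprSr !mulrA.
  apply: (vunit_congr Uy); rewrite addrC addrA addNr sub0r; apply: vmaxN.
  by rewrite -mulrA; apply: vmaxMr => //; rewrite rpredM.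
(* The range [S.+2] allows terms 0 and 1 to be split off whatever the size of [P]. *)
have taylor : \sum_(i < S.+2) (c i).[pi] * z ^+ i = 0.
  apply: etrans Pth; rewrite [in RHS]eth (@nderiv_taylor_wide _ S.+2) //; last 2 first.
  - exact: mulrC.
  - by rewrite (leq_trans (size_poly _ _)) // /S (leq_trans (leqnSn _)).
  by apply: eq_bigr => i _; rewrite cpi.
have [r0 ec0 Or0] : exists2 r0, (c 0%N).[pi] = pi ^+ (n + d) * r0 & r0 \in O.
  have := taylor; rewrite !big_ord_recl /= expr0 mulr1 expr1 => /eqP.
  rewrite addr_eq0 => /eqP ->.
  pose R := \sum_(i < S) (c i.+2).[pi] * z ^+ i.
  exists (- (y1 * h + pi * (h * h * R))).
    rewrite mulrN; congr (- _); rewrite mulrDr; congr (_ + _).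
      by rewrite ec1 /z mulrACA -exprD addnC.
    transitivity (z ^+ 2 * R).
      rewrite mulr_sumr; apply: eq_bigr => i _.
      by rewrite [RHS]mulrCA -exprD.
    by rewrite expr2 /z mulrACA -exprD (_ : n + n = (n + d).+1)%N ?exprSr -?mulrA // /n addnS.
  have OR : R \in O.
    apply: rpred_sum => i _; rewrite rpredM ?rpredX //.
    by apply: rpred_horner => //; apply/polyOverP => j; exact/EO/hc.
  by case: Uy1 => Oy1 _; rewrite rpredN rpredD ?rpredM.
have Ey1 := Uy1; have [Oy1 _] := Ey1.
have [c1 e1 hc1] := poly_div_Xn mpi pi0 (hc 1%N) ec1 Oy1.
have [c0 e0 hc0] := poly_div_Xn mpi pi0 (hc 0%N) ec0 Or0.
(* G(X, Y) is the sum of c_i(X) (X^n Y)^i divided by X^(n + d). For i >= 2 the exponent n i - (n +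
   d) is nonnegative because n > d; [c0] and [c1] are the quotients just obtained, and c1(pi) is a
   unit, whence c1(0) is nonzero. *)
pose g i := match i with 0 => c0 | 1 => c1 | _ => c i * 'X^(n * i - (n + d)) end.
pose G : {poly {poly F}} := \poly_(i < S.+2) g i.
have G1 : G`_1 = c1 by rewrite coef_poly.
exists h, G; split=> //.
- exact: subfieldM.
- have hX := adjoin_subfield E ([set pi] `|` [set h]).
  have Xpi : adjoin E ([set pi] `|` [set h]) pi by apply: sub_adjoinr; left.
  rewrite eth; apply: (subfieldD hX).
    by apply: (subfield_horner hX) => // i; apply: sub_adjoinl.
  apply: (subfieldM hX); first by apply: (subfieldX hX).
  by apply: sub_adjoinr; right.
- move=> i j; rewrite coef_poly; case: ifP => _; last by rewrite coef0; exact: subfield0.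
  case: i => [|[|i]] /=; rewrite ?hc0 ?hc1 // coefMXn.
  by case: ifP => _; [exact: subfield0 | exact: hc].
split; last first.
  rewrite G1; apply/eqP => c10; case: Uy1 => _ [].
  have -> : y1 = c1.[pi].
    by apply: (mulfI (expf_neq0 d pi0)); rewrite -ec1 e1 hornerM hornerXn.
  by rewrite -[_.[_]]subr0 -c10; exact: (vmax_horner0 EO).
apply: (mulIf (expf_neq0 (n + d) pi0)); rewrite mul0r; apply: etrans taylor.
rewrite (horner_coef_wide _ (size_poly _ _)) horner_sum mulr_suml; apply: eq_bigr => i _.
rewrite hornerM -polyC_exp hornerC coef_poly ltn_ord /z [(_ * h) ^+ i]exprMn mulrA mulrAC; congr (_ * _).
rewrite -exprM; case: (nat_of_ord i) => [|[|j]] /=.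
- by rewrite muln0 mulr1 e0 hornerM hornerXn mulrC.
- by rewrite muln1 e1 hornerM hornerXn exprD [_ * c1.[pi]]mulrC -mulrA [pi ^+ d * _]mulrC.
rewrite hornerM hornerXn -mulrA -exprD subnK //.
by rewrite !mulnS addnA (leq_trans _ (leq_addr _ _)) // leq_add2l /n leqnSn.
Qed.

End Expansion.
End Local.

Lemma separable_equation (F : fieldType) (char0 : [pchar F] =i pred0) (M : set F) x :
  subfield M -> algebraic_over M x ->
  exists p : {poly F}, [/\ forall i, M p`_i, p.[x] = 0 & p^`().[x] != 0].
Proof.
move=> hM [p0 [p00 hp0] p0x].
pose Q n := `[< exists p : {poly F}, [/\ size p = n, p != 0, forall i, M p`_i & p.[x] = 0] >].
have exQ : exists n, Q n.
  by exists (size p0); apply/asboolP; exists p0; split=> //; exact/eqP.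
have [n /asboolP[p [sp pn0 hp px]] nmin] := ex_minnP exQ.
exists p; split=> //; apply/eqP => dpx.
have n1 : (1 < n)%N by rewrite -sp; apply: (root_size_gt1 pn0); apply/rootP; exact: px.
have dp0 : p^`() != 0.
  have [j en] : exists j, n = j.+2 by case: (n) n1 => [|[|j]] // _; exists j.
  apply/eqP => /(congr1 (fun q : {poly F} => q`_j)); rewrite coef_deriv coef0.
  have -> : p`_j.+1 = lead_coef p by rewrite /lead_coef sp en.
  rewrite -mulr_natr => /eqP; rewrite mulf_eq0 lead_coef_eq0 (negPf pn0) /=.
  by rewrite ((pcharf0P F).1 char0).
have : (n <= size p^`())%N.
  apply: nmin; apply/asboolP; exists p^`(); split=> // i.
  rewrite coef_deriv -mulr_natr; apply: (subfieldM hM) => //.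
  by elim: (i.+1) => [|j IHj]; [exact: subfield0 | rewrite mulrS; apply: (subfieldD hM) => //; exact: subfield1].
by rewrite leqNgt -sp lt_size_deriv.
Qed.

Section Coordinates.
Variables (k : fieldType) (F : closedFieldType) (iota : {rmorphism k -> F}).
Variable char0 : [pchar F] =i pred0.
Variable v : valuation_ring iota.

Local Notation O := (vring_pred v).
Local Notation cl := (adjoin_acl (range iota)).
Local Notation m := (vmax v).
Local Notation U := (vunit v).

Variables (E : set F) (clE : cl E = E) (EO : E `<=` [set` O]).
Let hE : subfield E. Proof. by rewrite -clE; exact: cl_subfield. Qed.

Lemma cl_closedE S : cl (E `|` S) = algebraic_over (adjoin E S).
Proof. by rewrite /adjoin_acl closed_adjoinE. Qed.

Variable t : F.
Hypotheses (mt : m t) (t0 : t != 0).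

Lemma cl_exchange_closed x : m x -> x != 0 -> cl (E `|` [set t]) x ->
  cl (E `|` [set t]) `<=` cl (E `|` [set x]).
Proof.
move=> mx x0 hx; apply: cl_min => y [Ey|->]; first by apply: sub_cl; left.
apply: cl_exchange hx _; rewrite clE => Ex.
by case/eqP: x0; exact: (subfield_vmax hE EO).
Qed.

Lemma coordinates (l : seq F) : (forall x, x \in l -> cl (E `|` [set t]) x) ->
  exists pi h (G : {poly {poly F}}),
    [/\ m pi, pi != 0, m h, cl (E `|` [set t]) pi & cl (E `|` [set t]) h] /\
    [/\ forall x, x \in l -> adjoin E ([set pi] `|` [set h]) x,
        forall i j, E G`_i`_j, G.[h%:P].[pi] = 0 & G`_1`_0 != 0].
Proof.
move=> hl; pose M := adjoin E [set t].
have hM : subfield M := adjoin_subfield _ _.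
have hl' x : x \in l -> algebraic_over M x by rewrite -cl_closedE; exact: hl.
have [th thmin thl] := primitive_seq char0 hM hl'.
pose N := adjoin M [set th]; have hN : subfield N := adjoin_subfield _ _.
have ath : algebraic_over M th.
  by apply: thmin; [exact: acl_subfield | exact: sub_acl | exact: hl'].
have MN : M `<=` N by exact: sub_adjoinl.
have EN : E `<=` N by move=> x Ex; apply: MN; apply: sub_adjoinl.
have Nt : N t by apply: MN; apply: sub_adjoinr.
have lN : [set` l] `<=` N.
  move=> x /thl[p hp ->]; apply: (subfield_horner hN); last by apply: sub_adjoinr.
  by move=> i; exact: MN.
have NE : N `<=` cl (E `|` [set t]).
  rewrite cl_closedE; apply: adjoin_min; [exact: acl_subfield | exact: sub_acl |].
  by move=> _ ->.
have [n n0 hdep] := bounded_degree hM ath.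
have [L L0 hval] := uniform_value clE EO mt t0 hN n0 hdep.
have [pi [Npi mpi pi0 hpi]] := uniformizer mt t0 hN Nt L0 hval.
have tpi := cl_exchange_closed mpi pi0 (NE _ Npi).
pose M2 := adjoin E [set pi]; have hM2 : subfield M2 := adjoin_subfield _ _.
have M2N : M2 `<=` N by apply: adjoin_min => // _ ->.
(* E(t) has served to produce [pi]; the plane model requires an equation over E(pi), hence a second
   primitive element. *)
have [x /hl/tpi|th2 th2min th2l] := primitive_seq char0 hM2 (l := l).
  by rewrite cl_closedE.
have Nth2 : N th2 by exact: th2min.
(* A primitive element outside O_v is replaced by its inverse, which generates the same field. *)
have [th3 [Nth3 Oth3 th3l]] : exists th3, [/\ N th3, th3 \in O &
    forall X, subfield X -> E `<=` X -> X pi -> X th3 -> [set` l] `<=` X].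
  have key X : subfield X -> E `<=` X -> X pi -> X th2 -> [set` l] `<=` X.
    move=> hX EX Xpi Xth x /th2l[p hp ->]; apply: (subfield_horner hX) => // i.
    by apply: (adjoin_min hX EX _ (hp i)) => _ ->.
  have [Oth|nOth] := boolP (th2 \in O); first by exists th2.
  exists th2^-1; split; first exact: (subfieldV hN).
    exact/vmaxO/vmaxV.
  by move=> X hX EX Xpi /(subfieldV hX); rewrite invrK; exact: key.
have ath3 : algebraic_over M2 th3 by rewrite -cl_closedE; apply: tpi; exact: NE.
have [p [hp pth dpth]] := separable_equation char0 hM2 ath3.
have [P [d [hP hd d0 eP]]] := clear_denom hE hp.
have [||h [G [Nh mh Xth hG [G0 G1]]]] :=
    smooth_model clE EO hN EN mt t0 NE Npi mpi pi0 hpi Nth3 Oth3 hP.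
- by rewrite eP hornerZ pth mulr0.
- by rewrite eP derivZ hornerZ mulf_neq0.
exists pi, h, G; split; first by split=> //; exact: NE.
split=> // x xl; apply: (th3l _ (adjoin_subfield _ _)) => //; first exact: sub_adjoinl.
by apply: sub_adjoinr; left.
Qed.

End Coordinates.

(** * Automorphisms and the spaces [Vv] *)

Section VvTheory.
Variables (k F : fieldType) (iota : {rmorphism k -> F}).
Variables (V : zmodType) (act : gal iota -> V -> V).
Hypothesis actB : forall s x y, act s (x - y) = act s x - act s y.
Variable v : valuation_ring iota.

Let act0 s : act s 0 = 0. Proof. by have := actB s 0 0; rewrite !subrr. Qed.
Let actN s x : act s (- x) = - act s x. Proof. by rewrite -sub0r actB act0 sub0r. Qed.

Lemma Vv_fixed (M : set F) x : subfield M -> range iota `<=` M ->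
  M `<=` [set` vring_pred v] -> fixed act (gal_over M) x -> Vv act v x.
Proof.
move=> hM kM Mv hx; exists 1%N, (fun _ => x); split; last by rewrite big_ord1.
by move=> i; exists M; split=> // y /set_mem; exact: Mv.
Qed.

Lemma Vv0 : Vv act v 0.
Proof. by exists 0%N, (fun _ => 0); split=> [[]//|]; rewrite big_ord0. Qed.

Lemma VvD x y : Vv act v x -> Vv act v y -> Vv act v (x + y).
Proof.
move=> [n [w [hw ->]]] [n' [w' [hw' ->]]].
exists (n + n')%N, (fun i => match fintype.split i with inl j => w j | inr j => w' j end).
split=> [i|]; first by case: fintype.split => j; [exact: hw | exact: hw'].
rewrite big_split_ord; congr (_ + _); apply: eq_bigr => i _.
  by rewrite (unsplitK (inl i)).
by rewrite (unsplitK (inr i)).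
Qed.

Lemma VvN x : Vv act v x -> Vv act v (- x).
Proof.
move=> [n [w [hw ->]]]; exists n, (fun i => - w i); split; last by rewrite sumrN.
move=> i; have [M [hM kM Mv fw]] := hw i; exists M; split=> // s sM.
by rewrite actN fw.
Qed.

Lemma VvB x y : Vv act v x -> Vv act v y -> Vv act v (x - y).
Proof. by move=> hx /VvN; exact: VvD. Qed.

Lemma Vv_sum (I : eqType) (r : seq I) (P : pred I) (f : I -> V) :
  (forall i, i \in r -> P i -> Vv act v (f i)) -> Vv act v (\sum_(i <- r | P i) f i).
Proof.
move=> h; rewrite big_seq_cond; elim/big_ind: _ => //; [exact: Vv0 | exact: VvD |].
by move=> i /andP[]; exact: h.
Qed.

End VvTheory.

Section GalTheory.
Variables (k F : fieldType) (iota : {rmorphism k -> F}).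
Local Notation cl := (adjoin_acl (range iota)).
Implicit Types s t : gal iota.

Lemma gal_iota s a : s (iota a) = iota a.
Proof. by case: (galP s). Qed.

Lemma galVK s x : (s^-1)%g (s x) = x.
Proof. exact: gal_invVK. Qed.

Lemma gal_root s (p : {poly F}) x : p.[x] = 0 -> (map_poly s p).[s x] = 0.
Proof. by move=> px; rewrite horner_map px rmorph0. Qed.

Lemma fixed_subfield s : subfield [set x | s x = x].
Proof.
split=> [|x y|x y].
- by apply/mem_set; rewrite /= rmorph1.
- by move=> /set_mem /= hx /set_mem /= hy; apply/mem_set; rewrite /= rmorphB /= hx hy.
- by move=> /set_mem /= hx /set_mem /= hy; apply/mem_set; rewrite /= fmorph_div /= hx hy.
Qed.

Lemma preim_subfield s (M : set F) : subfield M -> subfield [set x | M (s x)].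
Proof.
move=> hM; split=> [|x y|x y].
- by apply/mem_set; rewrite /= rmorph1; exact: subfield1.
- by move=> /set_mem /= hx /set_mem /= hy; apply/mem_set; rewrite /= rmorphB; exact: subfieldB.
- by move=> /set_mem /= hx /set_mem /= hy; apply/mem_set; rewrite /= fmorph_div; exact: subfield_div.
Qed.

Lemma acl_map s (M N : set F) x : (forall y, M y -> N (s y)) ->
  algebraic_over M x -> algebraic_over N (s x).
Proof.
move=> MN [p [p0 hp] px]; exists (map_poly s p).
  by split=> [|i]; rewrite ?map_poly_eq0 // coef_map; exact/MN/hp.
exact/rootP/gal_root/rootP.
Qed.

Lemma cl_map s S T x : (forall y, S y -> cl T (s y)) -> cl S x -> cl T (s x).
Proof.
move=> ST hx; apply: acl_cl; apply: acl_map hx.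
apply: (adjoin_min (preim_subfield s (cl_subfield _ T))) => // y [a _ <-] /=.
by rewrite gal_iota; apply: base_cl; exists a.
Qed.

(** Used for the orbit of a vector [w]: there s w depends only on (s pi, s h), which ranges over
    pairs of roots of two fixed polynomials. *)
Lemma orbit_finite (T : Type) (P : set T) (C W : eqType) (g : T -> C) (f : T -> W) (l : seq C) :
  (forall x, P x -> g x \in l) -> (forall x y, P x -> P y -> g x = g y -> f x = f y) ->
  exists s : seq W, uniq s /\ forall z, z \in s <-> exists2 x, P x & z = f x.
Proof.
elim: l P => [|c l IHl] P hl hf.
  by exists [::]; split=> // z; split=> // -[x /hl].
have [||s [us hs]] := IHl (P `&` [set x | g x != c]).
- by move=> x [Px /= /negPf gx]; have := hl x Px; rewrite inE gx.
- by move=> x y [Px _] [Py _]; exact: hf.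
have [[x0 Px0 gx0]|nx] := pselect (exists2 x, P x & g x = c); last first.
  exists s; split=> // z; split; first by move=> /hs[x [Px _] ->]; exists x.
  move=> [x Px ->]; apply/hs; exists x => //; split=> //.
  by apply/eqP => gx; apply: nx; exists x.
exists (undup (f x0 :: s)); split=> [|z]; first exact: undup_uniq.
rewrite mem_undup inE; split.
  by case/predU1P => [->|/hs[x [Px _] ->]]; [exists x0 | exists x].
move=> [x Px ->]; have [gx|gx] := eqVneq (g x) c.
  by rewrite (hf x x0) ?eqxx // gx.
by apply/orP; right; apply/hs; exists x.
Qed.

End GalTheory.

Lemma poly_roots_finite (F : closedFieldType) (p : {poly F}) : p != 0 ->
  exists r : seq F, forall x, root p x -> x \in r.
Proof.
move=> p0; have [r ->] := closed_field_poly_normal p; exists r => x.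
by rewrite rootZ ?lead_coef_eq0 // root_prod_XsubC.
Qed.

(* [B] is a lift of a transcendence basis of the residue field. *)
Definition residual_basis (k F : fieldType) (iota : {rmorphism k -> F})
    (v : valuation_ring iota) (B : set F) (t : F) :=
  [/\ adjoin_acl (range iota) B `<=` [set` vring_pred v],
      forall u, B u -> ~ adjoin_acl (range iota) (B `\ u) u,
      forall x, adjoin_acl (range iota) (B `|` [set t]) x,
      forall s : seq F, exists2 u, B u & u \notin s
    & t != 0].

Lemma cl_fin_seq (F : fieldType) (k0 S : set F) (l : seq F) :
  (forall x, x \in l -> adjoin_acl k0 S x) ->
  exists2 s : seq F, [set` s] `<=` S & forall x, x \in l -> adjoin_acl k0 [set` s] x.
Proof.
elim: l => [|a l IHl] h; first by exists [::].
have [|s sS hs] := IHl; first by move=> x xl; apply: h; rewrite inE xl orbT.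
have [s' s'S hs'] := cl_fin (h a (mem_head _ _)); exists (s' ++ s); first exact: set_cat_sub.
move=> x; rewrite inE => /predU1P[->|/hs hx].
  by apply: cl_mono hs' => y /= ys; rewrite mem_cat ys.
by apply: cl_mono hx => y /= ys; rewrite mem_cat ys orbT.
Qed.

Section ResidualBasis.
Variables (k : fieldType) (F : closedFieldType) (iota : {rmorphism k -> F}).
Variable v : valuation_ring iota.
Local Notation O := (vring_pred v).
Local Notation cl := (adjoin_acl (range iota)).
Local Notation m := (vmax v).
Variables (B : set F) (t : F).
Hypotheses (hB : residual_basis v B t) (mt : m t).

Lemma residual_notin_sub u : B u -> forall e, cl (B `\ u) e -> ~ m (u - e).
Proof.
have [BO iB _ _ t0] := hB; move=> Bu e he mue; have := iB u Bu.
have ue : cl B (u - e).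
  apply: (subfieldB (cl_subfield _ B)); first exact: sub_cl.
  by apply: cl_mono he => x [].
have /eqP := subfield_vmax (cl_subfield _ B) BO ue mue; rewrite subr_eq0 => /eqP eue.
by move: he; rewrite -eue => h /(_ h).
Qed.

(** The list [l] involves finitely many members of the infinite set [B]; [u] is another member. *)
Lemma residual_split (l : seq F) : exists2 u, B u &
  forall x, x \in l -> cl (cl (B `\ u) `|` [set t]) x.
Proof.
have [BO iB Bt Binf t0] := hB.
have [s sB hs] := cl_fin_seq (fun x (_ : x \in l) => Bt x).
have [u Bu us] := Binf s; exists u => // x /hs; apply: cl_mono => y ys.
have [By|->] := sB _ ys; last by right.
by left; apply: sub_cl; split=> //= yu; case/negP: us; rewrite -yu.
Qed.

End ResidualBasis.

(** * Moving along a pencil *)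

Section Specialize.
Variables (k : fieldType) (F : closedFieldType) (iota : {rmorphism k -> F}).
Variable char0 : [pchar F] =i pred0.
Variable v : valuation_ring iota.
Local Notation O := (vring_pred v).
Local Notation cl := (adjoin_acl (range iota)).
Local Notation m := (vmax v).
Variables (E : set F) (clE : cl E = E) (EO : E `<=` [set` O]).
Let hE : subfield E. Proof. by rewrite -clE; exact: cl_subfield. Qed.
Variables (t u : F).
Hypotheses (mt : m t) (t0 : t != 0) (Ou : u \in O).
Hypothesis uE : forall e, E e -> ~ m (u - e).

Let kE : range iota `<=` E. Proof. by rewrite -clE; exact: base_cl. Qed.

Lemma residual_free_notin x : x \in O -> cl (E `|` [set t]) x -> exists2 e, E e & m (x - e).
Proof. by move=> Ox hx; exact: (cl_residue clE EO mt t0). Qed.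

Add Ring Fring : (com_ring_theory F).

Section Curve.
Variables (pi h : F) (G : {poly {poly F}}).
Hypotheses (mpi : m pi) (pi0 : pi != 0) (mh : m h).
Hypotheses (tpi : cl (E `|` [set t]) pi) (th : cl (E `|` [set t]) h).
Hypotheses (hG : forall i j, E G`_i`_j) (G0 : G.[h%:P].[pi] = 0) (G1 : G`_1`_0 != 0).

Let c := pi + u * h.
Let mc : m c. Proof. by apply: vmaxD => //; exact: vmaxMl. Qed.
Let clu := cl_subfield (range iota) (E `|` [set u]).
Let cluO : cl (E `|` [set u]) `<=` [set` O] := vring_adjoin clE EO Ou uE.

Let u_notin : ~ cl (E `|` [set t]) u.
Proof. by move=> /(residual_free_notin Ou)[e Ee]; exact: uE. Qed.

(** The closure of E(u) lies in O_v and so meets the maximal ideal only in 0; but c = 0 would give u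
    = - pi / h, whose residue would lie in E. *)
Lemma pencil_transc : ~ cl (E `|` [set u]) c.
Proof.
move=> hc; have : c = 0 by exact: (subfield_vmax clu cluO).
have [h0|h0] := eqVneq h 0; first by rewrite /c h0 mulr0 addr0 => /eqP; rewrite (negPf pi0).
move=> /eqP; rewrite /c addrC addr_eq0 => /eqP uh; apply: u_notin.
have ht := cl_subfield (range iota) (E `|` [set t]).
rewrite -(mulfK h0 u) uh; apply: (subfield_div ht) => //; exact: (subfieldN ht).
Qed.

Lemma pencil_alg : cl (E `|` [set t]) `<=` cl (E `|` ([set u] `|` [set c])).
Proof.
rewrite setUA; apply: cl_min => x [Ex|->]; first by apply: sub_cl; left; left.
apply: cl_exchange; last exact: pencil_transc.
have ht := cl_subfield (range iota) (E `|` [set u] `|` [set t]).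
have sub : cl (E `|` [set t]) `<=` cl (E `|` [set u] `|` [set t]).
  by apply: cl_mono => y [Ey|->]; [left; left | right].
apply: (subfieldD ht); first exact: sub.
by apply: (subfieldM ht); [apply: sub_cl; left; right | exact: sub].
Qed.

(* Two points of the curve on the same line of the pencil that both reduce to
   the origin coincide: the slope [u] of the line is residually generic, hence
   differs from the slope of the tangent. *)
Lemma pencil_specialize (s : gal iota) : (forall x, E x -> s x = x) -> s u = u -> s c = c ->
  (forall z, cl (E `|` [set s t]) z -> z \in O -> exists2 e, E e & m (z - e)) ->
  s pi = pi /\ s h = h.
Proof.
move=> sE su sc hs; set pi' := s pi; set h' := s h.
have T' := cl_subfield (range iota) (E `|` [set s t]).
have mapT x : cl (E `|` [set t]) x -> cl (E `|` [set s t]) (s x).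
  apply: cl_map => y [Ey|->]; apply: sub_cl; [left | by right].
  by rewrite sE.
have e1 : pi' + u * h' = c by rewrite -sc rmorphD rmorphM /= su.
(* Modulo the maximal ideal, 1 and [u] are linearly independent over E. *)
have unit_free e e' : E e -> E e' -> m (e + u * e') -> e' = 0.
  move=> Ee Ee' me; apply/eqP/negPn/negP => e'0.
  apply: (uE (e := - e / e')).
    by apply: (subfield_div hE) => //; exact: subfieldN.
  rewrite mulNr opprK -[u](mulfK e'0) -mulrDl addrC; apply: vmaxMr => //.
  by apply: EO; exact: subfieldV.
(* For a point at infinity, dividing the equation of the line by h' shows that pi'/h' has residue
   that of -u, although its residue lies in E. *)
have Oh' : h' \in O.
  apply/negPn/negP => nh'; have mV := vmaxV nh'.
  have h'0 : h' != 0 by apply: contraNneq nh' => ->; rewrite rpred0.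
  have q : pi' / h' = c / h' - u by rewrite -e1 mulrDl mulfK // addrK.
  have mq : m (c / h') by apply: vmaxMr => //; exact: vmaxO mV.
  have [||e Ee me] := hs (pi' / h').
  - by apply: (subfield_div T'); exact: mapT.
  - by rewrite q rpredB // vmaxO.
  apply: (uE (e := - e)); first exact: subfieldN.
  have -> : u - - e = c / h' - (pi' / h' - e) by rewrite q; mc_ring F.
  exact: vmaxB.
have Opi' : pi' \in O by rewrite -(addrK (u * h') pi') e1 rpredB ?rpredM // vmaxO.
have [e2 Ee2 me2] := hs h' (mapT _ th) Oh'.
have [e1' Ee1 me1] := hs pi' (mapT _ tpi) Opi'.
(* Reducing pi' + u h' = c gives a relation between 1 and [u] over E; so the second point also
   reduces to the origin. *)
have e20 : e2 = 0.
  apply: (unit_free e1') => //.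
  have -> : e1' + u * e2 = c - (pi' - e1' + u * (h' - e2)) by rewrite -e1; mc_ring F.
  by apply: vmaxB => //; apply: vmaxD => //; exact: vmaxMl.
have mh' : m h' by rewrite -[h']subr0 -e20.
have mpi' : m pi' by rewrite -(addrK (u * h') pi') e1; apply: vmaxB => //; exact: vmaxMl.
have G0' : G.[h'%:P].[pi'] = 0.
  have ev x y : G.[y%:P].[x] = \sum_(i < size G) (G`_i).[x] * y ^+ i.
    by rewrite (horner_coef G) horner_sum; apply: eq_bigr => i _; rewrite hornerM -polyC_exp hornerC.
  have := congr1 s G0; rewrite rmorph0 => e0; apply: etrans e0.
  rewrite !ev rmorph_sum; apply: eq_bigr => i _.
  rewrite rmorphM rmorphXn /=; congr (_ * _); rewrite -horner_map; congr (_.[_]).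
  by apply/polyP => j; rewrite coef_map /= sE.
have [a [b [eG ma mb]]] := horner2_diff EO hG mpi mh mpi' mh'.
have dpi : pi' - pi = - (u * (h' - h)).
  have -> : pi' = c - u * h' by rewrite -e1; mc_ring F.
  by rewrite /c; mc_ring F.
(* The difference of the curve equation at the two points, restricted to the line, where pi' - pi =
   - u (h' - h). *)
have /eqP : (h' - h) * (b - u * a) = 0.
  by transitivity ((pi' - pi) * a + (h' - h) * b); [rewrite dpi; mc_ring F | rewrite -eG G0 G0' subrr].
rewrite mulf_eq0 => /orP[|/eqP bua].
  rewrite subr_eq0 => /eqP eh; split=> //; apply/eqP.
  by rewrite -subr_eq0 dpi eh subrr mulr0 oppr0.
(* If b = u a, reduction gives a relation between 1 and [u] over E, which makes both partial
   derivatives of G vanish at the origin, against smoothness. *)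
have mBA : m (G`_1`_0 + u * - G`_0`_1).
  have -> : G`_1`_0 + u * - G`_0`_1 = b - u * a - (b - G`_1`_0) + u * (a - G`_0`_1) by mc_ring F.
  rewrite bua sub0r; apply: vmaxD; [exact: vmaxN | exact: vmaxMl].
have := unit_free _ _ (hG 1%N 0%N) (subfieldN hE (hG 0%N 1%N)) mBA.
move=> A0; move: mBA; rewrite A0 mulr0 addr0 => mB.
by case/eqP: G1; exact: (subfield_vmax hE EO).
Qed.

End Curve.

End Specialize.

(** * Finite orbits and the equality of W with W_v *)

Section InvariantRep.
Variables (k F : fieldType) (iota : {rmorphism k -> F}) (W : smooth_rep iota).
Local Notation act := (@rep_act _ _ _ W).

Lemma rep_actB s (x y : W) : act s (x - y) = act s x - act s y.
Proof.
have := rep_act_linear s (- 1) y x; rewrite !scaleN1r => e.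
by rewrite addrC e addrC.
Qed.

Lemma rep_act_inj s : injective (act s).
Proof.
have [a1 aM] := rep_actP W => x y e.
by rewrite -[x]a1 -[y]a1 -(mulVg s) !aM e.
Qed.

Lemma rep_act_sum s (l : seq W) : act s (\sum_(z <- l) z) = \sum_(z <- l) act s z.
Proof.
have act0 : act s 0 = 0 by have := rep_actB s 0 0; rewrite !subrr.
elim: l => [|z l IHl]; first by rewrite !big_nil.
by rewrite !big_cons -IHl -[in LHS](opprK (\sum_(j <- l) j)) rep_actB -sub0r rep_actB act0 sub0r opprK.
Qed.

Lemma rep_smooth_seq (w : W) : exists l : seq F, fixed act (gal_over [set` l]) w.
Proof.
have [a1 aM] := rep_actP W; have [l hl] := @rep_smooth _ _ _ W w 1%g (a1 w).
by exists l => s /hl /=; rewrite mul1g.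
Qed.

Lemma in_I_G_adjoin1 (M : set F) x : in_I_G W -> subfield M -> range iota `<=` M ->
  ~ algebraic_over M x -> fixed act (gal_over M) = fixed act (gal_over (adjoin M [set x])).
Proof.
by move=> hW hM kM nx; apply: hW => //; exists [set x] => //; exact: alg_indep1.
Qed.

End InvariantRep.

Lemma galM (k F : fieldType) (iota : {rmorphism k -> F}) (s t : gal iota) x :
  (s * t)%g x = s (t x).
Proof. by []. Qed.

Section WvAll.
Variables (k : fieldType) (F : closedFieldType) (iota : {rmorphism k -> F}).
Variable char0 : [pchar F] =i pred0.
Variable v : valuation_ring iota.
Local Notation O := (vring_pred v).
Local Notation cl := (adjoin_acl (range iota)).
Local Notation m := (vmax v).
Variables (B : set F) (t : F).
Hypotheses (hB : residual_basis v B t) (mt : m t).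
Variables (W : smooth_rep iota) (hW : in_I_G W).
Local Notation act := (@rep_act _ _ _ W).

Lemma Vv_in_I_G (w : W) : Vv act v w.
Proof.
have [a1 aM] := rep_actP W; have [BO iB Bt Binf t0] := hB.
have [l hl] := rep_smooth_seq w.
have [u Bu lE] := residual_split hB l.
pose E := cl (B `\ u).
have clE : cl E = E by rewrite /E cl_cl.
have EO : E `<=` [set` O].
  by move=> x Ex; apply: BO; apply: cl_mono Ex => y [].
have hE : subfield E by exact: cl_subfield.
have kE : range iota `<=` E by exact: base_cl.
have Ou : u \in O by apply: BO; exact: sub_cl.
have uE : forall e, E e -> ~ m (u - e) := residual_notin_sub hB Bu.
have [pi [h [G [[mpi pi0 mh tpi th] [lph hG G0 G1]]]]] := coordinates char0 clE EO mt t0 lE.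
pose c := pi + u * h.
pose Eu := adjoin E [set u]; have hEu : subfield Eu := adjoin_subfield _ _.
pose K := adjoin Eu [set c]; have hK : subfield K := adjoin_subfield _ _.
have EEu : E `<=` Eu by exact: sub_adjoinl.
have EuK : Eu `<=` K by exact: sub_adjoinl.
have Ku : K u by apply: EuK; apply: sub_adjoinr.
have Kc : K c by apply: sub_adjoinr.
have u_transc : ~ algebraic_over E u.
  move=> /(closed_acl clE) Eu'; apply: (uE u Eu'); rewrite subrr; exact: vmax0.
have c_transc : ~ algebraic_over Eu c.
  by rewrite -(cl_closedE clE); exact: (pencil_transc clE EO mt t0 Ou uE mpi pi0 mh tpi th).
(* Two simple transcendental extensions: [u] is adjoined first, then [c]. *)
have fixK : fixed act (gal_over E) = fixed act (gal_over K).
  rewrite (in_I_G_adjoin1 hW hE kE u_transc) (in_I_G_adjoin1 hW hEu _ c_transc) //.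
  exact: subset_trans kE EEu.
have algK x : cl (E `|` [set t]) x -> algebraic_over K x.
  move=> /(pencil_alg clE EO mt t0 Ou uE mpi pi0 mh tpi th).
  by rewrite (cl_closedE clE) adjoinU.
have [ppi [ppi0 hppi] rpi] := algK _ tpi.
have [ph [ph0 hph] rh] := algK _ th.
have [r1 hr1] := poly_roots_finite ppi0; have [r2 hr2] := poly_roots_finite ph0.
have rootK (p : {poly F}) x (s : gal iota) : gal_over K s -> (forall i, K p`_i) -> root p x -> root p (s x).
  move=> sK hp /rootP px; apply/rootP; rewrite -(gal_root s px); congr (_.[_]).
  by apply/polyP => i; rewrite coef_map /= sK.
have lfix s : gal_over K s -> s pi = pi -> s h = h -> act s w = w.
  move=> sK spi sh; apply: hl => x /lph; apply: (adjoin_min (fixed_subfield s)).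
    by move=> y Ey; apply: sK; apply: EuK; apply: EEu.
  by move=> y [->|->].
have [|s s' sK s'K [epi eh]|os [uos hos]] := @orbit_finite (gal iota) (gal_over K) _ _
  (fun s => (s pi, s h)) (fun s => act s w) [seq (x, y) | x <- r1, y <- r2].
- move=> s sK; apply: allpairs_f; [apply: hr1 | apply: hr2]; exact: rootK.
- have rw : act (s'^-1 * s)%g w = w.
    apply: lfix => [x Kx||].
    + by rewrite galM (sK _ Kx) -{1}(s'K _ Kx) galVK.
    + by rewrite galM epi galVK.
    + by rewrite galM eh galVK.
  by rewrite -[in RHS]rw -aM mulVKg.
pose S := \sum_(z <- os) z.
have SK : fixed act (gal_over K) S.
  move=> s sK; rewrite rep_act_sum -(big_map (act s) xpredT id); apply: perm_big.
  apply: uniq_perm => //; first by rewrite map_inj_uniq //; exact: rep_act_inj.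
  move=> z; apply/mapP/idP => [[y /hos[r rK ->] ->]|/hos[r rK ->]].
    by apply/hos; exists (s * r)%g; rewrite ?aM // => x Kx; rewrite galM rK ?sK.
  exists (act (s^-1 * r)%g w); last by rewrite -aM mulVKg.
  apply/hos; exists (s^-1 * r)%g => // x Kx.
  by rewrite galM rK // -{1}(sK _ Kx) galVK.
have ww : w \in os.
  by apply/hos; exists 1%g => //; rewrite a1.
have -> : w = S - \sum_(z <- os | z != w) z.
  by rewrite /S (bigD1_seq w) //= addrK.
apply: VvB; first exact: rep_actB.
  by apply: (@Vv_fixed _ _ _ _ _ v E) => //; rewrite fixK.
apply: Vv_sum => z /hos[s sK ->] sw.
(* If no such z0 existed, all residues over E(s t) would lie in E, and [pencil_specialize] would
   give s w = w. *)
have [z0 [clz0 Oz0 nz0]] : exists z0, [/\ cl (E `|` [set s t]) z0, z0 \in O & forall e, E e -> ~ m (z0 - e)].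
  apply: contrapT => H; case/eqP: sw.
  have hs z0 : cl (E `|` [set s t]) z0 -> z0 \in O -> exists2 e, E e & m (z0 - e).
    move=> hz Oz; apply: contrapT => nz; apply: H; exists z0; split=> // e Ee me.
    by apply: nz; exists e.
  have [] := pencil_specialize clE EO Ou uE mpi mh tpi th hG G0 G1 _ (sK _ Ku) (sK _ Kc) hs.
    by move=> x Ex; apply: sK; apply: EuK; apply: EEu.
  exact: lfix.
have sE x : E x -> s x = x by move=> Ex; apply: sK; apply: EuK; apply: EEu.
(* By exchange s t is algebraic over E(z0), so an automorphism over this closure fixes s(l)
   pointwise; conjugating by s reduces to the stabilizer of [l]. *)
apply: (@Vv_fixed _ _ _ _ _ v (cl (E `|` [set z0]))).
- exact: cl_subfield.
- exact: base_cl.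
- exact: vring_adjoin.
move=> r hr; have rw : act (s^-1 * (r * s))%g w = w.
  apply: hl => x /lE hx; rewrite !galM hr ?galVK //.
  apply: cl_map hx => y [Ey|->]; first by rewrite sE //; apply: sub_cl; left.
  apply: cl_exchange clz0 _; rewrite clE => Ez0.
  by apply: (nz0 z0) => //; rewrite subrr; exact: vmax0.
by rewrite -[in RHS]rw -!aM mulVKg.
Qed.
End WvAll.

(** * Residual transcendence bases *)

Lemma range_subfield (k F : fieldType) (iota : {rmorphism k -> F}) : subfield (range iota).
Proof.
split=> [|x y|x y].
- by apply/mem_set; exists 1; rewrite ?rmorph1.
- by move=> /set_mem[a _ <-] /set_mem[b _ <-]; apply/mem_set; exists (a - b); rewrite ?rmorphB.
- by move=> /set_mem[a _ <-] /set_mem[b _ <-]; apply/mem_set; exists (a / b); rewrite ?fmorph_div.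
Qed.

Section ResidueMap.
Variables (k : fieldType) (F : closedFieldType) (iota : {rmorphism k -> F}).
Variable v : valuation_ring iota.
Local Notation O := (vring_pred v).
Local Notation cl := (adjoin_acl (range iota)).
Local Notation m := (vmax v).

Lemma vring_unitP x : vring_unit v x <-> x \in O /\ ~ m x.
Proof.
split=> [[x0 Ox OVx]|[Ox nx]].
  by split=> // -[_ /(_ _ OVx)]; rewrite divff.
split=> //; last exact: vunitV.
by apply/eqP => x0; apply: nx; rewrite x0; exact: vmax0.
Qed.

Variables (kappa : fieldType) (res : {rmorphism vring v -> kappa}).
Hypothesis hres : is_residue_map res.

(** Total on F, with default 0 outside O_v, so that polynomials over F can be reduced
    coefficientwise. *)
Definition residue (x : F) : kappa := if insub x is Some y then res y else 0.

Lemma residueE (y : vring v) : residue (\val y) = res y.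
Proof. by rewrite /residue valK. Qed.

Lemma residue_eq0 x : x \in O -> residue x = 0 <-> m x.
Proof.
move=> Ox; rewrite -[x]/(\val (Vring Ox)) residueE; split.
  move=> /hres.2; rewrite vring_unitP => h; apply: contrapT => nm; exact: h.
by move=> mx; apply/hres.2; rewrite vring_unitP => -[].
Qed.

Lemma residue_sum (I : Type) (r : seq I) (f : I -> F) : (forall i, f i \in O) ->
  residue (\sum_(i <- r) f i) = \sum_(i <- r) residue (f i).
Proof.
move=> hf; pose g i := Vring (hf i).
have -> : \sum_(i <- r) f i = \val (\sum_(i <- r) g i) by rewrite rmorph_sum.
by rewrite residueE rmorph_sum; apply: eq_bigr => i _; rewrite -residueE.
Qed.

Lemma residue_prod (I : Type) (r : seq I) (f : I -> F) : (forall i, f i \in O) ->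
  residue (\prod_(i <- r) f i) = \prod_(i <- r) residue (f i).
Proof.
move=> hf; pose g i := Vring (hf i).
have -> : \prod_(i <- r) f i = \val (\prod_(i <- r) g i) by rewrite rmorph_prod.
by rewrite residueE rmorph_prod; apply: eq_bigr => i _; rewrite -residueE.
Qed.

Lemma residueM x y : x \in O -> y \in O -> residue (x * y) = residue x * residue y.
Proof.
move=> Ox Oy; rewrite -[x]/(\val (Vring Ox)) -[y]/(\val (Vring Oy)) -rmorphM.
by rewrite !residueE rmorphM.
Qed.

Lemma residueX x n : x \in O -> residue (x ^+ n) = residue x ^+ n.
Proof.
by move=> Ox; rewrite -[x]/(\val (Vring Ox)) -rmorphXn !residueE rmorphXn.
Qed.

Lemma residue_meval n (p : {mpoly F[n]}) (t : 'I_n -> F) :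
  (forall mm, p@_mm \in O) -> (forall i, t i \in O) ->
  residue p.@[t] = (\sum_(mm <- msupp p) residue p@_mm *: 'X_[mm]).@[fun i => residue (t i)].
Proof.
move=> hp ht; rewrite [in LHS]mevalE [in RHS]raddf_sum residue_sum => [|mm]; last first.
  by rewrite rpredM // rpred_prod // => i _; rewrite rpredX.
apply: eq_bigr => mm _; rewrite /= mevalZ mevalX residueM //; last first.
  by rewrite rpred_prod // => i _; rewrite rpredX.
rewrite residue_prod => [|i]; last by rewrite rpredX.
by congr (_ * _); apply: eq_bigr => i _; rewrite residueX.
Qed.

Variable B : set (vring v).
Hypothesis injB : {in B &, injective res}.
Hypothesis indepB : alg_indep [set res (Vring (vring_base v a)) | a in setT] (res @` B).

(** The reduction of [p] is a relation between independent residues, hence zero; and a coefficient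
    of [p], coming from k, vanishes as soon as its residue does. *)
Lemma meval_unit n (t : 'I_n -> F) (p : {mpoly F[n]}) : injective t ->
  (forall i, (\val @` B) (t i)) -> (forall mm, range iota p@_mm) -> m p.@[t] -> p = 0.
Proof.
move=> tinj tB hp mp.
have pO mm : p@_mm \in O by have [a _ <-] := hp mm; exact: vring_base.
have tO i : t i \in O by have [b _ <-] := tB i; exact: valP.
pose q := \sum_(mm <- msupp p) residue p@_mm *: 'X_[mm].
have q0 : q = 0.
  apply: (indepB (t := fun i => residue (t i))).
  - move=> i j; have [[b Bb eb] [b' Bb' eb']] := (tB i, tB j).
    rewrite -eb -eb' !residueE => /injB; rewrite !in_setE => /(_ Bb Bb') ebb.
    by apply: tinj; rewrite -eb -eb' ebb.
  - by move=> i; have [b Bb <-] := tB i; exists b => //; rewrite residueE.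
  - move=> mm; rewrite /q raddf_sum /=.
    have [mmp|mmp] := boolP (mm \in msupp p).
      rewrite (bigD1_seq mm) ?msupp_uniq //= mcoeffZ mcoeffX eqxx mulr1.
      rewrite big1 ?addr0 => [|mm' /negPf mmm]; last by rewrite mcoeffZ mcoeffX mmm mulr0.
      have [a _ <-] := hp mm; exists a => //.
      by rewrite -residueE.
    rewrite big_seq big1 => [|mm' mp']; last first.
      by rewrite mcoeffZ mcoeffX; case: eqP => [e|]; rewrite ?mulr0 //; rewrite -e mp' in mmp.
    by exists 0 => //; rewrite -residueE /= rmorph0; apply/residue_eq0; [exact: rpred0 | exact: vmax0].
  - by rewrite -residue_meval //; apply/residue_eq0 => //; exact: vmaxO.
apply/mpolyP => mm; rewrite mcoeff0; apply/eqP/negPn/negP => pm.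
have := congr1 (fun q : {mpoly kappa[n]} => q@_mm) q0.
rewrite mcoeff0 /q raddf_sum /= (bigD1_seq mm) ?msupp_uniq ?mcoeff_msupp //=.
rewrite mcoeffZ mcoeffX eqxx mulr1 big1 ?addr0 => [|mm' /negPf mmm]; last first.
  by rewrite mcoeffZ mcoeffX mmm mulr0.
move=> /(residue_eq0 (pO mm)) mpm; case/eqP: pm.
apply: (subfield_vmax (range_subfield iota) _ (hp mm) mpm) => x [a _ <-]; exact: vring_base.
Qed.

Lemma lift_alg_indep : alg_indep (range iota) (\val @` B).
Proof.
move=> n t ti tB p hp pt; apply: (meval_unit ti tB hp); rewrite pt; exact: vmax0.
Qed.

(** By [meval_unit] a nonzero polynomial expression in the lifts, in particular every denominator,
    is a unit of O_v. *)
Lemma lift_adjoin : adjoin (range iota) (\val @` B) `<=` [set` O].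
Proof.
have hk := range_subfield iota.
move=> x /(adjoinP hk)[s [a [b [sB ha hb b0 ->]]]].
have hundup y : y \in mgen_pred hk s -> y \in mgen_pred hk (undup s).
  by apply: mgen_mono => z; rewrite mem_undup.
have sO i : (undup s)`_i \in O.
  have [si|si] := ltnP i (size (undup s)); last by rewrite nth_default // rpred0.
  have := mem_nth 0 si; rewrite mem_undup => /sB[c _ <-]; exact: valP.
have mgO y : y \in mgen_pred hk s -> y \in O.
  move=> /hundup/set_mem[p /mpolyOverP hp ->]; rewrite mevalE; apply: rpred_sum => mm _.
  apply: rpredM; last by apply: rpred_prod => i _; apply: rpredX.
  by have /subfield_predE[c _ <-] := hp mm; exact: vring_base.
apply: rpredM; first exact: mgO.
apply: vunitV; first exact: mgO.
move: hb b0 => /hundup/set_mem[p /mpolyOverP hp ->] p0 mp; case/eqP: p0.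
rewrite (meval_unit _ _ _ mp) ?meval0 //.
- move=> i j /eqP; rewrite nth_uniq ?undup_uniq // => /eqP; exact: val_inj.
- by move=> i; apply: sB; rewrite /= -mem_undup mem_nth.
- by move=> mm; apply/subfield_predE.
Qed.

End ResidueMap.

Section Existence.
Variables (k : fieldType) (F : closedFieldType) (iota : {rmorphism k -> F}).
Local Notation cl := (adjoin_acl (range iota)).

(** A finite [S] involves only the x_i with i < N for some N; if it generated F up to algebraic
    elements, x_N would depend on them. *)
Lemma infinite_trdeg (x : nat -> F) (S : seq F) : injective x ->
  transc_basis (range iota) (range x) -> ~ forall y, cl [set` S] y.
Proof.
move=> xi [ix xF] SF.
have fin (l : seq F) : [set` l] `<=` range x -> exists N, [set` l] `<=` [set x i | i in [set i | (i < N)%N]].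
  elim: l => [|a l IHl] h; first by exists 0%N => y /=; rewrite inE.
  have [|N hN] := IHl; first by move=> y yl; apply: h; rewrite /= inE (_ : y \in l) ?orbT.
  have [i _ ia] := h a (mem_head _ _); exists (maxn N i.+1) => y /=.
  rewrite inE => /predU1P[->|/hN[j jN <-]].
    by exists i; rewrite //= leq_max ltnSn orbT.
  by exists j; rewrite //= leq_max (jN : (j < N)%N).
have [N hN] : exists N, [set` S] `<=` cl [set x i | i in [set i | (i < N)%N]].
  elim: S {SF} => [|a l [N hN]]; first by exists 0%N => y /=; rewrite inE.
  have [s' /fin[N' hN'] as'] := cl_fin (xF a).
  exists (maxn N N') => y /=; rewrite inE => /predU1P[->|/hN].
    apply: cl_mono as' => z /hN'[i iN <-].
    by exists i; rewrite //= leq_max (iN : (i < N')%N) orbT.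
  apply: cl_mono => z [i iN <-].
  by exists i; rewrite //= leq_max (iN : (i < N)%N).
apply: (alg_indep_not_acl (range_subfield iota) ix (u := x N)); first by exists N.
apply: cl_mono (cl_min hN (SF (x N))) => z [i iN <-]; split; first by exists i.
by move=> /= /xi ei; move: iN; rewrite /= ei ltnn.
Qed.

Lemma exists_residual_basis (v : valuation_ring iota) (x : nat -> F) : injective x ->
  transc_basis (range iota) (range x) -> discrete_rank_one v ->
  exists B t, residual_basis v B t /\ vmax v t.
Proof.
move=> xi hx [kappa [res [Gam [nu [hres hnu _ [B [t [injB [iB _] t0 bt ct]]]]]]]].
have nut : nu t != 0 by have := basis_free bt; rewrite seq1_free.
have ntU : ~ vring_unit v t.
  by have [_ _ h] := hnu; move/(h t t0) => nt0; rewrite nt0 eqxx in nut.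
pose B' : set F := \val @` B.
have base t' : vmax v t' -> t' != 0 -> cl (B' `|` [set t']) t -> residual_basis v B' t'.
  move=> mt' t'0 tt'; have all y : cl (B' `|` [set t']) y.
    by apply: (cl_min _ (ct y)) => z [Bz|->] //; apply: sub_cl; left.
  split=> //; first exact/cl_sub_vring/(lift_adjoin hres injB iB).
    by move=> u; exact: (alg_indep_not_acl (range_subfield iota) (lift_alg_indep hres injB iB)).
  (* If the finite list [s] contained B, then F would be algebraic over the field generated by t'
     and [s]. *)
  move=> s; apply: contrapT => H; apply: (@infinite_trdeg x (t' :: s) xi hx) => y.
  apply: cl_mono (all y) => z [Bz|->]; last exact: mem_head.
  rewrite /= inE; apply/orP; right; apply: contrapT => zs; apply: H; exists z => //.
  exact/negP.
have [Ot|nOt] := boolP (t \in vring_pred v).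
  exists B', t; have mt : vmax v t.
    by apply: contrapT => nm; apply: ntU; apply/vring_unitP.
  by split=> //; apply: base => //; apply: sub_cl; right.
exists B', t^-1; have mt := vmaxV nOt; split=> //; apply: base; rewrite ?invr_eq0 //.
rewrite -[X in cl _ X]invrK; apply: (subfieldV (cl_subfield _ _)).
by apply: sub_cl; right.
Qed.

End Existence.

(** * Extension of automorphisms *)

Section PartialIso.
Variable F : closedFieldType.
Implicit Types R : set (F * F).

(* [R] is the graph of an isomorphism between two subfields of [F]. *)
Definition partial_iso R :=
  [/\ R 1, forall x y, R x -> R y -> R (x - y), forall x y, R x -> R y -> R (x * y),
      forall a b, R (a, b) -> R (a^-1, b^-1) & forall b, R (0, b) -> b = 0].

Definition pdom R : set F := [set a | exists b, R (a, b)].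

Section Fixed.
Variables (R : set (F * F)) (hR : partial_iso R).

Lemma piso_subring : GRing.subring_closed (mem R).
Proof.
case: hR => R1 RB RM _ _; split=> [|x y|x y]; first exact/mem_set.
- by move=> /set_mem hx /set_mem hy; apply/mem_set/RB.
- by move=> /set_mem hx /set_mem hy; apply/mem_set/RM.
Qed.

Definition piso_pred of partial_iso R : {pred F * F} := mem R.
HB.instance Definition _ := GRing.isSubringClosed.Build (F * F)%type (piso_pred hR) piso_subring.

Lemma piso_predE x : (x \in piso_pred hR) <-> R x.
Proof. by split=> [/set_mem|/mem_set]. Qed.

Lemma piso_unique a b b' : R (a, b) -> R (a, b') -> b = b'.
Proof.
case: hR => _ RB _ _ R0 h h'; have : R (a - a, b - b') := RB _ _ h h'.
by rewrite subrr => /R0/eqP; rewrite subr_eq0 => /eqP.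
Qed.

Lemma piso_snd_neq0 a b : R (a, b) -> a != 0 -> b != 0.
Proof.
case: hR => R1 _ RM RV _ h a0; apply/eqP => b0.
have : R (a / a, b / b) := RM _ _ h (RV _ _ h); rewrite divff // b0 mul0r.
by move=> /(piso_unique R1)/eqP; rewrite oner_eq0.
Qed.

Lemma pdom_subfield : subfield (pdom R).
Proof.
case: hR => R1 RB RM RV _; split=> [|x y|x y].
- by apply/mem_set; exists 1.
- move=> /set_mem[x' hx] /set_mem[y' hy]; apply/mem_set; exists (x' - y'); exact: (RB _ _ hx hy).
- move=> /set_mem[x' hx] /set_mem[y' hy]; apply/mem_set; exists (x' / y'); exact: (RM _ _ hx (RV _ _ hy)).
Qed.

Lemma piso_poly_size (f : {poly (F * F)%type}) : f \is a polyOver (piso_pred hR) ->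
  size (map_poly fst f) = size f.
Proof.
move=> /polyOverP hf; have [->|f0] := eqVneq f 0; first by rewrite rmorph0 !size_poly0.
apply: size_map_poly_id0; apply: contraNneq f0 => l0.
rewrite -lead_coef_eq0; have /piso_predE := hf (size f).-1.
rewrite -/(lead_coef f); case: (lead_coef f) l0 => a b /= -> hb.
have [_ _ _ _ R0] := hR; by rewrite (R0 _ hb); apply/eqP.
Qed.

Lemma piso_lift (p : {poly F}) : (forall i, pdom R p`_i) ->
  exists2 f, f \is a polyOver (piso_pred hR) & p = map_poly fst f.
Proof.
move=> /choice[g hg]; exists (\poly_(i < size p) (p`_i, g i)).
  apply/polyOverP => i; rewrite coef_poly; case: ifP => _; last exact: rpred0.
  exact/piso_predE/hg.
apply/polyP => i; rewrite coef_map coef_poly; case: ltnP => // ip.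
by rewrite nth_default.
Qed.

Variable a : F.
Hypothesis alga : algebraic_over (pdom R) a.

(* Pairs of polynomials with related coefficients are polynomials over the
   product ring [F * F]; evaluating them at [(a, b)], with [b] a root of the
   transported minimal equation of [a], extends [R] to [a]. *)
Lemma piso_extend : exists R' , [/\ partial_iso R', R `<=` R' & pdom R' a].
Proof.
have [R1 RB RM RV R0] := hR.
pose Q n := `[< exists f : {poly (F * F)%type}, [/\ f \is a polyOver (piso_pred hR),
  f != 0, size f = n & (map_poly fst f).[a] = 0] >].
have exQ : exists n, Q n.
  case: alga => p [p0 /piso_lift[f hf pf]] pa; exists (size f); apply/asboolP.
  exists f; split=> //; first by apply: contraNneq p0 => f0; rewrite pf f0 rmorph0.
  by rewrite -pf; exact/rootP.
have [n /asboolP[p0 [hp0 p00 sp0 p0a]] nmin] := ex_minnP exQ.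
have [p [hp mp sp pa]] : exists p : {poly (F * F)%type}, [/\ p \is a polyOver (piso_pred hR),
    p \is monic, size p = n & (map_poly fst p).[a] = 0].
  case e : (lead_coef p0) => [c1 c2].
  have hc : R (c1, c2) by rewrite -e; apply/piso_predE; exact: (polyOverP hp0).
  have c10 : c1 != 0.
    apply: contra_neq p00 => c10; apply/eqP; rewrite -lead_coef_eq0 e c10.
    by rewrite c10 in hc; rewrite (R0 _ hc).
  have c20 := piso_snd_neq0 hc c10.
  have cc : (c1^-1, c2^-1) * (c1, c2) = 1 :> F * F by apply/eqP; rewrite xpair_eqE /= !mulVf ?eqxx.
  pose c : F * F := (c1^-1, c2^-1).
  have cl : lead_coef c%:P * lead_coef p0 = 1 by rewrite lead_coefC e.
  have cl0 : lead_coef c%:P * lead_coef p0 != 0 by rewrite cl oner_eq0.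
  exists (c%:P * p0); split.
  - by apply: rpredM => //; rewrite polyOverC; apply/piso_predE/RV.
  - by rewrite monicE lead_coef_proper_mul // cl.
  - have c0 : c != 0 by apply: contraNneq cl0 => ->; rewrite lead_coefC mul0r.
    by rewrite size_proper_mul // size_polyC c0.
  - by rewrite rmorphM hornerM p0a mulr0.
have smin f : f \is a polyOver (piso_pred hR) -> (map_poly fst f).[a] = 0 -> (size f < n)%N -> f = 0.
  move=> hf fa; apply: contraTeq => f0; rewrite -leqNgt; apply: nmin.
  by apply/asboolP; exists f.
have sp1 : size (map_poly snd p) = n.
  by rewrite size_map_poly_id0 // (monicP mp) /= oner_eq0.
have n1 : (1 < n)%N.
  rewrite -sp -(piso_poly_size hp); apply: (@root_size_gt1 _ a); last exact/rootP.
  by rewrite -size_poly_eq0 piso_poly_size // size_poly_eq0 monic_neq0.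
have [b pb] : exists b, root (map_poly snd p) b.
  by apply/closed_rootP; rewrite sp1 neq_ltn n1 orbT.
pose ab : F * F := (a, b).
have ev1 (f : {poly (F * F)%type}) : f.[ab].1 = (map_poly fst f).[a] by rewrite -(horner_map fst).
have ev2 (f : {poly (F * F)%type}) : f.[ab].2 = (map_poly snd f).[b] by rewrite -(horner_map snd).
have pab : p.[ab] = 0.
  by rewrite [LHS]surjective_pairing ev1 ev2 pa (rootP pb).
(* Division by the monic [p] over the product ring: subtracting multiples of [p] keeps the value at
   (a, b) and brings the size below [n], where a polynomial vanishing at [a] is zero by
   minimality. *)
have key (f : {poly (F * F)%type}) : f \is a polyOver (piso_pred hR) ->
    f.[ab].1 = 0 -> f.[ab].2 = 0.
  have [N] := ubnP (size f); elim: N f => // N IHN f; rewrite ltnS => sf hf f1.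
  have [sn|ns] := ltnP (size f) n.
    by rewrite (smin f) ?horner0 // -ev1.
  pose g := f - lead_coef f *: (p * 'X^(size f - n)).
  have gab : g.[ab] = f.[ab] by rewrite hornerD hornerN hornerZ hornerM pab mul0r mulr0 subr0.
  have sf0 : (0 < size f)%N by apply: leq_trans ns; apply: ltnW.
  have hg : g \is a polyOver (piso_pred hR).
    apply: rpredB => //; apply: polyOverZ; first exact: (polyOverP hf).
    by apply: rpredM => //; rewrite rpredX ?polyOverX.
  have sg : (size g < size f)%N.
    have sm : size (p * 'X^(size f - n)) = size f.
      by rewrite size_Mmonic ?monicXn ?monic_neq0 // sp size_polyXn addnS subnKC.
    rewrite -[size f]prednK // ltnS; apply/leq_sizeP => j hj.
    rewrite coefB coefZ; have [jf|jf] := ltnP j (size f); last first.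
      by rewrite !nth_default ?mulr0 ?subr0 ?sm.
    have -> : j = (size f).-1 by apply/eqP; rewrite eqn_leq hj andbT -ltnS prednK.
    have mM : p * 'X^(size f - n) \is monic by rewrite monicMr // monicXn.
    have -> : (p * 'X^(size f - n))`_(size f).-1 = 1 by have := monicP mM; rewrite lead_coefE sm.
    by rewrite mulr1 subrr.
  by rewrite -gab; apply: IHN; rewrite ?gab //; exact: leq_trans sg sf.
pose R' : set (F * F) := [set x | exists2 f, f \is a polyOver (piso_pred hR) & x = f.[ab]].
have RR' : R `<=` R'.
  by move=> x Rx; exists x%:P; rewrite ?hornerC // polyOverC; exact/piso_predE.
have R'M x y : R' x -> R' y -> R' (x * y).
  by move=> [f hf ->] [g hg ->]; exists (f * g); rewrite ?hornerM // rpredM.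
have R'B x y : R' x -> R' y -> R' (x - y).
  by move=> [f hf ->] [g hg ->]; exists (f - g); rewrite ?hornerD ?hornerN // rpredB.
have R'0 y : R' (0, y) -> y = 0.
  by move=> [f hf e]; have := key f hf; rewrite -e; apply.
have R'a : R' ab by exists 'X; rewrite ?hornerX // polyOverX.
exists R'; split=> //; last by exists b.
split=> //; first exact: RR'.
move=> x x' Rx; have [x0|x0] := eqVneq x 0.
  move: Rx; rewrite x0 => Rx; have x'0 := R'0 _ Rx.
  by move: Rx; rewrite x'0 !invr0.
have hD := pdom_subfield.
have algx : algebraic_over (pdom R) x.
  have [f hf ex] := Rx; have -> : x = (map_poly fst f).[a] by rewrite -ev1 -ex.
  apply: (subfield_horner (acl_subfield hD)) => // i; apply: (sub_acl hD).
  rewrite coef_map; have /piso_predE := polyOverP hf i.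
  by case: (f`_i) => c1 c2 hc; exists c2.
(* With q = q' X + q_0 and q_0 nonzero, 1/x = - q'(x) / q_0 is polynomial in x, so closure under
   inverses follows from closure under ring operations. *)
have [q [hq qx q0]] : exists q : {poly F}, [/\ forall i, pdom R q`_i, q.[x] = 0 & q`_0 != 0].
  have [q0 [q00 hq0] q0x] := algx; have [j [q [eq0 hq q0']]] := poly_shift q00 hq0.
  exists q; split=> //; apply: (mulfI (expf_neq0 j x0)).
  by rewrite mulr0 -(rootP q0x) eq0 hornerM hornerXn.
have [fq hfq efq] := piso_lift hq.
pose fq' := drop_poly 1 fq.
have hfq' : fq' \is a polyOver (piso_pred hR).
  by apply/polyOverP => i; rewrite coef_drop_poly; exact: (polyOverP hfq).
have fqE : fq = fq' * 'X + (fq`_0)%:P.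
  apply/polyP => i; rewrite coefD coefMX coefC coef_drop_poly.
  by case: i => [|i] /=; rewrite ?add0r ?addr0 ?addn1.
case ec : (fq`_0) fqE => [c1 c2] fqE.
have hc : R (c1, c2) by rewrite -ec; apply/piso_predE; exact: (polyOverP hfq).
have c1E : c1 = q`_0 by rewrite efq coef_map ec.
have c10 : c1 != 0 by rewrite c1E.
have [g hg eg] := Rx.
have Rw0 : R' fq'.[(x, x')].
  by exists (fq' \Po g); [exact: polyOver_comp | rewrite horner_comp -eg].
case ew : (fq'.[(x, x')]) Rw0 => [w1 w2] Rw0.
have RVc : R' (c1^-1, c2^-1) by apply/RR'/RV.
have q1 : w1 * x + c1 = 0.
  have : (fq.[(x, x')]).1 = 0 by rewrite -(horner_map fst) -efq.
  by rewrite fqE hornerD hornerM hornerX hornerC ew.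
have Rw : R' (- (w1 * c1^-1), - (w2 * c2^-1)).
  have : R' (0 - w1 * c1^-1, 0 - w2 * c2^-1).
    apply: (R'B (0, 0) (_, _)); last exact: (R'M (_, _) (_, _)).
    by apply: RR'; have := RB _ _ R1 R1; rewrite subrr.
  by rewrite !sub0r.
have inv1 : - (w1 * c1^-1) = x^-1.
  apply: (mulIf x0); rewrite mulVf // mulNr mulrAC.
  by move/eqP: q1; rewrite addr_eq0 => /eqP ->; rewrite mulNr opprK divff.
have : R' (- (w1 * c1^-1) * x, - (w2 * c2^-1) * x') := R'M _ _ Rw Rx.
rewrite inv1 mulVf // => R11.
have : R' (1 - 1, - (w2 * c2^-1) * x' - 1) := R'B _ _ R11 (RR' _ R1).
rewrite subrr => /R'0/eqP; rewrite subr_eq0 => /eqP e2.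
have x'0 : x' != 0 by apply/eqP => x'0; move/eqP: e2; rewrite x'0 mulr0 eq_sym oner_eq0.
move: Rw; rewrite inv1; congr (R' (_, _)); apply: (mulIf x'0).
by rewrite e2 mulVf.
Qed.

End Fixed.
End PartialIso.

Section Extension.
Variable F : closedFieldType.
Implicit Types R : set (F * F).

Lemma piso_total R0 : partial_iso R0 -> (forall a, algebraic_over (pdom R0) a) ->
  exists R, [/\ partial_iso R, R0 `<=` R & forall a, pdom R a].
Proof.
move=> hR0 alg.
pose P R := R = set0 \/ (partial_iso R /\ R0 `<=` R).
have [C CP Ctot|A [PA Amax]] := @Zorn_bigcup _ P.
  have [[X CX [x Xx]]|none] := pselect (exists2 X, C X & exists x, X x); last first.
    left; apply/seteqP; split=> // x [X CX Xx]; apply: none.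
    by exists X => //; exists x.
  right; have pX Y y : C Y -> Y y -> partial_iso Y /\ R0 `<=` Y.
    by move=> CY Yy; have [Y0|] := CP Y CY; first by rewrite Y0 in Yy.
  have join y z : (\bigcup_(X in C) X) y -> (\bigcup_(X in C) X) z -> exists Y, [/\ C Y, Y y & Y z].
    move=> [Y CY Yy] [Z CZ Zz]; have [YZ|ZY] := Ctot _ _ CY CZ.
      by exists Z; split=> //; exact: YZ.
    by exists Y; split=> //; exact: ZY.
  have [hX X0] := pX _ _ CX Xx; split; last by move=> y /X0 Xy; exists X.
  split.
  - by exists X => //; case: hX.
  - move=> y z hy hz; have [Y [CY Yy Yz]] := join _ _ hy hz.
    by have [[_ YB _ _ _] _] := pX _ _ CY Yy; exists Y => //; exact: YB.
  - move=> y z hy hz; have [Y [CY Yy Yz]] := join _ _ hy hz.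
    by have [[_ _ YM _ _] _] := pX _ _ CY Yy; exists Y => //; exact: YM.
  - move=> a b [Y CY Yy].
    by have [[_ _ _ YV _] _] := pX _ _ CY Yy; exists Y => //; exact: YV.
  - move=> b [Y CY Yy].
    by have [[_ _ _ _ Y0] _] := pX _ _ CY Yy; exact: Y0.
have [A0|[hA R0A]] := PA.
  have [R01 _ _ _ _] := hR0; exfalso; apply: (Amax R0); last by right; split.
  by split; [rewrite A0 | move=> h; have := h _ R01; rewrite A0].
exists A; split=> // a.
have alga : algebraic_over (pdom A) a.
  by apply: algebraic_over_mono (alg a) => x [b Rxb]; exists b; exact: R0A.
have [R' [hR' AR' [b R'b]]] := piso_extend hA alga.
exists b; apply: contrapT => nA; apply: (Amax R'); last first.
  by right; split=> //; exact: subset_trans AR'.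
by split=> // /(_ _ R'b).
Qed.

End Extension.

Section Automorphism.
Variables (k : fieldType) (F : closedFieldType) (iota : {rmorphism k -> F}).
Local Notation cl := (adjoin_acl (range iota)).

Lemma piso_gal (R : set (F * F)) : partial_iso R -> (forall a, R (iota a, iota a)) ->
  (forall a, algebraic_over (pdom R) a) ->
  (forall b, algebraic_over [set b | exists a, R (a, b)] b) ->
  exists s : gal iota, forall a b, R (a, b) -> s a = b.
Proof.
move=> hR hk algd algr; have [T [hT RT /choice[f hf]]] := piso_total hR algd.
have fE a b : T (a, b) -> f a = b by exact: piso_unique.
have [T1 TB TM _ _] := hT.
have fB : GRing.zmod_morphism f by move=> x y; apply: fE; exact: (TB _ _ (hf x) (hf y)).
have fM : GRing.monoid_morphism f.
  by split=> [|x y]; apply: fE; [exact: T1 | exact: (TM _ _ (hf x) (hf y))].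
pose fzm := GRing.isZmodMorphism.Build F F f fB.
pose fmm := GRing.isMonoidMorphism.Build F F f fM.
pose fr : {rmorphism F -> F} := HB.pack f fzm fmm.
(* [b] is a root of a polynomial transported from some [q]; as [q] splits in F, [b] is the image of
   one of its roots. *)
have fsurj b : exists a, f a = b.
  have [p [p0 hp] pb] := algr b.
  have /choice[g hg] : forall i, exists a, p`_i = f a.
    by move=> i; have [a Rab] := hp i; exists a; apply/esym/fE/RT.
  pose q := \poly_(i < size p) g i.
  have pq : p = map_poly fr q.
    apply/polyP => i; rewrite coef_map coef_poly; case: ltnP => [_|ip]; first exact: hg.
    by rewrite nth_default //; apply: esym; exact: (rmorph0 fr).
  have [r er] := closed_field_poly_normal q.
  move: pb p0; rewrite pq er map_polyZ rmorph_prod /= => pb p0.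
  have l0 : f (lead_coef q) != 0 by apply: contraNneq p0 => l0; rewrite /= l0 scale0r.
  move: pb; rewrite rootZ // (eq_bigr (fun z => 'X - (f z)%:P)); last first.
    move=> z _; transitivity (map_poly fr 'X - map_poly fr z%:P); first exact: (rmorphB (map_poly fr)).
    by rewrite map_polyX map_polyC.
  rewrite -(big_map f xpredT (fun z => 'X - z%:P)) root_prod_XsubC => /mapP[a _ ->].
  by exists a.
have fbij : bijective f.
  have /choice[g hg] := fsurj; exists g => // x; apply: (fmorph_inj fr); exact: hg.
have fk a : f (iota a) = iota a by apply/fE/RT/hk.
have hs : `[< is_automorphism iota f >] by apply/asboolP; split.
by exists (Gal hs) => a b /RT /fE.
Qed.

(** As y and y' are transcendental over C, substituting y' for y is an isomorphism from C(y) to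
    C(y'), and F is algebraic over both fields. *)
Lemma transc_gal (C : set F) y y' : cl C = C -> ~ C y -> ~ C y' ->
  (forall x, cl (C `|` [set y]) x) -> cl (C `|` [set y]) `<=` cl (C `|` [set y']) ->
  exists s : gal iota, (forall x, C x -> s x = x) /\ s y = y'.
Proof.
move=> clC ny ny' hy yy'.
have hC : subfield C by rewrite -clC; exact: cl_subfield.
pose S := subfield_pred hC.
have nz (z : F) (g : {poly F}) : ~ C z -> g \is a polyOver S -> g != 0 -> g.[z] != 0.
  move=> nz hg g0; apply/eqP => gz; apply: nz; apply: (closed_acl clC); exists g; last exact/rootP.
  by split=> //; apply/subfield_polyOverP.
pose R : set (F * F) := [set x | exists f g : {poly F}, [/\ f \is a polyOver S, g \is a polyOver S,
  g != 0 & x = (f.[y] / g.[y], f.[y'] / g.[y'])]].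
have RC (f : {poly F}) : f \is a polyOver S -> R (f.[y], f.[y']).
  by move=> hf; exists f, 1; split; rewrite ?rpred1 ?oner_eq0 ?hornerC ?divr1.
have hR : partial_iso R.
  split.
  - by exists 1, 1; split; rewrite ?rpred1 ?oner_eq0 ?hornerC ?divr1.
  - move=> _ _ [f [g [hf hg g0 ->]]] [f' [g' [hf' hg' g'0 ->]]].
    exists (f * g' - f' * g), (g * g'); rewrite mulf_neq0 // ?rpredB ?rpredM //; split=> //.
    by rewrite /= !hornerE; congr (_, _); rewrite subf_div // nz.
  - move=> _ _ [f [g [hf hg g0 ->]]] [f' [g' [hf' hg' g'0 ->]]].
    exists (f * f'), (g * g'); rewrite mulf_neq0 // ?rpredM //; split=> //.
    by rewrite /= !hornerE; congr (_, _); rewrite mulf_div.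
  - move=> a b [f [g [hf hg g0 [-> ->]]]]; have [f0|f0] := eqVneq f 0.
      by exists 0, 1; rewrite f0 !horner0 !mul0r invr0; split; rewrite ?rpred0 ?rpred1 ?oner_eq0.
    by exists g, f; rewrite !invf_div; split.
  - move=> b [f [g [hf hg g0 [/esym/eqP h ->]]]].
    move: h; rewrite mulf_eq0 invr_eq0 (negPf (nz _ _ ny hg g0)) orbF => fy.
    have [->|f0] := eqVneq f 0; first by rewrite horner0 mul0r.
    by have := nz _ _ ny hf f0; rewrite fy.
have fC c : C c -> R (c, c).
  by move=> Cc; have := RC c%:P; rewrite !hornerC polyOverC; apply; apply/subfield_predE.
have Ry : R (y, y') by have := RC 'X; rewrite !hornerX polyOverX; exact.
have frac z (p q : {poly F}) : (forall i, C p`_i) -> (forall i, C q`_i) -> q.[z] != 0 ->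
    [/\ p \is a polyOver S, q \is a polyOver S & q != 0].
  move=> hp hq q0; split; [exact/subfield_polyOverP | exact/subfield_polyOverP |].
  by apply: contraNneq q0 => ->; rewrite horner0.
have [s hs] : exists s : gal iota, forall a b, R (a, b) -> s a = b.
  apply: piso_gal hR _ _ _.
  - by move=> a; apply: fC; rewrite -clC; apply: base_cl; exists a.
  - move=> a; have := hy a; rewrite (cl_closedE clC); apply: algebraic_over_mono.
    move=> x /(adjoin1P hC)[p [q [hp hq q0 ->]]]; have [h1 h2 h3] := frac _ _ _ hp hq q0.
    by exists (p.[y'] / q.[y']), p, q; split.
  - move=> a; have := yy' _ (hy a); rewrite (cl_closedE clC); apply: algebraic_over_mono.
    move=> x /(adjoin1P hC)[p [q [hp hq q0 ->]]]; have [h1 h2 h3] := frac _ _ _ hp hq q0.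
    by exists (p.[y] / q.[y]), p, q; split.
by exists s; split=> [x /fC/hs|]; last exact: hs.
Qed.

End Automorphism.

(** * The module structure of [Vv] *)

Section Bases.
Variables (F : fieldType) (k0 : set F).
Local Notation cl := (adjoin_acl k0).
Implicit Types I T : set F.

Definition cl_indep I := forall u, I u -> ~ cl (I `\ u) u.

Lemma cl_indepU1 I x : cl_indep I -> ~ cl I x -> cl_indep (I `|` [set x]).
Proof.
move=> iI nx u [Iu|->] hu; last first.
  by apply: nx; apply: cl_mono hu => z [[Iz //|->] []].
have ux : u != x by apply/eqP => ux; apply: nx; rewrite -ux; exact: sub_cl.
have {hu}hu : cl ((I `\ u) `|` [set x]) u.
  by apply: cl_mono hu => z [[Iz|->] zu]; [left | right].
apply: nx; apply: cl_mono (cl_exchange hu (iI u Iu)) => z [[Iz _]|->] //.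
Qed.

Lemma basis_extension I T : cl_indep I -> I `<=` T ->
  exists J, [/\ I `<=` J, J `<=` T, cl_indep J & T `<=` cl J].
Proof.
(* Zorn is applied to the part added to [I], so that the empty chain is covered by the independence
   of [I] itself. *)
move=> iI IT; pose P A := A `<=` T /\ cl_indep (I `|` A).
have [C CP Ctot|A [[AT iA] Amax]] := @Zorn_bigcup _ P.
  split; first by move=> x [X CX Xx]; have [XT _] := CP X CX; exact: XT.
  have [[X0 CX0]|none] := pselect (exists X, C X); last first.
    have -> : \bigcup_(X in C) X = set0.
      by apply/seteqP; split=> // x [X CX _]; apply: none; exists X.
    by rewrite setU0.
  have fin (s : seq F) : [set` s] `<=` I `|` \bigcup_(X in C) X ->
      exists2 X, C X & [set` s] `<=` I `|` X.
    elim: s => [|a s IHs] h; first by exists X0 => // y /=; rewrite inE.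
    have [|X CX sX] := IHs; first by move=> y ys; apply: h; rewrite /= inE (_ : y \in s) ?orbT.
    have [Ia|[Y CY Ya]] := h a (mem_head _ _).
      by exists X => // y /=; rewrite inE => /predU1P[->|/sX //]; left.
    have [XY|YX] := Ctot _ _ CX CY.
      exists Y => // y /=; rewrite inE => /predU1P[->|/sX[Iy|/XY Yy]]; by [right | left].
    exists X => // y /=; rewrite inE => /predU1P[->|/sX //]; right; exact: YX.
  move=> u Uu hu; have [s sU us] := cl_fin hu.
  have [|X CX sX] := fin (u :: s).
    by move=> y /=; rewrite inE => /predU1P[->|/sU[]].
  have [_ iX] := CP X CX; apply: (iX u); first by apply: sX; exact: mem_head.
  apply: cl_mono us => y ys; split; first by apply: sX; rewrite /= inE (_ : y \in s) ?orbT.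
  by have [] := sU y ys.
exists (I `|` A); split=> //; first by move=> x [/IT|/AT].
move=> x Tx; apply: contrapT => nx; apply: (Amax (A `|` [set x])); last first.
  split; first by move=> y [/AT|->].
  by rewrite setUA; exact: cl_indepU1.
split=> [|h]; first by move=> y; left.
by apply: nx; apply: sub_cl; right; apply: h; right.
Qed.

End Bases.

Lemma image_subfield (k F : fieldType) (iota : {rmorphism k -> F}) (g : gal iota) (M : set F) :
  subfield M -> subfield (g @` M).
Proof.
move=> hM; split=> [|z1 z2|z1 z2].
- by apply/mem_set; exists 1; [exact: subfield1 | rewrite rmorph1].
- move=> /set_mem[w1 h1 <-] /set_mem[w2 h2 <-]; apply/mem_set; exists (w1 - w2).
    exact: subfieldB.
  by rewrite rmorphB.
- move=> /set_mem[w1 h1 <-] /set_mem[w2 h2 <-]; apply/mem_set; exists (w1 / w2).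
    exact: subfield_div.
  by rewrite fmorph_div.
Qed.

Section Submodule.
Variables (k : fieldType) (F : closedFieldType) (iota : {rmorphism k -> F}).
Variable char0 : [pchar F] =i pred0.
Variable v : valuation_ring iota.
Local Notation O := (vring_pred v).
Local Notation cl := (adjoin_acl (range iota)).
Local Notation m := (vmax v).
Variables (B : set F) (t : F).
Hypotheses (hB : residual_basis v B t) (mt : m t).
Variable V : semilinear_rep iota.
Local Notation act := (@slin_act _ _ _ V).
Add Ring Fring : (com_ring_theory F).

Lemma slin_actB s (x y : V) : act s (x - y) = act s x - act s y.
Proof. by rewrite slin_actD -scaleN1r slin_actZ rmorphN1 scaleN1r. Qed.

Lemma fixed_scale (M : set F) a (x : V) : M a -> fixed act (gal_over M) x ->
  fixed act (gal_over M) (a *: x).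
Proof. by move=> Ma hx s sM; rewrite slin_actZ sM // hx. Qed.

Lemma fixed_mono (M N : set F) (x : V) : M `<=` N -> fixed act (gal_over M) x ->
  fixed act (gal_over N) x.
Proof. by move=> MN hx s sN; apply: hx => y /MN; exact: sN. Qed.

Lemma fixed_conj (M : set F) (h : gal iota) (x : V) : act h x = x ->
  fixed act (gal_over M) x -> fixed act (gal_over (h @` M)) x.
Proof.
have [a1 aM] := slin_actP V; move=> hx fx s sM.
have hVx : act (h^-1)%g x = x by rewrite -{1}hx -aM mulVg a1.
have : act (h^-1 * s * h)%g x = x.
  by apply: fx => y My; rewrite !galM sM ?galVK //; exists y.
by rewrite !aM hx => e; rewrite -{2}hx -{2}e -aM mulgV a1.
Qed.

(** * Multiples of a vector fixed over a closed subfield of O_v *)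

Section OneFixed.
Variables (M : set F) (clM : cl M = M) (MO : M `<=` [set` O]).
Variables (x : V) (fx : fixed act (gal_over M) x).

Let hM : subfield M. Proof. by rewrite -clM; exact: cl_subfield. Qed.
Let kM : range iota `<=` M. Proof. by rewrite -clM; exact: base_cl. Qed.

Lemma Vv_scale_free a : a \in O -> (forall e, M e -> ~ m (a - e)) -> Vv act v (a *: x).
Proof.
move=> Oa na; apply: (Vv_fixed (M := cl (M `|` [set a]))).
- exact: cl_subfield.
- exact: base_cl.
- exact: vring_adjoin.
apply: fixed_scale; first by apply: sub_cl; right.
by apply: fixed_mono fx => y My; apply: sub_cl; left.
Qed.

Section Full.
Hypothesis Mfull : forall u, u \in O -> exists2 e, M e & m (u - e).

(** If [I] were finite, M would lie in the closure of E(t) for an E that misses a member u of the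
    residual basis. All residues of M would then be in E, although [Mfull] provides that of u. *)
Lemma full_infinite (I : set F) : M `<=` cl I -> forall s : seq F, exists2 y, I y & y \notin s.
Proof.
have [BO _ _ _ t0] := hB.
move=> MI s; apply: contrapT => H.
have Is y : I y -> y \in s.
  by move=> Iy; apply: contrapT => ys; apply: H; exists y => //; exact/negP.
have [u Bu hu] := residual_split hB s.
set E := cl (B `\ u) in hu.
have EO : E `<=` [set` O] by move=> y Ey; apply: BO; apply: cl_mono Ey => z [].
have clE : cl E = E by rewrite /E cl_cl.
have Ou : u \in O by apply: BO; exact: sub_cl.
have [e Me me] := Mfull Ou.
have [|e' Ee' me'] := cl_residue clE EO mt t0 (y := e) _ (MO Me).
  by apply: cl_min (MI _ Me) => z /Is /hu.
apply: (residual_notin_sub hB Bu Ee').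
by rewrite -(subrK e u) -addrA; apply: vmaxD.
Qed.

Lemma Vv_scale_max a : m a -> Vv act v (a *: x).
Proof.
move=> ma.
have [S0 hS0] : exists S0 : seq F, fixed act (gal_over [set` S0]) x.
  have [a1 aM] := slin_actP V; have [l hl] := @slin_smooth _ _ _ V x 1%g (a1 x).
  by exists l => s /hl /=; rewrite mul1g.
(* A transcendence basis [I] of M is extended to a basis [J] of F. The vector x is supported on a
   finite part [s] of [J], and [y] in [I] is chosen outside it, so x is fixed over the closure C of
   the other basis elements. *)
have [I [_ IM iI MI]] : exists I, [/\ set0 `<=` I, I `<=` M, cl_indep (range iota) I & M `<=` cl I].
  by apply: basis_extension => // u [].
have [J [IJ _ iJ JF]] := basis_extension iI (@subsetT _ I).
have JF' z : cl J z by exact: JF.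
have [s sJ hs] := cl_fin_seq (fun z (_ : z \in S0) => JF' z).
have [y Iy ys] := full_infinite MI s; have My := IM y Iy; have Jy := IJ y Iy.
pose C := cl (J `\ y).
have clC : cl C = C by rewrite /C cl_cl.
have hC : subfield C by exact: cl_subfield.
have S0C : [set` S0] `<=` C.
  move=> z /hs; apply: cl_mono => w ws; split; first exact: sJ.
  by move=> /= wy; case/negP: ys; rewrite -wy.
have ny : ~ C y by exact: iJ.
have Fy z : cl (C `|` [set y]) z.
  apply: cl_mono (JF' z) => w Jw; have [->|wy] := pselect (w = y); first by right.
  by left; apply: sub_cl.
(* The move from y to y + b needs y + b outside C. As 2 is invertible, y + a and y - a cannot both
   lie in C, and the sign of [a] does not matter for the claim. *)
suff key b : m b -> ~ C (y + b) -> Vv act v (b *: x).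
  have [Ca|] := pselect (C (y + a)); last exact: key.
  rewrite -[a]opprK scaleNr; apply: VvN; first exact: slin_actB.
  apply: key; first exact: vmaxN.
  move=> Cb; apply: ny; have two0 : (2%:R : F) != 0 by rewrite ((pcharf0P F).1 char0).
  have -> : y = (y + a + (y - a)) / 2%:R.
    by apply: (mulIf two0); rewrite divfK // mulr_natr mulr2n; mc_ring F.
  apply: (subfield_div hC); first exact: subfieldD.
  by apply: (subfieldD hC); exact: subfield1.
move=> mb nyb.
have yy' : cl (C `|` [set y]) `<=` cl (C `|` [set (y + b)]).
  apply: cl_min => z [Cz|->]; first by apply: sub_cl; left.
  by apply: cl_exchange (Fy _) _; rewrite clC.
have [g [gC gy]] := transc_gal clC ny nyb Fy yy'.
have gx : act g x = x by apply: hS0 => z /S0C; exact: gC.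
have gO z : M z -> g z \in O.
  (* [D] is the field of elements of M that g fixes modulo the maximal ideal. It contains k(I), so g
     maps k(I) into O_v, and then M as well, since O_v is closed under algebraic extension of
     subfields. *)
  pose D := [set z | M z /\ m (g z - z)].
  have hD : subfield D.
    split=> [|z1 z2|z1 z2].
    - by apply/mem_set; rewrite /D /= rmorph1 subrr; split; [exact: subfield1 | exact: vmax0].
    - move=> /set_mem[M1 m1] /set_mem[M2 m2]; apply/mem_set; split; first exact: subfieldB.
      by rewrite rmorphB /= (_ : _ - _ = g z1 - z1 - (g z2 - z2)); [exact: vmaxB | mc_ring F].
    - move=> /set_mem[M1 m1] /set_mem[M2 m2]; apply/mem_set; split; first exact: subfield_div.
      have [->|z20] := eqVneq z2 0; first by rewrite !invr0 !mulr0 rmorph0 subrr; exact: vmax0.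
      have U2 : vunit v z2 by exact: (subfield_vunit hM).
      have Ug := vunit_congr U2 m2.
      have [OV2 _] := vunit_inv U2; have [OVg _] := vunit_inv Ug.
      rewrite fmorph_div /= subf_div ?(vunit_neq0 Ug) // invfM; apply: vmaxMr; last exact: rpredM.
      rewrite (_ : _ - _ = (g z1 - z1) * z2 - z1 * (g z2 - z2)); last by mc_ring F.
      by apply: vmaxB; [apply: vmaxMr => //; exact: MO | apply: vmaxMl => //; exact: MO].
  have ID : adjoin (range iota) I `<=` D.
    apply: (adjoin_min hD) => [_ [c _ <-]|z' Iz'].
      by split; [apply: kM; exists c | rewrite gal_iota subrr; exact: vmax0].
    split; first exact: IM.
    have [->|zy] := pselect (z' = y); first by rewrite gy addrAC subrr add0r.
    by rewrite gC ?subrr; [exact: vmax0 | apply: sub_cl; split=> //; exact: IJ].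
  move=> /MI hz; have hA := adjoin_subfield (range iota) I.
  apply: (vring_acl (image_subfield g hA)).
    move=> _ [w /ID[Mw mw] <-]; rewrite /= -(subrK w (g w)) rpredD ?(vmaxO mw) //; exact: MO.
  by apply: acl_map hz => w hw; exists w.
have -> : b *: x = g y *: x - y *: x by rewrite gy scalerDl [RHS]addrC addKr.
apply: VvB; first exact: slin_actB.
  (* As g fixes x, the vector x is fixed over g(M) too, and so is its multiple by g(y). *)
  apply: (Vv_fixed (M := g @` M)).
  - exact: image_subfield.
  - by move=> _ [c _ <-]; exists (iota c); [apply: kM; exists c | exact: gal_iota].
  - by move=> _ [z Mz <-]; exact: gO.
  - by apply: fixed_scale; [exists y | exact: fixed_conj].
by apply: (Vv_fixed hM kM MO); exact: fixed_scale.
Qed.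

End Full.

Lemma Vv_scale_fixed a : a \in O -> Vv act v (a *: x).
Proof.
move=> Oa; have [[e [Me me]]|na] := pselect (exists e, M e /\ m (a - e)); last first.
  by apply: Vv_scale_free => // e Me me; apply: na; exists e.
rewrite -(subrK e a) scalerDl; apply: VvD; last first.
  by apply: (Vv_fixed hM kM MO); exact: fixed_scale.
have [full|nfull] := pselect (forall u, u \in O -> exists2 e, M e & m (u - e)).
  exact: Vv_scale_max.
have [u [Ou nu]] : exists u, u \in O /\ forall e, M e -> ~ m (u - e).
  apply: contrapT => H; apply: nfull => u Ou; apply: contrapT => nu; apply: H.
  by exists u; split=> // e' Me' me'; apply: nu; exists e'.
rewrite -[a - e](addrK u) scalerBl; apply: VvB; first exact: slin_actB.
  apply: Vv_scale_free; first by rewrite rpredD ?(vmaxO me).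
  by move=> e' Me' me'; apply: (nu e' Me'); rewrite (_ : u - e' = a - e + u - e' - (a - e)); [exact: vmaxB | mc_ring F].
exact: Vv_scale_free.
Qed.

End OneFixed.

Lemma Vv_submodule : is_submodule (\val : {rmorphism vring v -> F}) (Vv act v).
Proof.
split=> [|a x y [n [w [hw ->]]] hy]; first exact: Vv0.
apply: VvD => //; rewrite scaler_sumr; apply: Vv_sum => i _ _.
have [M [hM kM MO fw]] := hw i.
apply: (Vv_scale_fixed (M := cl M)); last exact: valP.
- by rewrite cl_cl.
- by apply: cl_sub_vring => z hz; apply: MO; apply/mem_set; exact: (adjoin_min hM kM (fun _ h => h) hz).
- by apply: fixed_mono fw; exact: sub_cl.
Qed.

End Submodule.

(** * The natural maps *)

Section NaturalMap.

Lemma tens_vring (k F : fieldType) (iota : {rmorphism k -> F}) (v : valuation_ring iota)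
    (N : lmodType (vring v)) (z : tensor (\val : {rmorphism vring v -> F}) N) :
  exists n b, z = tens (\val : {rmorphism vring v -> F}) n b.
Proof.
set f := (\val : {rmorphism vring v -> F}).
elim/tens_ind: z => [|x y [n [b ->]] [n' [b' ->]]|n b]; last by exists n, b.
  by exists 0, 0; apply: (addrI (tens f 0 0)); rewrite addr0 -tensDr addr0.
have tB1 (p p' : N) c : tens f p c - tens f p' c = tens f (p - p') c.
  by apply/eqP; rewrite subr_eq -tensDl subrK.
have tM (p : N) (c : F) d : d \in vring_pred v -> exists p', tens f p (d * c) = tens f p' c.
  by move=> Od; exists (Vring Od *: p); rewrite tensZ.
have [->|b0] := eqVneq b 0.
  by have [p' e'] := tM n b' 0 (rpred0 _); rewrite mul0r in e'; exists (p' - n'), b'; rewrite e' tB1.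
have [->|b'0] := eqVneq b' 0.
  by have [p' e'] := tM n' b 0 (rpred0 _); rewrite mul0r in e'; exists (n - p'), b; rewrite e' tB1.
(* The quotient of the scalars that lies in O_v is moved to the left factor; both tensors then share
   their right factor. *)
have /orP[h|h] := vring_val v (b / b').
  by have [p' e'] := tM n b' _ h; rewrite divfK // in e'; exists (p' - n'), b'; rewrite e' tB1.
rewrite invf_div in h; have [p' e'] := tM n' b _ h; rewrite divfK // in e'.
by exists (n - p'), b; rewrite e' tB1.
Qed.

Lemma natural_map_vring_inj (k F : fieldType) (iota : {rmorphism k -> F}) (v : valuation_ring iota)
    (V : lmodType F) (N : submodule (\val : {rmorphism vring v -> F}) V) :
  injective (natural_map N).
Proof.
move=> x y e; apply/eqP; rewrite -subr_eq0; apply/eqP.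
have : natural_map N (x - y) = 0 by rewrite raddfB /= e subrr.
have [n [b ->]] := tens_vring (x - y); rewrite natural_map_tens.
have t0 z : tens (\val : {rmorphism vring v -> F}) z 0 = 0 :> tensor _ (submod_sort N).
  by apply: (addIr (tens _ z 0)); rewrite -tensDr !add0r.
have [->|b0] := eqVneq b 0; first by rewrite t0.
move=> /eqP; rewrite scaler_eq0 (negPf b0) /= => /eqP n0.
have -> : n = 0 by apply: val_inj.
by rewrite -(scale0r (0 : submod_sort N)) tensZ rmorph0 mul0r t0.
Qed.

(** Stated for a general ring A in order to cover both O_v with V_v and k with Gamma(V). *)
Lemma natural_map_surj (A : comNzRingType) (F : fieldType) (f : {rmorphism A -> F})
    (V : lmodType F) (N : submodule f V) (W : lmodType rat) (char0 : [pchar F] =i pred0)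
    (q : tensor (ratF char0) W -> V) :
  (forall a x y, q (a *: x + y) = a *: q x + q y) -> (forall y, exists x, q x = y) ->
  (forall w, submod_set N (q (tens (ratF char0) w 1))) ->
  forall y, exists x, natural_map N x = y.
Proof.
move=> qlin qsurj hN y; have [z <-] := qsurj y.
have qB x x' : q (x - x') = q x - q x'.
  by have := qlin (-1) x' x; rewrite !scaleN1r addrC => ->; rewrite addrC.
have q0 : q 0 = 0 by have := qB 0 0; rewrite !subrr.
elim/tens_ind: z => [|x x' [u eu] [u' eu']|w b].
- by exists 0; rewrite raddf0 q0.
- by exists (u - u'); rewrite raddfB qB -eu -eu'.
- have hw : q (tens (ratF char0) w 1) \in submod_pred N by exact/mem_set/hN.
  exists (tens f (SubmodElt hw) b); rewrite natural_map_tens /=.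
  have := qlin b (tens (ratF char0) w 1) 0.
  by rewrite !addr0 q0 addr0 scale_tens mulr1.
Qed.

End NaturalMap.

Theorem mainTheorem5
  (k F : closedFieldType) (iota : {rmorphism k -> F})
  (char0 : [pchar F] =i pred0)
  (trdeg_F : exists x : nat -> F,
     injective x /\ transc_basis (range iota) (range x))
  (v : valuation_ring iota) (hv : discrete_rank_one v)
  (W : smooth_rep iota) (hW : in_I_G W)
  (V : semilinear_rep iota) (q : tensor_rep char0 W -> V)
  (hq : is_morphism q) (q_surj : forall y : V, exists x, q x = y) :
  (exists hVv : is_submodule (\val : {rmorphism vring v -> F})
                             (Vv (@slin_act k F iota V) v),
     bijective (natural_map (Submodule hVv))) /\
  (forall y : V, exists x, natural_map (Gamma V) x = y).
Proof.
have [x [xi hx]] := trdeg_F; have [qlin qact] := hq.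
(* Sending w to q(w (x) 1) is additive and equivariant, since automorphisms fix 1, so W_v' is
   carried into V_v'. All v' are needed because Gamma(V) is an intersection. *)
have hVv v' w : discrete_rank_one v' -> Vv (@slin_act k F iota V) v' (q (tens (ratF char0) w 1)).
  move=> hv'; have [B [t [hB mt]]] := exists_residual_basis xi hx hv'.
  have [n [u [hu ->]]] := Vv_in_I_G char0 hB mt hW w.
  exists n, (fun i => q (tens (ratF char0) (u i) 1)); split.
    move=> i; have [M [hM kM MO fu]] := hu i; exists M; split=> // s sM.
    by rewrite -qact /= tensor_act_tens fu // rmorph1.
  pose phi (w' : W) := q (tens (ratF char0) w' 1).
  have phiD w1 w2 : phi (w1 + w2) = phi w1 + phi w2.
    by rewrite /phi tensDl; have := qlin 1 (tens (ratF char0) w1 1) (tens (ratF char0) w2 1); rewrite !scale1r.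
  have phi0 : phi 0 = 0 by apply: (addrI (phi 0)); rewrite -phiD !addr0.
  exact: (big_morph phi phiD phi0).
have [B [t [hB mt]]] := exists_residual_basis xi hx hv.
split; last by apply: (natural_map_surj qlin q_surj) => w v' hv'; exact: hVv.
exists (Vv_submodule char0 hB mt V).
have /choice[g hg] : forall y, exists z, natural_map (Submodule (Vv_submodule char0 hB mt V)) z = y.
  by apply: (natural_map_surj qlin q_surj) => w; exact: hVv.
by exists g => // z; apply: natural_map_vring_inj; rewrite hg.
Qed.
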